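(* Let $X=(X_s)_{s\in[0,T]}$ be a centered continuous Gaussian process, generated by a linear bounded operator $u:H\to C([0,T])$ on a separable Hilbert space $H$, which is a Markov process with $R_X(s,t)=\mathbb E X_sX_t\ne0$ for all $0<s,t<T$, and let $f,g:[0,T]\to\mathbb R$ be the functions with $R_X(s,t)=f(s\wedge t)\,g(s\vee t)$ for $0\le s,t\le T$. Let $A=\{a_1,\dots,a_N\}\subset C([0,T])^*$ be a finite set of conditions, $X^{(A)}$ the conditioned process of $X$ with respect to $A$, $(\mathcal F^{X^{(A)}}_s)_{s\in[0,T]}$ its natural filtration, $I^{(A),i}_s=\int_0^sX^{(A)}_x\,a_i(dx)$ for $1\le i\le N$, and $(e_i)_{i=1}^N$ an orthonormal basis of the detached subspace $H_{(A)}$. Define the $(N+1)\times(N+1)$ matrix $$D_s=\begin{pmatrix} g(s)&(ue_1)(s)&\cdots&(ue_N)(s)\\ \int_{s+}^Tg(x)\,a_1(dx)&\int_{s+}^T(ue_1)(x)\,a_1(dx)&\cdots&\int_{s+}^T(ue_N)(x)\,a_1(dx)\\ \vdots&\vdots&\ddots&\vdots\\ \int_{s+}^Tg(x)\,a_N(dx)&\int_{s+}^T(ue_1)(x)\,a_N(dx)&\cdots&\int_{s+}^T(ue_N)(x)\,a_N(dx)\end{pmatrix}$$ and the random vector $d_s=\big(X^{(A)}_s,-I^{(A),1}_s,\dots,-I^{(A),N}_s\big)^\top$. Then for every $s<t$ (in $[0,T]$) there are $\mathcal F^{X^{(A)}}_s$-measurable random variables $\xi_0,\dots,\xi_N$ such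 that $$\mathbb E\big[X^{(A)}_t\mid\mathcal F^{X^{(A)}}_s\big]=\xi_0\,g(t)+\sum_{i=1}^N\xi_i\,(ue_i)(t).$$ If moreover the matrix $D_s$ is invertible, then $\xi=(\xi_0,\dots,\xi_N)^\top$ is given by $\xi=D_s^{-1}d_s$.
   Context: $C([0,T])$ is the Banach space of continuous real functions on $[0,T]$ with the supremum norm. A condition is an element $a$ of $C([0,T])^*$, identified with a finite signed Borel measure on $[0,T]$, $a(f)=\int f\,da$. $\int_0^s\cdot\,a_i(dx)$ is over $[0,s]$ and $\int_{s+}^T\cdot\,a_i(dx)$ is over $(s,T]$. It is known (Borisov) that for a Gaussian Markov process $X$ with $R_X(s,t)\ne0$ for $0<s,t<T$ there are, up to a constant, uniquely defined functions $f,g:[0,T]\to\mathbb R$ such that $h=f/g$ (convention $0/0=0$) is non-negative and non-decreasing on $[0,T]$ and $R_X(s,t)=f(s\wedge t)g(s\vee t)$; these are the $f,g$ used. ''$X$ is generated by $u$'' means that for every orthonormal basis $(h_i)_{i\ge1}$ of $H$ and independent standard normal $(\omega_i)_{i\ge1}$, the series $\sum_i\omega_i(uh_i)$ converges almost surely in $C([0,T])$ and has the law of $X$. Reduced Hilbert space: $H^{(A)}=\{h\in H: a(uh)=0\text{ for all }a\in A\}$. Detached subspace: $H_{(A)}=H\ominus H^{(A)}=\operatorname{span}\{u^*a:a\in A\}$ with $u^*$ the adjoint of $u$; if $\dim H_{(A)}<N$, an orthonormal basis of it is padded with zero vectors to a list $e_1,\dots,e_N$. The conditioned process $X^{(A)}$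 (defined only in law) is a continuous Gaussian process such that for all $b_1,\dots,b_n\in C([0,T])^*$ the law of $(b_1(X^{(A)}),\dots,b_n(X^{(A)}))$ is the conditional law of the Gaussian vector $(b_1(X),\dots,b_n(X))$ given $a(X)=0$ for all $a\in A$ in the sense of Gaussian conditioning, i.e. the law of $\big(b_k(X)-\mathbb E[b_k(X)\mid a(X),a\in A]\big)_{k=1}^n$. *)

(* Defs.v *)
From HB Require Import structures.
From mathcomp Require Import all_boot all_order all_algebra finmap.
From mathcomp Require Import all_classical all_reals all_analysis.

Set Implicit Arguments.
Unset Strict Implicit.
Unset Printing Implicit Defensive.

Import Order.TTheory GRing.Theory Num.Theory.
Import numFieldNormedType.Exports.

Local Open Scope classical_set_scope.
Local Open Scope ring_scope.

(* Elements of C([0,T]) are represented by functions R -> R that are continuous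
   on [0,T], and processes indexed by [0,T] by functions R -> Omega -> R; in
   both cases the values at times outside [0,T] are never constrained. *)

Definition condition (R : realType) := {charge set (measurableTypeR R) -> \bar R}.

Lemma hahn_exists (R : realType) (a : condition R) :
  exists PN : set (measurableTypeR R) * set (measurableTypeR R),
    hahn_decomposition a PN.1 PN.2.
Proof. by have [P [N aPN]] := Hahn_decomposition a; exists (P, N). Qed.

(* int_D phi da for the signed measure a, via its Jordan decomposition; the
   Jordan parts do not depend on the Hahn decomposition that is chosen. *)
Definition cint (R : realType) (a : condition R) (D : set R) (phi : R -> R) : R :=
  Rintegral (jordan_pos (projT2 (cid (hahn_exists a)))) D phi
  - Rintegral (jordan_neg (projT2 (cid (hahn_exists a)))) D phi.

(* a(phi) for phi in C([0,T]). *)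
Definition capp (R : realType) (T : R) (a : condition R) (phi : R -> R) : R :=
  cint a `[0, T] phi.

Definition sigma_rv (R : realType) (Omega I : Type) (D : set I)
    (X : I -> Omega -> R) : set (set Omega) :=
  <<s \bigcup_(i in D)
        preimage_set_system setT (X i : Omega -> measurableTypeR R) measurable >>.

(* No completion by null sets. *)
Definition natural_filtration (R : realType) (Omega : Type)
    (X : R -> Omega -> R) (s : R) : set (set Omega) :=
  sigma_rv `[0, s] X.

Definition measurable_wrt (R : realType) (Omega : Type) (G : set (set Omega))
    (Z : Omega -> R) : Prop :=
  forall B : set (measurableTypeR R), measurable B -> G (Z @^-1` B).

(* Z is a version of E[V | G]. *)
Definition is_condexp d (Omega : measurableType d) (R : realType)
    (P : probability Omega R) (G : set (set Omega)) (V Z : Omega -> R) : Prop :=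
  [/\ P.-integrable setT (EFin \o V),
      P.-integrable setT (EFin \o Z),
      measurable_wrt G Z &
      forall E, G E ->
        (\int[P]_(w in E) (Z w)%:E = \int[P]_(w in E) (V w)%:E)%E].

(* N(m, sigma^2); the point mass at m when sigma = 0 (where the library's
   normal_prob is not the degenerate law). *)
Definition gaussian_law (R : realType) (m sigma : R)
    (B : set (measurableTypeR R)) : \bar R :=
  if sigma == 0 then \d_m B else normal_prob m sigma B.

Definition gaussian_rv d (Omega : measurableType d) (R : realType)
    (P : probability Omega R) (V : Omega -> R) : Prop :=
  measurable_fun setT (V : Omega -> measurableTypeR R) /\
  exists m sigma : R, forall B : set (measurableTypeR R), measurable B ->
    P (V @^-1` B) = gaussian_law m sigma B.

Definition continuous_process d (Omega : measurableType d) (R : realType)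
    (T : R) (X : R -> Omega -> R) : Prop :=
  (forall s, s \in `[0, T] ->
     measurable_fun setT (X s : Omega -> measurableTypeR R)) /\
  (forall w, {within `[0, T], continuous (X ^~ w)}).

Definition gaussian_process d (Omega : measurableType d) (R : realType)
    (P : probability Omega R) (T : R) (X : R -> Omega -> R) : Prop :=
  forall (n : nat) (t c : 'I_n -> R), (forall i, t i \in `[0, T]) ->
    gaussian_rv P (fun w => \sum_(i < n) c i * X (t i) w).

Definition centered_process d (Omega : measurableType d) (R : realType)
    (P : probability Omega R) (T : R) (X : R -> Omega -> R) : Prop :=
  forall s, s \in `[0, T] -> ('E_P[X s] = 0)%E.

(* P(X_t in B | F_s) = P(X_t in B | X_s) a.s.: some random variable is a version
   of both conditional probabilities. *)
Definition markov_process d (Omega : measurableType d) (R : realType)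
    (P : probability Omega R) (T : R) (X : R -> Omega -> R) : Prop :=
  forall s t, 0 <= s -> s <= t -> t <= T ->
  forall B : set (measurableTypeR R), measurable B ->
  exists Z : Omega -> R,
    is_condexp P (sigma_rv [set s] X) \1_(X t @^-1` B) Z /\
    is_condexp P (natural_filtration X s) \1_(X t @^-1` B) Z.

Definition covar d (Omega : measurableType d) (R : realType)
    (P : probability Omega R) (X : R -> Omega -> R) (s t : R) : \bar R :=
  ('E_P[fun w => (X s w * X t w)%R])%E.

(* f / g with 0 / 0 = 0 and c / 0 = +oo for c != 0. The latter is needed when
   X_T = 0, e.g. for the Brownian bridge f s = s, g s = T - s. *)
Definition quotient_fg (R : realType) (f g : R -> R) (s : R) : \bar R :=
  if g s == 0 then (if f s == 0 then 0%E else +oo%E) else (f s / g s)%:E.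

Definition markov_factorization d (Omega : measurableType d) (R : realType)
    (P : probability Omega R) (T : R) (X : R -> Omega -> R)
    (f g : R -> R) : Prop :=
  [/\ forall s t, s \in `[0, T] -> t \in `[0, T] ->
        covar P X s t = (f (Num.min s t) * g (Num.max s t))%:E,
      forall s, s \in `[0, T] -> (0 <= quotient_fg f g s)%E &
      forall s t, s \in `[0, T] -> t \in `[0, T] -> s <= t ->
        (quotient_fg f g s <= quotient_fg f g t)%E].

(* The Borel sigma-algebra of C([0,T]) is generated by the evaluations at the
   points of [0,T]. *)
Definition same_path_law d1 (Omega1 : measurableType d1) d2
    (Omega2 : measurableType d2) (R : realType) (P1 : probability Omega1 R)
    (P2 : probability Omega2 R) (T : R) (X1 : R -> Omega1 -> R)
    (X2 : R -> Omega2 -> R) : Prop :=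
  forall B : set (R -> R),
    sigma_rv `[0, T] (fun (s : R) (phi : R -> R) => phi s) B ->
    P1 ((fun w => X1 ^~ w) @^-1` B) = P2 ((fun w => X2 ^~ w) @^-1` B).

Definition same_vector_law d1 (Omega1 : measurableType d1) d2
    (Omega2 : measurableType d2) (R : realType) (P1 : probability Omega1 R)
    (P2 : probability Omega2 R) (n : nat) (V1 : 'I_n -> Omega1 -> R)
    (V2 : 'I_n -> Omega2 -> R) : Prop :=
  forall B : set (n.-tuple (measurableTypeR R)), measurable B ->
    P1 ((fun w => [tuple V1 k w | k < n]) @^-1` B) =
    P2 ((fun w => [tuple V2 k w | k < n]) @^-1` B).

Definition iid_standard_normal d (Omega : measurableType d) (R : realType)
    (P : probability Omega R) (omega : nat -> Omega -> R) : Prop :=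
  [/\ forall i, measurable_fun setT (omega i : Omega -> measurableTypeR R),
      forall i (B : set (measurableTypeR R)), measurable B ->
        P (omega i @^-1` B) = normal_prob 0 1 B &
      forall (J : {fset nat}) (B : nat -> set (measurableTypeR R)),
        (forall i, measurable (B i)) ->
        P (\bigcap_(i in [set` J]) (omega i @^-1` B i)) =
        (\prod_(i <- J) P (omega i @^-1` B i))%E].

(* A real Hilbert space is a complete normed module whose norm comes from a
   positive definite symmetric bilinear form. *)
Definition hilbert_norm (R : realType) (H : completeNormedModType R)
    (ip : {dot H for idfun}) : Prop :=
  forall x : H, ip x x = `|x| ^+ 2.

Definition separable_space (H : topologicalType) : Prop :=
  exists S : set H, countable S /\ dense S.

(* u : H -> C([0,T]), with the supremum norm on C([0,T]). *)
Definition bounded_operator (R : realType) (H : completeNormedModType R) (T : R)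
    (u : H -> R -> R) : Prop :=
  [/\ forall x, {within `[0, T], continuous (u x)},
      forall (c : R) (x y : H) s, s \in `[0, T] ->
        u (c *: x + y) s = c * u x s + u y s &
      exists M : R, forall x s, s \in `[0, T] -> `|u x s| <= M * `|x|].

(* An orthonormal basis of H enumerated by an initial segment of nat, extended
   by zero vectors when H is finite-dimensional. *)
Definition orthonormal_basis (R : realType) (H : completeNormedModType R)
    (ip : {dot H for idfun}) (h : nat -> H) : Prop :=
  [/\ forall i j, h i != 0 -> h j != 0 -> ip (h i) (h j) = (i == j)%:R,
      forall i, h i = 0 -> h i.+1 = 0 &
      forall x, (fun n => \sum_(i < n) ip x (h i) *: h i) @ \oo --> x].

Definition generated_by (R : realType) (H : completeNormedModType R)
    (ip : {dot H for idfun}) (T : R) (u : H -> R -> R) d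
    (Omega : measurableType d) (P : probability Omega R)
    (X : R -> Omega -> R) : Prop :=
  forall (h : nat -> H), orthonormal_basis ip h ->
  forall d' (Omega' : measurableType d') (P' : probability Omega' R)
    (omega : nat -> Omega' -> R), iid_standard_normal P' omega ->
  exists W : R -> Omega' -> R,
    [/\ forall s, s \in `[0, T] ->
          measurable_fun setT (W s : Omega' -> measurableTypeR R),
        {ae P', forall w,
          {uniform `[0, T],
            (fun (n : nat) (s : R) => \sum_(i < n) omega i w * u (h i) s) @ \oo
            --> W ^~ w}} &
        same_path_law P' P T W X].

(* H^(A) *)
Definition reduced_space (R : realType) (H : completeNormedModType R) (T : R)
    (u : H -> R -> R) (N : nat) (a : 'I_N -> condition R) : set H :=
  [set x | forall i, capp T (a i) (u x) = 0].

(* H_(A) *)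
Definition detached_space (R : realType) (H : completeNormedModType R)
    (ip : {dot H for idfun}) (T : R) (u : H -> R -> R) (N : nat)
    (a : 'I_N -> condition R) : set H :=
  [set x | forall y, reduced_space T u a y -> ip x y = 0].

Definition padded_orthonormal_basis (R : realType) (H : completeNormedModType R)
    (ip : {dot H for idfun}) (S : set H) (N : nat) (e : 'I_N -> H) : Prop :=
  exists2 k : nat, (k <= N)%N &
    [/\ forall i j : 'I_N, (i < k)%N -> (j < k)%N ->
          ip (e i) (e j) = (i == j)%:R,
        forall i : 'I_N, (k <= i)%N -> e i = 0 &
        S = [set x | exists c : 'I_N -> R, x = \sum_(i < N) c i *: e i]].

(* The process Y on (Omega', P') is a version of X^(A). *)
Definition conditioned_process (R : realType) (T : R) (N : nat)
    (a : 'I_N -> condition R)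
    d (Omega : measurableType d) (P : probability Omega R) (X : R -> Omega -> R)
    d' (Omega' : measurableType d') (P' : probability Omega' R)
    (Y : R -> Omega' -> R) : Prop :=
  [/\ continuous_process T Y,
      gaussian_process P' T Y &
      forall (n : nat) (b : 'I_n -> condition R),
      exists2 Z : 'I_n -> Omega -> R,
        forall k, is_condexp P
          (sigma_rv setT (fun i w => capp T (a i) (X ^~ w)))
          (fun w => capp T (b k) (X ^~ w)) (Z k) &
        same_vector_law P' P
          (fun k w => capp T (b k) (Y ^~ w))
          (fun k w => capp T (b k) (X ^~ w) - Z k w)].

Definition D_matrix (R : realType) (H : completeNormedModType R) (T : R)
    (u : H -> R -> R) (g : R -> R) (N : nat) (a : 'I_N -> condition R)
    (e : 'I_N -> H) (s : R) : 'M[R]_(1 + N) :=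
  block_mx
    (g s)%:M                         (\row_j u (e j) s)
    (\col_i cint (a i) `]s, T] g)    (\matrix_(i, j) cint (a i) `]s, T] (u (e j))).

Definition d_vector (R : realType) (N : nat) (a : 'I_N -> condition R)
    (Omega : Type) (Y : R -> Omega -> R) (s : R) (w : Omega) : 'cV[R]_(1 + N) :=
  col_mx (Y s w)%:M (\col_i - cint (a i) `[0, s] (Y ^~ w)).

(* Main.v *)
(* Let [k_s] and [alpha_i] be the Riesz representers of the evaluation
   [x |-> u x s] and of [a_i o u]. The series generating [X] gives
   [E X_s X_t = q <k_s, k_t>], and projecting [X_t] on the span of the [a_i(X)],
   Gaussian regression gives the covariance
   [K(r, x) = q (<k_r, k_x> - \sum_j u e_j(r) u e_j(x))] of the conditioned
   process [Y]. For [r <= s <= x] this is [f(r) g(x) - q \sum_j u e_j(r) u e_j(x)],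
   and [a_i(K(r, .)) = 0], so that [E d_s Y_r = D_s c_r] and
   [E Y_t Y_r = (g(t), u e_1(t), ..., u e_N(t)) c_r] for one vector [c_r]. Hence
   [Y_t - (g(t), u e_1(t), ..., u e_N(t)) D_s^-1 d_s] is uncorrelated with, and
   therefore orthogonal to every event of, the past of [Y] up to [s]. When [D_s]
   is singular, the [xi_i] may depend on [t], and it suffices to divide a version
   of the conditional expectation by a nonzero entry of
   [(g(t), u e_1(t), ..., u e_N(t))]; if all entries vanish, so does
   [E Y_t Y_r] for [r <= s].

   Joint Gaussianity is used only through [E V cos U = 0] and
   [E V sin U = kappa(U) E V U], which pass to the integrals [a_i(X)] by Fubini,
   and a variable [V] such that [E V cos U = E V sin U = 0] for all linear
   combinations [U] of a family is orthogonal to the sigma-algebra of the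
   family, by uniqueness of Fourier transforms. *)

Require Import Defs.
From HB Require Import structures.
From mathcomp Require Import all_boot all_order all_algebra finmap.
From mathcomp Require Import all_classical all_reals all_analysis.
From mathcomp Require Import measurable_realfun ring lra.
Import Order.TTheory GRing.Theory Num.Theory.
Import numFieldNormedType.Exports.
Local Open Scope classical_set_scope.
Local Open Scope ring_scope.

Set Implicit Arguments.
Unset Strict Implicit.
Unset Printing Implicit Defensive.

(** [generated_by] quantifies over all independent standard normal sequences, so it says something
    about [X] only once one such sequence is exhibited; it is built on the unit interval by
    distributing the binary digits of a uniform point. No Gaussian characteristic function is
    evaluated: a centred Gaussian variable enters only as a multiple of a standard normal one, and
    [q] is the second moment of the latter, left unevaluated. The obstacle in the conditioning is
    that the [a_i(X)] are not linear combinations of values of [X], so [gaussian_process] does not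
    speak of them. Along continuous paths they are limits of finite sums with deterministic weights,
    and these sums carry measurability, square integrability and the estimates. The regression of
    [X_t] on the [a_i(X)] is read off from the projection onto [H_(A)] and then verified by
    orthogonality, so no normal equations between the [a_i(X)] are solved and they may be linearly
    dependent. The law of [Y] is compared with that of [X] only at pairs of times, through Dirac
    conditions. *)

Notation L1 mu D f := (integrable mu D (EFin \o f)).

(** * Real-valued integrals *)

Section real_integral.
Context d (T : measurableType d) (R : realType).
Variables (mu : {measure set T -> \bar R}) (D : set T) (mD : measurable D).
Implicit Types f g : T -> R.

Lemma L1_meas f : L1 mu D f -> measurable_fun D f.
Proof. by move=> /measurable_int/measurable_EFinP. Qed.

Lemma L1_ext f g : (forall x, D x -> f x = g x) -> L1 mu D f -> L1 mu D g.
Proof.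
by move=> fg; apply: eq_integrable => // x /[!inE] Dx /=; rewrite fg.
Qed.

Lemma L1_le f g : measurable_fun D f -> (forall x, D x -> `|f x| <= g x) ->
  L1 mu D g -> L1 mu D f.
Proof.
move=> mf fg; apply: le_integrable => //; first exact/measurable_EFinP.
by move=> x Dx /=; rewrite lee_fin (le_trans (fg _ Dx))// ler_norm.
Qed.

Lemma L1D f g : L1 mu D f -> L1 mu D g -> L1 mu D (fun x => f x + g x).
Proof. by move=> lf lg; apply: eq_integrable (integrableD mD lf lg). Qed.

Lemma L1Z c f : L1 mu D f -> L1 mu D (fun x => c * f x).
Proof. by move=> lf; apply: eq_integrable (integrableZl mD c lf). Qed.

Lemma L1N f : L1 mu D f -> L1 mu D (fun x => - f x).
Proof. by move=> /(L1Z (-1)); apply: L1_ext => x _; rewrite mulN1r. Qed.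

Lemma L1B f g : L1 mu D f -> L1 mu D g -> L1 mu D (fun x => f x - g x).
Proof. by move=> lf lg; apply: L1D => //; exact: L1N. Qed.

Lemma L1_sum n (f : 'I_n -> T -> R) : (forall i, L1 mu D (f i)) ->
  L1 mu D (fun x => \sum_(i < n) f i x).
Proof.
move=> lf; have := integrable_sum mD (index_enum 'I_n) (P := xpredT)
  (h := fun i x => (f i x)%:E) (fun i _ => lf i).
by apply: eq_integrable => // x _ /=; rewrite sumEFin.
Qed.

Lemma L1_bounded_mul f g (M : R) : L1 mu D f -> measurable_fun D g ->
  (forall x, D x -> `|g x| <= M) -> L1 mu D (fun x => f x * g x).
Proof.
move=> lf mg gM.
apply: (@L1_le _ (fun x => M * `|f x|)).
- by apply: measurable_funM => //; exact: L1_meas.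
- by move=> x Dx; rewrite normrM mulrC ler_wpM2r// gM.
- by apply: L1Z; exact: integrable_norm.
Qed.

Lemma Rint_ext f g : (forall x, D x -> f x = g x) ->
  Rintegral mu D f = Rintegral mu D g.
Proof. by move=> fg; apply: eq_Rintegral => x /[!inE]; exact: fg. Qed.

Lemma Rint_sum n (f : 'I_n -> T -> R) : (forall i, L1 mu D (f i)) ->
  Rintegral mu D (fun x => \sum_(i < n) f i x)
  = \sum_(i < n) Rintegral mu D (f i).
Proof.
elim: n f => [|n ih] f lf.
  rewrite big_ord0; under eq_Rintegral do rewrite big_ord0.
  by rewrite /Rintegral integral0.
under eq_Rintegral do rewrite big_ord_recr/=.
rewrite RintegralD//; last exact: L1_sum.
by rewrite ih// big_ord_recr.
Qed.

Lemma Rint_dominated (f_ : nat -> T -> R) f g :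
  (forall n, measurable_fun D (f_ n)) ->
  (forall x, D x -> (f_ ^~ x) @ \oo --> f x) ->
  L1 mu D g ->
  (forall n x, D x -> `|f_ n x| <= g x) ->
  L1 mu D f /\ (fun n => Rintegral mu D (f_ n)) @ \oo --> Rintegral mu D f.
Proof.
move=> mf_ f_f lg f_g.
have mf : measurable_fun D f by apply: measurable_fun_cvg f_f.
have lf n : L1 mu D (f_ n) by apply: L1_le lg => // x; exact: f_g.
have [] := @dominated_convergence _ _ _ mu D mD (fun n => EFin \o f_ n)
  (EFin \o f) (EFin \o g).
- by move=> n; exact/measurable_EFinP.
- exact/measurable_EFinP.
- by apply: aeW => x Dx; apply: cvg_EFin; [exact: nearW|exact: f_f].
- exact: lg.
- by apply: aeW => x n Dx /=; rewrite lee_fin f_g.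
move=> intf _ cv; split => //.
apply: fine_cvg; rewrite fineK//; exact: integrable_fin_num.
Qed.

(** Measurability of [g] is assumed because the sigma-algebra need not contain all subsets of null
    sets. *)
Lemma Rint_ae_eq f g : measurable_fun D g -> L1 mu D f -> ae_eq mu D f g ->
  L1 mu D g /\ Rintegral mu D f = Rintegral mu D g.
Proof.
move=> mg lf fg.
have mf := L1_meas lf.
have fgE : ae_eq mu D (EFin \o f) (EFin \o g).
  by move: fg; apply: filterS => x /= h Dx; rewrite h.
have mfE : measurable_fun D (EFin \o f) by exact/measurable_EFinP.
have mgE : measurable_fun D (EFin \o g) by exact/measurable_EFinP.
split; last by congr fine; apply: ae_eq_integral fgE.
have /integrableP[_ fi] := lf; apply/integrableP; split => //.
suff <- : (\int[mu]_(x in D) `|(EFin \o f) x| =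
           \int[mu]_(x in D) `|(EFin \o g) x|)%E by [].
apply: ae_eq_integral => //; [exact: measurableT_comp..|].
by apply: filterS fgE => x h Dx; rewrite (h Dx).
Qed.

End real_integral.

(** * Fourier uniqueness *)

Section sign_iteration.
Variable R : realType.
Implicit Types (x y : R).

(** The Newton-Schulz iteration for the sign: 0 is a repelling fixed point, 1 and -1 are attracting
    ones. Being a polynomial, it maps trigonometric polynomials to trigonometric polynomials, so
    that the sign of a sine is a bounded pointwise limit of such functions. *)
Definition sgn_step x : R := (3 * x - x ^+ 3) / 2.

Lemma sgn_stepN x : sgn_step (- x) = - sgn_step x.
Proof. by rewrite /sgn_step; field. Qed.

Lemma iter_sgn_stepN n x : iter n sgn_step (- x) = - iter n sgn_step x.
Proof. by elim: n => //= n ->; rewrite sgn_stepN. Qed.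

Lemma sgn_step_ge x : 0 <= x <= 1 -> x <= sgn_step x <= 1.
Proof.
move=> /andP[x0 x1]; rewrite /sgn_step; apply/andP; split.
- suff : 0 <= x * ((1 - x) * (1 + x)) by lra.
  by do 2?[apply: mulr_ge0] => //; lra.
- suff : 0 <= (1 - x) ^+ 2 * (2 + x) by lra.
  by apply: mulr_ge0; [exact: sqr_ge0|lra].
Qed.

Lemma iter_sgn_step_ge n x : 0 <= x <= 1 -> x <= iter n sgn_step x <= 1.
Proof.
move=> x01; elim: n => [|n /andP[h1 h2]] /=; first by case/andP: x01 => _ ->; rewrite lexx.
have /andP[x0 x1] := x01.
have /andP[h3 h4] : iter n sgn_step x <= sgn_step (iter n sgn_step x) <= 1.
  by apply: sgn_step_ge; rewrite h2 (le_trans x0).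
by rewrite h4 (le_trans h1).
Qed.

Lemma iter_sgn_step_le1 n x : `|x| <= 1 -> `|iter n sgn_step x| <= 1.
Proof.
have aux y : 0 <= y <= 1 -> `|iter n sgn_step y| <= 1.
  move=> y01; have /andP[h1 h2] := iter_sgn_step_ge n y01.
  by case/andP: y01 => y0 _; rewrite ger0_norm ?(le_trans y0).
have [x0|x0] := leP 0 x; first by rewrite ger0_norm// => x1; apply: aux; rewrite x0.
rewrite ltr0_norm// => x1; rewrite -normrN -iter_sgn_stepN; apply: aux.
by rewrite x1 oppr_ge0 ltW.
Qed.

(* [1 - sgn_step y = (1 - y) (1 - (y + y^2) / 2)], so the defect contracts by
   the factor [1 - x / 2] at every point above [x]. *)
Lemma iter_sgn_step_defect n x : 0 <= x <= 1 ->
  1 - iter n sgn_step x <= (1 - x / 2) ^+ n.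
Proof.
move=> x01; have /andP[x0 x1] := x01; elim: n => [|n ih] /=; first by rewrite expr0; lra.
have /andP[h1 h2] := iter_sgn_step_ge n x01.
rewrite exprS; set y := iter n _ _ in ih h1 h2 *; set p := _ ^+ n in ih *.
have -> : 1 - sgn_step y = (1 - (y + y ^+ 2) / 2) * (1 - y).
  by rewrite /sgn_step; field.
apply: ler_pM => //; [nra|lra|nra].
Qed.

Lemma cvg_iter_sgn_step x : `|x| <= 1 ->
  (fun n => iter n sgn_step x) @ \oo --> Num.sg x.
Proof.
have aux y : 0 < y <= 1 -> (fun n => iter n sgn_step y) @ \oo --> (1 : R).
  move=> /andP[y0 y1].
  have y01 : 0 <= y <= 1 by rewrite (ltW y0).
  apply: (@squeeze_cvgr _ _ _ _ (fun n => 1 - (1 - y / 2) ^+ n) (cst 1)).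
  - apply: nearW => n; have /andP[_ ->] := iter_sgn_step_ge n y01.
    by rewrite andbT lerBlDr -lerBlDl iter_sgn_step_defect.
  - have : (fun n => 1 - (1 - y / 2) ^+ n) @ \oo --> (1 - 0 : R).
      by apply: cvgB; [exact: cvg_cst|apply: cvg_expr; rewrite ger0_norm; lra].
    by rewrite subr0.
  - exact: cvg_cst.
have [x0|x0|<-] := ltgtP 0 x.
- by rewrite gtr0_norm// gtr0_sg// => x1; apply: aux; rewrite x0.
- rewrite ltr0_norm// ltr0_sg// => x1.
  have -> : (fun n => iter n sgn_step x) = (fun n => - iter n sgn_step (- x)).
    by apply/funext => n; rewrite iter_sgn_stepN opprK.
  by apply: cvgN; apply: aux; rewrite x1 oppr_gt0 x0.
- rewrite sgr0 => _.
  have -> : (fun n => iter n sgn_step (0 : R)) = cst 0; last exact: cvg_cst.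
  apply/funext => n; elim: n => //= n ->.
  by rewrite /sgn_step expr0n/= mulr0 subrr mul0r.
Qed.

(** The frequencies are arbitrary reals, so the class is stable under translations and, by the
    product-to-sum formulas, under products, hence under polynomials such as [sgn_step]. *)
Inductive trig_poly : (R -> R) -> Prop :=
| trig_cos l : trig_poly (fun y => cos (l * y))
| trig_sin l : trig_poly (fun y => sin (l * y))
| trig_lin c p q : trig_poly p -> trig_poly q ->
    trig_poly (fun y => c * p y + q y).

Lemma trig_const c : trig_poly (cst c).
Proof.
rewrite (_ : cst c = fun y => (c - 1) * cos (0 * y) + cos (0 * y)).
  by apply: trig_lin; exact: trig_cos.
by apply/funext => y /=; rewrite mul0r cos0; ring.
Qed.

Lemma trigZ c p : trig_poly p -> trig_poly (fun y => c * p y).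
Proof.
move=> tp; rewrite (_ : (fun y => _) = fun y => c * p y + cst 0 y).
  by apply: trig_lin => //; exact: trig_const.
by apply/funext => y; rewrite /= addr0.
Qed.

Lemma trigM p q : trig_poly p -> trig_poly q -> trig_poly (fun y => p y * q y).
Proof.
have cc l m : trig_poly (fun y => cos (l * y) * cos (m * y)).
  rewrite (_ : (fun y => _) = fun y =>
      2^-1 * cos ((l + m) * y) + 2^-1 * cos ((l - m) * y)).
    by apply: trig_lin; [|apply: trigZ]; exact: trig_cos.
  by apply/funext => y; rewrite mulrDl mulrBl cosD cosB; field.
have ss l m : trig_poly (fun y => sin (l * y) * sin (m * y)).
  rewrite (_ : (fun y => _) = fun y =>
      - 2^-1 * cos ((l + m) * y) + 2^-1 * cos ((l - m) * y)).
    by apply: trig_lin; [|apply: trigZ]; exact: trig_cos.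
  by apply/funext => y; rewrite mulrDl mulrBl cosD cosB; field.
have sc l m : trig_poly (fun y => sin (l * y) * cos (m * y)).
  rewrite (_ : (fun y => _) = fun y =>
      2^-1 * sin ((l + m) * y) + 2^-1 * sin ((l - m) * y)).
    by apply: trig_lin; [|apply: trigZ]; exact: trig_sin.
  by apply/funext => y; rewrite mulrDl mulrBl sinD sinB; field.
move=> tp; elim: tp q => [l|l|c p1 p2 _ ih1 _ ih2] q tq.
- elim: tq => [m|m|c q1 q2 _ ih1 _ ih2] //.
  + by rewrite (_ : (fun y => _) = fun y => sin (m * y) * cos (l * y))//;
      apply/funext => y; rewrite mulrC.
  + rewrite (_ : (fun y => _) = fun y =>
      c * (cos (l * y) * q1 y) + cos (l * y) * q2 y); first exact: trig_lin.
    by apply/funext => y; ring.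
- elim: tq => [m|m|c q1 q2 _ ih1 _ ih2] //.
  rewrite (_ : (fun y => _) = fun y =>
    c * (sin (l * y) * q1 y) + sin (l * y) * q2 y); first exact: trig_lin.
  by apply/funext => y; ring.
- rewrite (_ : (fun y => _) = fun y => c * (p1 y * q y) + p2 y * q y).
    by apply: trig_lin; [exact: ih1|exact: ih2].
  by apply/funext => y; ring.
Qed.

Lemma trig_shift l c : trig_poly (fun y => sin (l * (y - c))).
Proof.
rewrite (_ : (fun y => _) = fun y =>
    cos (l * c) * sin (l * y) + - sin (l * c) * cos (l * y)).
  by apply: trig_lin; [exact: trig_sin|apply: trigZ; exact: trig_cos].
by apply/funext => y; rewrite mulrBr sinB; ring.
Qed.

Lemma trig_iter_sgn n p : trig_poly p -> trig_poly (fun y => iter n sgn_step (p y)).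
Proof.
move=> tp; elim: n => //= n ih.
rewrite (_ : (fun y => _) = fun y => 3 / 2 * iter n sgn_step (p y) +
  - 2^-1 * (iter n sgn_step (p y) * (iter n sgn_step (p y) * iter n sgn_step (p y)))).
  by apply: trig_lin => //; apply: trigZ; apply: trigM => //; exact: trigM.
by apply/funext => y; rewrite /sgn_step; field.
Qed.

Lemma trig_bounded p : trig_poly p -> exists M, forall y, `|p y| <= M.
Proof.
elim => [l|l|c p1 p2 _ [M1 h1] _ [M2 h2]].
- by exists 1 => y; exact: cos_max.
- by exists 1 => y; exact: sin_max.
- exists (`|c| * M1 + M2) => y; apply: le_trans (ler_normD _ _) _.
  by rewrite lerD// normrM ler_wpM2l.
Qed.

Lemma measurable_cosT : measurable_fun [set: R] (@cos R).
Proof. by apply: continuous_measurable_fun; exact: continuous_cos. Qed.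

Lemma measurable_sinT : measurable_fun [set: R] (@sin R).
Proof. by apply: continuous_measurable_fun; exact: continuous_sin. Qed.

Lemma trig_measurable p : trig_poly p -> measurable_fun [set: R] p.
Proof.
elim => [l|l|c p1 p2 _ h1 _ h2].
- by apply: (measurableT_comp measurable_cosT); exact: measurable_funM.
- by apply: (measurableT_comp measurable_sinT); exact: measurable_funM.
- by apply: measurable_funD => //; exact: measurable_funM.
Qed.

End sign_iteration.

Lemma cvg_eq_cst (R : realType) (f : nat -> R) (c l : R) :
  (forall n, f n = c) -> f @ \oo --> l -> l = c.
Proof.
move=> /funext -> cl; exact: (cvg_unique (@Rhausdorff R) cl (cvg_cst _)).
Qed.

Section orthogonality.
Context d (T : measurableType d) (R : realType).
Variable (mu : {measure set T -> \bar R}).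
Implicit Types (V : T -> R).

Lemma L1_indic_mul V E : L1 mu setT V -> measurable E ->
  L1 mu setT (fun w => V w * \1_E w).
Proof.
move=> lV mE; apply: (L1_bounded_mul (M := 1) measurableT lV) => //.
by move=> x _; rewrite indicE; case: (_ \in _); rewrite ?normr1 ?normr0.
Qed.

(** Complements use that [V] has mean zero; countable disjoint unions use dominated convergence of
    the partial sums, with bound [|V|]. *)
Lemma orth_dynkin V : L1 mu setT V -> Rintegral mu setT V = 0 ->
  dynkin [set E | measurable E /\ Rintegral mu setT (fun w => V w * \1_E w) = 0].
Proof.
move=> lV V0; split => /=.
- by split => //; under eq_Rintegral do rewrite indicT mulr1.
- move=> E [mE E0]; split; first exact: measurableC.
  rewrite (_ : (fun w => _) = fun w => V w - V w * \1_E w).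
    by rewrite RintegralB ?V0 ?E0 ?subr0//; exact: L1_indic_mul.
  by apply/funext => w; rewrite !indicE in_setC; case: (_ \in _) => /=; ring.
- move=> F tF F0.
  have mF n : measurable (F n) by case: (F0 n).
  split; first exact: bigcupT_measurable.
  have [] := @Rint_dominated _ _ _ mu setT measurableT
    (fun n w => \sum_(i < n) V w * \1_(F i) w)
    (fun w => V w * \1_(\bigcup_i F i) w) (fun w => `|V w|) _ _ _ _.
    + move=> n; apply: L1_meas; apply: L1_sum => // i; exact: L1_indic_mul.
    + move=> w _; have [[i _ Fiw]|nF] := pselect ((\bigcup_i F i) w); last first.
        rewrite indicE memNset// mulr0.
        rewrite (_ : (fun n => _) = cst 0); first exact: cvg_cst.
        apply/funext => n; rewrite big1// => i _; rewrite indicE memNset ?mulr0//.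
        by move=> Fiw; apply: nF; exists i.
      rewrite indicE mem_set; last by exists i.
      apply: cvg_near_cst; near=> n.
      have ni : (i < n)%N by near: n; exact: nbhs_infty_gt.
      rewrite (bigD1 (Ordinal ni))//= big1 ?addr0.
        by rewrite indicE mem_set.
      move=> j ji; rewrite indicE memNset ?mulr0// => Fjw.
      move/eqP: ji; apply; apply/val_inj => /=.
      by apply: (tF) => //; exists w.
    + exact: integrable_norm.
    + move=> n w _.
      have [[i Fiw]|nF] := pselect (exists i : 'I_n, F i w); last first.
        rewrite big1 ?normr0// => i _; rewrite indicE memNset ?mulr0//.
        by move=> Fiw; apply: nF; exists i.
      rewrite (bigD1 i)//= big1 ?addr0.
        by rewrite indicE mem_set// mulr1.
      move=> j ji; rewrite indicE memNset ?mulr0// => Fjw.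
      move/eqP: ji; apply; apply/val_inj => /=.
      by apply: (tF) => //; exists w.
  move=> _; apply: cvg_eq_cst => n; rewrite Rint_sum//; last by move=> i; exact: L1_indic_mul.
  by rewrite big1// => i _; case: (F0 i).
Unshelve. all: by end_near. Qed.

Lemma orth_sigma V (G : set (set T)) : setI_closed G -> G `<=` measurable ->
  L1 mu setT V -> Rintegral mu setT V = 0 ->
  (forall E, G E -> Rintegral mu setT (fun w => V w * \1_E w) = 0) ->
  forall E, <<s G >> E -> Rintegral mu setT (fun w => V w * \1_E w) = 0.
Proof.
move=> GI Gm lV V0 GV E; rewrite -setI_closed_g_dynkin_g_sigma_algebra//.
move=> /(_ [set E | measurable E /\ Rintegral mu setT (fun w => V w * \1_E w) = 0]).
case=> //; split; first exact: orth_dynkin.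
by move=> A GA; split; [exact: Gm|exact: GV].
Qed.

Lemma orth_rays V (Y : T -> R) : measurable_fun setT Y -> L1 mu setT V ->
  Rintegral mu setT V = 0 ->
  (forall c, Rintegral mu setT (fun w => V w * \1_(`]c, +oo[%classic : set R) (Y w)) = 0) ->
  forall B : set R, measurable B ->
  Rintegral mu setT (fun w => V w * \1_B (Y w)) = 0.
Proof.
move=> mY lV V0 Vray.
move=> B mB; rewrite -[RHS](_ : Rintegral mu setT (fun w => V w * \1_(Y @^-1` B) w) = 0)//.
have mE : @measurable _ (measurableTypeR R) = <<s @RGenOInfty.G R >>.
  exact: RGenOInfty.measurableE.
have := @dynkin_induction _ (measurableTypeR R) (@RGenOInfty.G R)
  (fun B => measurable (Y @^-1` B) /\
     Rintegral mu setT (fun w => V w * \1_(Y @^-1` B) w) = 0) mE.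
have [dT dC dU] := orth_dynkin lV V0.
move=> ind; have [] // : measurable (Y @^-1` B) /\
     Rintegral mu setT (fun w => V w * \1_(Y @^-1` B) w) = 0.
have sB : <<s @RGenOInfty.G R >> B by rewrite -mE.
apply: (ind _ _ _ _ _ _ sB) => //.
- move=> _ _ [x ->] [y ->]; exists (Num.max x y).
  by apply/seteqP; split => z /=; rewrite !in_itv/= !andbT gt_max => /andP.
- move=> _ [x ->]; split; last exact: Vray.
  by rewrite -[_ @^-1` _]setTI; apply: mY => //; exact: measurable_itv.
- by move=> S mS /dC; rewrite preimage_setC.
- move=> F mF tF FP; rewrite preimage_bigcup; apply: dU => //.
  move/trivIsetP in tF; apply/trivIsetP => i j _ _ ij.
  by rewrite -preimage_setI tF ?preimage_set0.
Qed.

(* A finite signed measure on the line whose Fourier transform vanishes is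
   zero, here for the image of [V . mu] by [Y]. *)
Lemma fourier_unique V (Y : T -> R) :
  measurable_fun setT Y -> L1 mu setT V ->
  (forall l, Rintegral mu setT (fun w => V w * cos (l * Y w)) = 0) ->
  (forall l, Rintegral mu setT (fun w => V w * sin (l * Y w)) = 0) ->
  forall B : set R, measurable B ->
  Rintegral mu setT (fun w => V w * \1_B (Y w)) = 0.
Proof.
move=> mY lV Vc Vs.
have V0 : Rintegral mu setT V = 0.
  by rewrite -(Vc 0); apply: Rint_ext => w _; rewrite mul0r cos0 mulr1.
have Vtrig p : trig_poly p ->
    L1 mu setT (fun w => V w * p (Y w)) /\
    Rintegral mu setT (fun w => V w * p (Y w)) = 0.
  move=> tp.
  have lp q : trig_poly q -> L1 mu setT (fun w => V w * q (Y w)).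
    move=> tq; have [M qM] := trig_bounded tq.
    apply: (L1_bounded_mul (M := M) measurableT lV) => //.
    exact: (measurableT_comp (trig_measurable tq)).
  split; first exact: lp.
  elim: tp => // c p1 p2 tp1 ih1 tp2 ih2.
  rewrite (_ : (fun w => _) = fun w => c * (V w * p1 (Y w)) + V w * p2 (Y w)).
    rewrite RintegralD ?RintegralZl ?ih1 ?ih2 ?mulr0 ?addr0//;
      [exact: lp|apply: L1Z => //; exact: lp|exact: lp].
  by apply/funext => w; ring.
have bounded_lim (p : nat -> R -> R) q :
    (forall n, measurable_fun [set: R] (p n)) ->
    (forall n y, `|p n y| <= 1) ->
    (forall y, (p ^~ y) @ \oo --> q y) ->
    (forall n, Rintegral mu setT (fun w => V w * p n (Y w)) = 0) ->
    Rintegral mu setT (fun w => V w * q (Y w)) = 0.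
  move=> mp p1 pq Vp.
  have [] := @Rint_dominated _ _ _ mu setT measurableT
    (fun n w => V w * p n (Y w))
    (fun w => V w * q (Y w)) (fun w => `|V w|) _ _ _ _.
  - by move=> n; apply: measurable_funM; [exact: L1_meas lV|exact: (measurableT_comp (mp n))].
  - by move=> w _; apply: cvgMr; exact: pq.
  - exact: integrable_norm.
  - by move=> n w _; rewrite normrM ler_piMr.
  by move=> _; exact: cvg_eq_cst.
have msg : measurable_fun [set: R] (@Num.sg R).
  rewrite (_ : @Num.sg R = fun x => \1_`]0, +oo[ x - \1_`]-oo, 0[ x).
    by apply: measurable_funB; apply: measurable_indic.
  apply/funext => x; rewrite !indicE !mem_setE !in_itv/= andbT.
  have [x0|x0|<-] := ltgtP 0 x.
  - by rewrite gtr0_sg// subr0.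
  - by rewrite ltr0_sg// sub0r.
  - by rewrite sgr0 subr0.
(* The square wave with a sign change at [c] is the bounded limit of the iterates of [sgn_step] on a
   shifted sine. *)
have Vsg_sin l c : Rintegral mu setT (fun w => V w * Num.sg (sin (l * (Y w - c)))) = 0.
  apply: (bounded_lim (fun n y => iter n (@sgn_step R) (sin (l * (y - c))))
    (fun y => Num.sg (sin (l * (y - c))))).
  - by move=> n; apply: trig_measurable; apply: trig_iter_sgn; exact: trig_shift.
  - by move=> n y; apply: iter_sgn_step_le1; exact: sin_max.
  - by move=> y; apply: cvg_iter_sgn_step; exact: sin_max.
  - move=> n; have [] // := Vtrig (fun y => iter n (@sgn_step R) (sin (l * (y - c)))).
    by apply: trig_iter_sgn; exact: trig_shift.
have sg_le1 (x : R) : `|Num.sg x| <= 1.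
  by rewrite normr_sg; case: eqP.
(* Dilating by [n.+1] moves the sign changes of the sine other than [c] to distance at least
   [n.+1 * pi] from [c], so at a fixed [y] only the sign of [y - c] remains for large [n]. *)
have Vsg c : Rintegral mu setT (fun w => V w * Num.sg (Y w - c)) = 0.
  apply: (bounded_lim (fun n y => Num.sg (sin (n.+1%:R^-1 * (y - c)))) (fun y => Num.sg (y - c))) => //.
  - move=> n; apply: (measurableT_comp msg); apply: trig_measurable; exact: trig_shift.
  - move=> y; apply: cvg_near_cst; near=> n.
    have n0 : 0 < n.+1%:R^-1 :> R by rewrite invr_gt0.
    have small : n.+1%:R^-1 * `|y - c| < pi.
      rewrite mulrC ltr_pdivrMr// mulrC -ltr_pdivrMr ?pi_gt0//.
      near: n; have := nbhs_infty_gtr (`|y - c| / pi).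
      by apply: filterS => n; move/lt_le_trans; apply; rewrite ler_nat.
    have [yc|yc|yc] := ltgtP c y.
    + rewrite -subr_gt0 in yc; rewrite gtr0_sg ?gtr0_sg// sin_gt0_pi//.
      by rewrite mulr_gt0//= -[y - c]gtr0_norm.
    + rewrite -subr_lt0 in yc; rewrite ltr0_sg ?ltr0_sg// -oppr_gt0 -sinN.
      by rewrite -mulrN sin_gt0_pi// mulr_gt0 ?oppr_gt0//= -[- (y - c)]ltr0_norm.
    + by rewrite yc subrr mulr0 sin0.
have Vray c : Rintegral mu setT (fun w => V w * \1_(`]c, +oo[%classic : set R) (Y w)) = 0.
  have : Rintegral mu setT
      (fun w => V w * (2 * \1_(`]c, +oo[%classic : set R) (Y w) - 1)) = 0.
    (* The shift to the right of [c] gives the value -1 at [y = c], where the unshifted sign would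
       be 0; the limit is then exactly 1 on the open ray and -1 off it. *)
    apply: (bounded_lim (fun n y => Num.sg (y - (c + n.+1%:R^-1)))
       (fun y => 2 * \1_(`]c, +oo[%classic : set R) y - 1)) => //.
    - by move=> n; apply: (measurableT_comp msg); exact: measurable_funB.
    - move=> y; apply: cvg_near_cst; near=> n.
      have n0 : 0 < n.+1%:R^-1 :> R by rewrite invr_gt0.
      rewrite indicE mem_setE in_itv/= andbT.
      have [yc|yc] := ltP c y; last first.
        by rewrite ltr0_sg ?mulr0 ?sub0r// subr_lt0 (le_lt_trans yc)// ltrDl.
      have nyc : n.+1%:R^-1 < y - c.
        rewrite invf_plt ?posrE ?subr_gt0//.
        near: n; have := nbhs_infty_gtr (y - c)^-1.
        by apply: filterS => n; move/lt_le_trans; apply; rewrite ler_nat.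
      have yn : 0 < y - (c + n.+1%:R^-1) by rewrite opprD addrA subr_gt0.
      by rewrite gtr0_sg// mulr1; ring.
  have l1 : L1 mu setT (fun w => V w * \1_(`]c, +oo[%classic : set R) (Y w)).
    apply: (L1_bounded_mul (M := 1) measurableT lV) => //.
      by apply: measurableT_comp => //; exact: measurable_indic.
    by move=> w _; rewrite indicE; case: (_ \in _); rewrite ?normr1 ?normr0.
  rewrite (_ : (fun w => _) = fun w => 2 * (V w * \1_(`]c, +oo[%classic : set R) (Y w)) - V w).
    rewrite RintegralB ?RintegralZl//; last exact: L1Z.
    by rewrite V0; lra.
  by apply/funext => w; ring.
exact: orth_rays.
Unshelve. all: by end_near. Qed.

End orthogonality.

Section trig_orthogonality.
Context d (T : measurableType d) (R : realType) (I : Type).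
Variables (mu : {measure set T -> \bar R}) (D : set I) (X : I -> T -> R).
Hypothesis mX : forall i, D i -> measurable_fun setT (X i).
Implicit Types (U V : T -> R).

Inductive lin_span : (T -> R) -> Prop :=
| lin_span0 : lin_span (fun=> 0)
| lin_spanD c i U : D i -> lin_span U -> lin_span (fun w => U w + c * X i w).

Lemma lin_span_measurable U : lin_span U -> measurable_fun setT U.
Proof.
elim => [|c i {}U Di _ mU]; first exact: measurable_cst.
by apply: measurable_funD => //; apply: measurable_funM => //; exact: mX.
Qed.

(** Finite intersections of events of single variables: a family stable under intersection that
    generates [sigma_rv D X], built one event at a time for the induction below. *)
Inductive cylinder : set T -> Prop :=
| cylinderT : cylinder setT
| cylinderI i (B : set R) E : D i -> measurable B -> cylinder E ->
    cylinder (X i @^-1` B `&` E).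

Lemma cylinder_setI : setI_closed cylinder.
Proof.
move=> A B cA cB; elim: cA => [|i C E Di mC _ ih]; first by rewrite setTI.
by rewrite -setIA; exact: cylinderI.
Qed.

Lemma measurable_preX i (B : set R) : D i -> measurable B -> measurable (X i @^-1` B).
Proof. by move=> Di mB; rewrite -[_ @^-1` _]setTI; exact: mX. Qed.

Lemma cylinder_measurable : cylinder `<=` measurable.
Proof.
move=> E; elim => {E} [|i B E Di mB _ mE]; first exact: measurableT.
apply: measurableI => //.
exact: measurable_preX.
Qed.

Lemma L1_mul_cos V U : L1 mu setT V -> measurable_fun setT U ->
  L1 mu setT (fun w => V w * cos (U w)).
Proof.
move=> lV mU; apply: (L1_bounded_mul (M := 1) measurableT lV).
  exact: (measurableT_comp (@measurable_cosT R)).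
by move=> w _; exact: cos_max.
Qed.

Lemma L1_mul_sin V U : L1 mu setT V -> measurable_fun setT U ->
  L1 mu setT (fun w => V w * sin (U w)).
Proof.
move=> lV mU; apply: (L1_bounded_mul (M := 1) measurableT lV).
  exact: (measurableT_comp (@measurable_sinT R)).
by move=> w _; exact: sin_max.
Qed.

Definition trig_orth V U :=
  Rintegral mu setT (fun w => V w * cos (U w)) = 0 /\
  Rintegral mu setT (fun w => V w * sin (U w)) = 0.

(** Multivariate Fourier uniqueness, one variable at a time: along a cylinder [E], the variable
    [V * \1_E] stays orthogonal to the sines and cosines of the whole span. To add an event of
    [X i], freeze [E] and [U]; the product-to-sum formulas turn [cos U * cos (l * X i)] into cosines
    of [U + l * X i] and [U - l * X i], again in the span, and uniqueness on the line applies to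
    [X i]. *)
Lemma trig_orth_sigma V : L1 mu setT V ->
  (forall U, lin_span U -> trig_orth V U) ->
  forall E, sigma_rv D X E ->
  Rintegral mu setT (fun w => V w * \1_E w) = 0.
Proof.
move=> lV VU.
have cyl E : cylinder E -> forall U, lin_span U -> trig_orth (fun w => V w * \1_E w) U.
  elim => [U lU|i B {}E Di mB cE ih U lU].
    by rewrite (_ : (fun w => _) = V); [exact: VU|apply/funext => w; rewrite indicT mulr1].
  have mE := cylinder_measurable cE.
  have lVE : L1 mu setT (fun w => V w * \1_E w) by exact: L1_indic_mul.
  have mU := lin_span_measurable lU.
  have mXi := mX Di.
  have lUp l : lin_span (fun w => U w + l * X i w) by exact: lin_spanD.
  have mUp l := lin_span_measurable (lUp l).
  have indE w : V w * \1_(X i @^-1` B `&` E) w = V w * \1_E w * \1_B (X i w).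
    by rewrite indicI -[\1_B (X i w)]/(\1_(X i @^-1` B) w) /=; ring.
  split.
  - transitivity (Rintegral mu setT (fun w => (V w * \1_E w * cos (U w)) * \1_B (X i w))).
      by apply: Rint_ext => w _; rewrite indE; ring.
    apply: fourier_unique => //; first exact: L1_mul_cos.
      move=> l; transitivity (Rintegral mu setT (fun w =>
        2^-1 * (V w * \1_E w * cos (U w + l * X i w)) +
        2^-1 * (V w * \1_E w * cos (U w + (- l) * X i w)))).
        by apply: Rint_ext => w _; rewrite (mulNr l) cosD cosB; field.
      rewrite RintegralD ?RintegralZl//; try (try apply: L1Z => //; exact: L1_mul_cos).
      by rewrite (ih _ (lUp _)).1 (ih _ (lUp _)).1 !mulr0 addr0.
    move=> l; transitivity (Rintegral mu setT (fun w =>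
      2^-1 * (V w * \1_E w * sin (U w + l * X i w)) +
      - 2^-1 * (V w * \1_E w * sin (U w + (- l) * X i w)))).
      by apply: Rint_ext => w _; rewrite (mulNr l) sinD sinB; field.
    rewrite RintegralD ?RintegralZl//; try (try apply: L1Z => //; exact: L1_mul_sin).
    by rewrite (ih _ (lUp _)).2 (ih _ (lUp _)).2 !mulr0 addr0.
  - transitivity (Rintegral mu setT (fun w => (V w * \1_E w * sin (U w)) * \1_B (X i w))).
      by apply: Rint_ext => w _; rewrite indE; ring.
    apply: fourier_unique => //; first exact: L1_mul_sin.
      move=> l; transitivity (Rintegral mu setT (fun w =>
        2^-1 * (V w * \1_E w * sin (U w + l * X i w)) +
        2^-1 * (V w * \1_E w * sin (U w + (- l) * X i w)))).
        by apply: Rint_ext => w _; rewrite (mulNr l) sinD sinB; field.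
      rewrite RintegralD ?RintegralZl//; try (try apply: L1Z => //; exact: L1_mul_sin).
      by rewrite (ih _ (lUp _)).2 (ih _ (lUp _)).2 !mulr0 addr0.
    move=> l; transitivity (Rintegral mu setT (fun w =>
      - 2^-1 * (V w * \1_E w * cos (U w + l * X i w)) +
      2^-1 * (V w * \1_E w * cos (U w + (- l) * X i w)))).
      by apply: Rint_ext => w _; rewrite (mulNr l) cosD cosB; field.
    rewrite RintegralD ?RintegralZl//; try (try apply: L1Z => //; exact: L1_mul_cos).
    by rewrite (ih _ (lUp _)).1 (ih _ (lUp _)).1 !mulr0 addr0.
have cyl0 E : cylinder E -> Rintegral mu setT (fun w => V w * \1_E w) = 0.
  move=> /cyl /(_ _ lin_span0) [<- _]; apply: Rint_ext => w _.
  by rewrite cos0 mulr1.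
have V0 : Rintegral mu setT V = 0.
  rewrite -(cyl0 _ cylinderT); apply: Rint_ext => w _; by rewrite indicT mulr1.
move=> E sE; apply: (orth_sigma cylinder_setI cylinder_measurable lV V0 cyl0).
move: E sE; apply: smallest_sub; first exact: smallest_sigma_algebra.
move=> _ [i Di [B mB <-]]; apply: sub_sigma_algebra.
by rewrite setTI -[_ @^-1` _]setIT; apply: cylinderI => //; exact: cylinderT.
Qed.

Lemma sigma_rv_measurable : sigma_rv D X `<=` measurable.
Proof.
apply: smallest_sub; first exact: sigma_algebra_measurable.
by move=> _ [i Di [B mB <-]]; rewrite setTI; exact: measurable_preX.
Qed.

End trig_orthogonality.

Lemma ge0_integral_scaled d (S : measurableType d) (R : realType)
  (mu nu : {measure set S -> \bar R}) (r : {nonneg R}) (D : set S) (phi : S -> \bar R) :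
  (forall B, measurable B -> mu B = r%:num%:E * nu B)%E ->
  measurable D -> measurable_fun setT phi -> (forall y, 0 <= phi y)%E ->
  (\int[mu]_(y in D) phi y = r%:num%:E * \int[nu]_(y in D) phi y)%E.
Proof.
move=> muE mD mphi phi0.
transitivity (\int[mscale r nu]_(y in D) phi y)%E.
  by apply: eq_measure_integral => C mC _; exact: muE.
by rewrite ge0_integral_mscale//; exact: measurable_funTS.
Qed.

(** * Gaussian laws *)

Section same_law.
Context d1 (T1 : measurableType d1) d2 (T2 : measurableType d2)
  d (S : measurableType d) (R : realType).
Variables (mu1 : {measure set T1 -> \bar R}) (mu2 : {measure set T2 -> \bar R}).
Variables (V1 : T1 -> S) (V2 : T2 -> S).
Hypotheses (mV1 : measurable_fun setT V1) (mV2 : measurable_fun setT V2).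
Hypothesis law12 : forall B, measurable B -> mu1 (V1 @^-1` B) = mu2 (V2 @^-1` B).

Let law_integral (phi : S -> \bar R) : measurable_fun setT phi ->
  (forall y, 0 <= phi y)%E ->
  (\int[mu1]_x phi (V1 x) = \int[mu2]_x phi (V2 x))%E.
Proof.
move=> mphi phi0.
transitivity (\int[pushforward mu1 V1]_y phi y)%E.
  by rewrite ge0_integral_pushforward.
transitivity (\int[pushforward mu2 V2]_y phi y)%E.
  by apply: eq_measure_integral => B mB _; exact: law12.
by rewrite ge0_integral_pushforward.
Qed.

Lemma same_law_integrable (phi : S -> R) : measurable_fun setT phi ->
  L1 mu1 setT (fun x => phi (V1 x)) -> L1 mu2 setT (fun x => phi (V2 x)).
Proof.
move=> mphi /integrableP[_ fi]; apply/integrableP; split.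
  by apply/measurable_EFinP; exact: measurableT_comp.
rewrite -[ltLHS](@law_integral (fun y => `|(phi y)%:E|)%E)//.
by apply: measurableT_comp => //; exact/measurable_EFinP.
Qed.

Lemma same_law_Rint (phi : S -> R) : measurable_fun setT phi ->
  Rintegral mu1 setT (fun x => phi (V1 x)) = Rintegral mu2 setT (fun x => phi (V2 x)).
Proof.
move=> mphi; rewrite /Rintegral integralE [in RHS]integralE.
have mE : measurable_fun setT (fun y => (phi y)%:E) by exact/measurable_EFinP.
have lp := law_integral (measurable_funepos mE).
have ln := law_integral (measurable_funeneg mE).
congr (fine (_ - _)%E).
- transitivity (\int[mu1]_x ((fun y => (phi y)%:E)^\+%E (V1 x)))%E.
    by apply: eq_integral => x _; rewrite !funeposE.
  by rewrite lp//; apply: eq_integral => x _; rewrite !funeposE.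
- transitivity (\int[mu1]_x ((fun y => (phi y)%:E)^\-%E (V1 x)))%E.
    by apply: eq_integral => x _; rewrite !funenegE.
  by rewrite ln//; apply: eq_integral => x _; rewrite !funenegE.
Qed.

End same_law.

Section normal_law.
Variable R : realType.
Local Notation leb := (@lebesgue_measure R).
Local Notation N01 := (@normal_prob R 0 1).

Definition affine (m s : R) (x : measurableTypeR R) : measurableTypeR R := m + s * x.

Lemma measurable_affine (m s : R) :
  measurable_fun setT (affine m s).
Proof. by apply: measurable_funD => //; exact: measurable_funM. Qed.

(** Lebesgue measure is determined by its values on the intervals []a, b]]; for [s < 0] their
    preimages are closed on the left and open on the right instead, with the same length. *)
Lemma lebesgue_affine (m s : R) (B : set (measurableTypeR R)) : s != 0 ->
  measurable B ->
  (leb B = `|s|%:E * pushforward leb (affine m s) B)%E.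
Proof.
move=> s0 mB.
pose r := NngNum (normr_ge0 s).
have mA := measurable_affine m s.
suff e : forall X, ocitv X -> leb X = mscale r (pushforward leb (affine m s)) X.
  by rewrite (lebesgue_measure_unique (e mA) mB).
move=> mA' _ [[a b]] /= _ <-; rewrite /mscale /= /pushforward.
have [sp|sn|/eqP] := ltgtP 0 s; last by rewrite eq_sym (negbTE s0).
- rewrite (_ : _ @^-1` _ = `](a - m) / s, (b - m) / s]%classic); last first.
    apply/seteqP; split => x /=; rewrite /affine !in_itv/= ltr_pdivrMr// ler_pdivlMr// ltrBlDl lerBrDl;
      by rewrite (mulrC x).
  rewrite !lebesgue_measure_itv/= !lte_fin ltr_pM2r ?invr_gt0// ltrD2r.
  case: ifPn => ab; last by rewrite mule0.
  rewrite gtr0_norm// -!EFinB -EFinM; congr EFin.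
  by field.
- rewrite (_ : _ @^-1` _ = `[(b - m) / s, (a - m) / s[%classic); last first.
    apply/seteqP; split => x /=; rewrite /affine !in_itv/= ler_ndivrMr// ltr_ndivlMr// ltrBlDl lerBrDl;
      by rewrite (mulrC x) andbC.
  rewrite !lebesgue_measure_itv/= !lte_fin ltr_nM2r ?invr_lt0// ltrD2r.
  case: ifPn => ab; last by rewrite mule0.
  rewrite ltr0_norm// -!EFinB -EFinM; congr EFin.
  by field.
Qed.

(** Every Gaussian law, the point mass included, is the image of N(0,1) under an affine map, so
    later arguments need no case distinction on [s], which may be zero or negative. *)
Lemma gaussian_lawE (m s : R) (B : set (measurableTypeR R)) : measurable B ->
  gaussian_law m s B = N01 ((affine m s) @^-1` B).
Proof.
move=> mB; rewrite /gaussian_law; have [->|s0] := eqVneq s 0.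
  rewrite diracE.
  have [mB1|mB0] := boolP (m \in B).
    rewrite (_ : _ @^-1` _ = setT) ?probability_setT//.
    by apply/seteqP; split => // x _ /=; rewrite /affine mul0r addr0; exact/set_mem.
  rewrite (_ : _ @^-1` _ = set0) ?measure0//.
  apply/seteqP; split => // x /=; rewrite /affine mul0r addr0 => /mem_set.
  by rewrite (negbTE mB0).
pose A := affine m s.
have mA : measurable_fun setT A by exact: measurable_affine.
have mp a b : measurable_fun [set: R] (fun x => (normal_pdf a b x)%:E).
  by apply/measurable_EFinP; exact: measurable_normal_pdf.
rewrite /normal_prob.
have pdf0 x : (0 <= (normal_pdf m s x)%:E)%E by rewrite lee_fin normal_pdf_ge0.
have lebA C : measurable C ->
    (leb C = (NngNum (normr_ge0 s))%:num%:E * pushforward leb A C)%E.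
  by move=> mC; rewrite (lebesgue_affine m s0 mC).
rewrite (ge0_integral_scaled lebA mB)//; last exact: mp.
rewrite ge0_integral_pushforward//; last by apply: measurable_funTS; exact: mp.
rewrite -ge0_integralZl//=; last 2 first.
- by rewrite -[_ @^-1` _]setTI; exact: mA.
- by apply: measurable_funTS; apply: (measurableT_comp (mp m s)).
apply: eq_integral => x _; rewrite -EFinM; congr EFin.
rewrite !normal_pdfE ?oner_neq0// /A /affine mulrA; congr (_ * _).
  rewrite /normal_peak expr1n mul1r -mulrnAr sqrtrM ?sqr_ge0// sqrtr_sqr invfM.
  by rewrite mulrA divff ?normr_eq0// mul1r.
rewrite /normal_fun; congr expR; rewrite subr0 expr1n addrAC subrr add0r.
by field.
Qed.

End normal_law.

Section normal_moments.
Variable R : realType.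
Local Notation leb := (@lebesgue_measure R).
Local Notation N01 := (@normal_prob R 0 1).

(** The Radon-Nikodym derivative of the normal law agrees almost everywhere with [normal_pdf], since
    both have the same integrals over measurable sets. *)
Lemma ge0_integral_normal_prob (m s : R) (f : R -> \bar R) :
  measurable_fun setT f -> (forall x, 0 <= f x)%E ->
  (\int[normal_prob m s]_x f x = \int[leb]_x (f x * (normal_pdf m s x)%:E))%E.
Proof.
move=> mf f0; have dom := normal_prob_dominates m s.
rewrite -(Radon_Nikodym_SigmaFinite.change_of_variables dom)//.
have mp : measurable_fun [set: R] (fun x => (normal_pdf m s x)%:E).
  by apply/measurable_EFinP; exact: measurable_normal_pdf.
have intd := Radon_Nikodym_SigmaFinite.f_integrable dom.
have md : measurable_fun setT (Radon_Nikodym_SigmaFinite.f (normal_prob m s) leb).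
  exact: measurable_int intd.
apply: ae_eq_integral => //; [exact: emeasurable_funM..|].
apply: ae_eqe_mul2l; apply: integral_ae_eq => //.
by move=> E _ mE; rewrite -Radon_Nikodym_SigmaFinite.f_integral.
Qed.

Lemma normal_sq_integrable : L1 N01 setT (fun x => x ^+ 2).
Proof.
have m2 : measurable_fun setT (fun x : measurableTypeR R => (x ^+ 2)%:E).
  by apply/measurable_EFinP; exact: measurable_funX.
apply/integrableP; split => //.
under eq_integral do rewrite /= ger0_norm ?sqr_ge0//.
rewrite ge0_integral_normal_prob//; last by move=> x; rewrite lee_fin sqr_ge0.
pose s := Num.sqrt 2 : R.
have s2 : s ^+ 2 = 2 by rewrite sqr_sqrtr.
have s0 : s != 0 by rewrite gt_eqF// sqrtr_gt0.
have ps0 := normal_peak_gt0 s0.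
(* From [x^2 / 4 <= exp (x^2 / 4)] follows [x^2 exp (- x^2 / 2) <= 4 exp (- x^2 / 4)], and the right
   side is, up to normalisation, the density of N(0,2). The ratio of peaks in [c] accounts for the
   normalisations. *)
pose c := 4 * normal_peak 1 / normal_peak s : R.
have le x : x ^+ 2 * normal_pdf 0 1 x <= c * normal_pdf 0 s x :> R.
  rewrite !normal_pdfE ?oner_neq0// /c mulrCA.
  have -> : 4 * normal_peak 1 / normal_peak s * (normal_peak s * normal_fun 0 s x)
    = normal_peak 1 * (4 * normal_fun 0 s x) by field; rewrite gt_eqF.
  rewrite ler_wpM2l ?normal_peak_ge0// /normal_fun subr0 s2 expr1n.
  rewrite -[in leLHS](_ : - (x ^+ 2 / 4) + - (x ^+ 2) / (2 *+ 2) = - x ^+ 2 / (1 *+ 2)); last by field.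
  rewrite expRD mulrA ler_wpM2r ?expR_ge0//.
  rewrite expRN ler_pdivrMr ?expR_gt0//.
  have := expR_ge1Dx (x ^+ 2 / 4); lra.
apply: (@le_lt_trans _ _ (\int[leb]_x (c%:E * (normal_pdf 0 s x)%:E)))%E.
  apply: ge0_le_integral => //.
  - by move=> x _; rewrite -EFinM lee_fin mulr_ge0 ?sqr_ge0 ?normal_pdf_ge0.
  - apply: emeasurable_funM => //; apply/measurable_EFinP; exact: measurable_normal_pdf.
  - apply: emeasurable_funM => //; apply/measurable_EFinP; exact: measurable_normal_pdf.
  - by move=> x _; rewrite -!EFinM lee_fin.
by rewrite integralZl ?integral_normal_pdf ?mule1 ?ltry//; exact: integrable_normal_pdf.
Qed.

(* Its value is 1, but only its positivity matters. *)
Definition normal_m2 : R := Rintegral N01 setT (fun x => x ^+ 2).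

(** Otherwise N(0,1) would be carried by the point 0, which is Lebesgue-null and hence null for
    N(0,1). *)
Lemma normal_m2_gt0 : 0 < normal_m2.
Proof.
have m2 : measurable_fun setT (fun x : measurableTypeR R => (x ^+ 2)%:E).
  by apply/measurable_EFinP; exact: measurable_funX.
rewrite lt_neqAle Rintegral_ge0 ?andbT; last by move=> x _; exact: sqr_ge0.
apply/eqP => h0.
have i0 : (\int[N01]_x (x ^+ 2)%:E = 0)%E.
  rewrite -(fineK (integrable_fin_num measurableT normal_sq_integrable)).
  by rewrite -[fine _]/normal_m2 -h0.
have ae0 : {ae N01, forall x, setT x -> (x ^+ 2)%:E = 0%E}.
  apply/(@ae_eq_integral_abs _ _ _ N01 setT measurableT _ m2).
  by under eq_integral do rewrite /= ger0_norm ?sqr_ge0//.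
have n0 : N01 (~` [set (0 : R)%R]) = 0%E.
  case: ae0 => A [mA A0 sA]; apply/eqP; rewrite -measure_le0 -A0.
  apply: le_measure; rewrite ?inE//; first by apply: measurableC; exact: measurable_set1.
  move=> x /= x0; apply: sA => /= /(_ I) [] /eqP; rewrite sqrf_eq0 => /eqP.
  exact: x0.
have n1 : N01 [set (0 : R)%R] = 0%E.
  have /null_content_dominatesP dom := normal_prob_dominates (0 : R) 1.
  by apply: dom => //; exact: lebesgue_measure_set1.
have : (N01 [set: R] = N01 [set (0 : R)%R] + N01 (~` [set (0 : R)%R]))%E.
  rewrite -measureU//; first by rewrite setUv.
  - by apply: measurableC; exact: measurable_set1.
  - by rewrite setICr.
by rewrite n0 n1 adde0 probability_setT => /eqP; rewrite eqe oner_eq0.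
Qed.

Lemma normal_prob_opp (B : set (measurableTypeR R)) : measurable B ->
  N01 B = N01 ((-%R : measurableTypeR R -> measurableTypeR R) @^-1` B).
Proof.
(* The density depends on the standard deviation only through its square, so N(0,1) is also the law
   with parameter -1, whose affine map is the reflection. *)
move=> mB; transitivity (gaussian_law 0 (- 1) B).
  rewrite /gaussian_law oppr_eq0 oner_eq0 /normal_prob; apply: eq_integral => x _.
  rewrite !normal_pdfE ?oppr_eq0 ?oner_eq0//.
  by rewrite /normal_peak /normal_fun sqrrN.
rewrite gaussian_lawE//; congr (N01 _); apply/seteqP; split => x /=;
  by rewrite /affine add0r mulN1r.
Qed.

Lemma normal_sym (phi : R -> R) : measurable_fun setT phi ->
  Rintegral N01 setT phi = Rintegral N01 setT (fun x => phi (- x)).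
Proof.
move=> mphi; apply: (@same_law_Rint _ _ _ _ _ (measurableTypeR R) R N01 N01 id -%R) => //.
by move=> B mB; exact: normal_prob_opp.
Qed.

Lemma normal_id_integrable : L1 N01 setT (fun x => x).
Proof.
apply: (@L1_le _ _ _ N01 setT measurableT _ (fun x => 1 + x ^+ 2)) => //.
  move=> x _; have [x1|x1] := lerP `|x| 1.
    by rewrite (le_trans x1)// lerDl sqr_ge0.
  have := sqr_ge0 (`|x| - 1); rewrite sqrrB real_normK ?num_real//; lra.
apply: L1D => //; last exact: normal_sq_integrable.
exact: finite_measure_integrable_cst.
Qed.

Lemma normal_mean : Rintegral N01 setT (fun x => x) = 0.
Proof.
have /eqP := normal_sym (@measurable_id _ R setT).
rewrite (_ : Rintegral N01 setT (fun x : R => - x) = - Rintegral N01 setT (fun x => x)).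
  by rewrite -subr_eq0 opprK -mulr2n mulrn_eq0 => /eqP.
rewrite -[RHS]mulN1r -RintegralZl//; last exact: normal_id_integrable.
by apply: Rint_ext => x _; rewrite mulN1r.
Qed.

End normal_moments.

Section gaussian_variable.
Context d (T : measurableType d) (R : realType) (P : probability T R).
Local Notation N01 := (@normal_prob R 0 1).

(** All that is used about one centred Gaussian variable: it is distributed as [s] times a standard
    normal one, the sign of [s] being irrelevant. Mean zero forces [m = 0]. *)
Lemma gaussian_rvP (U : T -> R) : gaussian_rv P U -> Rintegral P setT U = 0 ->
  exists s : R, forall phi : R -> R, measurable_fun setT phi ->
    (L1 N01 setT (fun x => phi (s * x)) <-> L1 P setT (fun w => phi (U w))) /\
    Rintegral P setT (fun w => phi (U w)) = Rintegral N01 setT (fun x => phi (s * x)).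
Proof.
move=> [mU [m [s lawU]]] U0.
have mA : measurable_fun setT (affine m s) by exact: measurable_affine.
have law B : measurable B -> P (U @^-1` B) = N01 (affine m s @^-1` B).
  by move=> mB; rewrite lawU// gaussian_lawE.
have m0 : m = 0.
  have := same_law_Rint (S := measurableTypeR R) mU mA law (@measurable_id _ R setT).
  rewrite U0 /affine RintegralD//; last 2 first.
  - exact: finite_measure_integrable_cst.
  - by apply: L1Z => //; exact: normal_id_integrable.
  rewrite RintegralZl ?normal_mean ?mulr0 ?addr0//; last exact: normal_id_integrable.
  rewrite Rintegral_cst// (_ : fine _ = 1) ?mulr1 => [<-//|].
  exact: (congr1 fine (probability_setT N01)).
exists s => phi mphi.
have e : (fun x => phi (s * x)) = (fun x => phi (affine m s x)).
  by apply/funext => x; rewrite /affine m0 add0r.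
rewrite e; split; last exact: (same_law_Rint (S := measurableTypeR R)).
have law' B : measurable B -> N01 (affine m s @^-1` B) = P (U @^-1` B).
  by move=> mB; rewrite law.
split; first exact: (same_law_integrable (S := measurableTypeR R) mA mU law').
exact: (same_law_integrable (S := measurableTypeR R) mU mA law).
Qed.

End gaussian_variable.

(** * Taylor estimates and orthogonality of uncorrelated Gaussian variables *)

Section trig_estimates.
Variable R : realType.
Implicit Types x y h : R.

Lemma mean_value (f df : R -> R) x y : (forall z : R, is_derive z (1 : R) f (df z)) ->
  exists2 c, `|c - x| <= `|y - x| & f y - f x = df c * (y - x).
Proof.
move=> fdf.
have cf : continuous f.
  by move=> z; apply/differentiable_continuous/derivable1_diffP; apply: ex_derive.
have [xy|yx] := leP x y.
  have [c] := MVT_segment xy (fun z _ => fdf z) (continuous_subspaceT cf).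
  rewrite in_itv/= => /andP[xc cy] e; exists c => //.
  by rewrite !ger0_norm ?subr_ge0// lerD2r.
have [c] := MVT_segment (ltW yx) (fun z _ => fdf z) (continuous_subspaceT cf).
rewrite in_itv/= => /andP[yc cx] e; exists c.
  by rewrite ler0_norm ?subr_le0// ler0_norm ?subr_le0 ?(ltW yx)// lerN2 lerD2r.
by apply: oppr_inj; rewrite opprB e; ring.
Qed.

Lemma sin_lip x y : `|sin y - sin x| <= `|y - x|.
Proof.
have [c _ ->] := @mean_value sin cos x y (fun z => is_derive_sin z).
by rewrite normrM ler_piMl// cos_max.
Qed.

Lemma cos_lip x y : `|cos y - cos x| <= `|y - x|.
Proof.
have [c _ ->] := @mean_value cos (fun z => - sin z) x y (fun z => is_derive_cos z).
by rewrite normrM ler_piMl// normrN sin_max.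
Qed.

Lemma cos_taylor x h : `|cos (x + h) - cos x + h * sin x| <= h ^+ 2.
Proof.
have [c] := @mean_value cos (fun z => - sin z) x (x + h) (fun z => is_derive_cos z).
rewrite addrAC subrr add0r => cx ->.
rewrite (_ : _ + _ = - ((sin c - sin x) * h)); last by ring.
rewrite normrN normrM -real_normK ?num_real// expr2 ler_wpM2r//.
by rewrite (le_trans (sin_lip _ _)).
Qed.

Lemma sin_taylor x h : `|sin (x + h) - sin x - h * cos x| <= h ^+ 2.
Proof.
have [c] := @mean_value sin cos x (x + h) (fun z => is_derive_sin z).
rewrite addrAC subrr add0r => cx ->.
rewrite (_ : _ - _ = (cos c - cos x) * h); last by ring.
rewrite normrM -real_normK ?num_real// expr2 ler_wpM2r//.
by rewrite (le_trans (cos_lip _ _)).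
Qed.

(** The difference of cosines is a product of two sines, each bounded by its argument. The bound is
    in terms of squares because it serves to show that [E cos U] is Lipschitz in the variance of
    [U]. *)
Lemma cos_sub_le x y : `|cos x - cos y| <= `|x ^+ 2 - y ^+ 2| / 2.
Proof.
have aux (a b : R) : `|cos (a + b) - cos (a - b)| <= `|(a + b) ^+ 2 - (a - b) ^+ 2| / 2.
  rewrite (_ : cos _ - _ = - (2 * sin a * sin b)); last by rewrite cosD cosB; ring.
  rewrite (_ : _ - _ = 2 * a * b * 2); last by ring.
  rewrite normrN !normrM (ger0_norm (x := 2))// mulfK//.
  have s (z : R) : `|sin z| <= `|z| by have := sin_lip 0 z; rewrite sin0 !subr0.
  by apply: ler_pM => //; rewrite ?ler_pM2l//; exact: s.
have := aux ((x + y) / 2) ((x - y) / 2).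
rewrite -mulrDl -mulrBl (_ : x + y + (x - y) = x * 2); last by ring.
by rewrite (_ : x + y - (x - y) = y * 2) ?mulfK//; ring.
Qed.

End trig_estimates.

Section square_integrable.
Context d (T : measurableType d) (R : realType) (P : {finite_measure set T -> \bar R}).
Implicit Types f g : T -> R.

Lemma L1_bounded f M : measurable_fun setT f -> (forall w, `|f w| <= M) -> L1 P setT f.
Proof.
move=> mf fM; apply: (L1_le measurableT mf (g := fun=> M)) => //.
exact: (finite_measure_integrable_cst P M).
Qed.

Definition L2 f := measurable_fun setT f /\ L1 P setT (fun w => f w ^+ 2).

Lemma L2_mul f g : L2 f -> L2 g -> L1 P setT (fun w => f w * g w).
Proof.
move=> [mf lf] [mg lg].
apply: (@L1_le _ _ _ P setT measurableT _ (fun w => f w ^+ 2 + g w ^+ 2)).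
- exact: measurable_funM.
- move=> w _; rewrite normrM -[f w ^+ 2]real_normK ?num_real// -[g w ^+ 2]real_normK ?num_real//.
  have := sqr_ge0 (`|f w| - `|g w|); have := sqr_ge0 (`|f w|); have := sqr_ge0 (`|g w|).
  rewrite sqrrB; lra.
- by apply: L1D.
Qed.

Lemma L2_cst c : L2 (fun=> c).
Proof. by split => //; exact: (finite_measure_integrable_cst P (c ^+ 2)). Qed.

Lemma L2_L1 f : L2 f -> L1 P setT f.
Proof.
move=> lf; have := L2_mul lf (L2_cst 1); apply: (L1_ext measurableT) => w _.
by rewrite mulr1.
Qed.

Lemma L2D f g : L2 f -> L2 g -> L2 (fun w => f w + g w).
Proof.
move=> lf lg; split; first by apply: measurable_funD; [exact: lf.1|exact: lg.1].
apply: (@L1_ext _ _ _ P setT measurableT (fun w => (f w ^+ 2 + g w ^+ 2) + 2 * (f w * g w))).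
  by move=> w _; ring.
apply: L1D => //; first exact: (L1D measurableT lf.2 lg.2).
by apply: L1Z => //; exact: L2_mul.
Qed.

Lemma L2Z c f : L2 f -> L2 (fun w => c * f w).
Proof.
move=> lf; split; first by apply: measurable_funM => //; exact: lf.1.
apply: (@L1_ext _ _ _ P setT measurableT (fun w => c ^+ 2 * f w ^+ 2)).
  by move=> w _; ring.
by apply: L1Z => //; exact: lf.2.
Qed.

Lemma L2B f g : L2 f -> L2 g -> L2 (fun w => f w - g w).
Proof.
move=> lf lg; have := L2D lf (L2Z (-1) lg).
rewrite (_ : (fun w => f w + -1 * g w) = fun w => f w - g w)//.
by apply/funext => w; ring.
Qed.

Lemma L2_sum n (f : 'I_n -> T -> R) : (forall i, L2 (f i)) ->
  L2 (fun w => \sum_(i < n) f i w).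
Proof.
elim: n f => [|n ih] f lf.
  by rewrite (_ : (fun w => _) = fun=> 0); [exact: L2_cst|apply/funext => w; rewrite big_ord0].
rewrite (_ : (fun w => _) = fun w => \sum_(i < n) f (widen_ord (leqnSn n) i) w + f ord_max w).
  by apply: L2D => //; exact: ih.
by apply/funext => w; rewrite big_ord_recr.
Qed.

End square_integrable.

Section gaussian_orthogonality.
Context d (T : measurableType d) (R : realType) (P : probability T R).
Local Notation N01 := (@normal_prob R 0 1).
Local Notation E := (Rintegral P setT).

Lemma gaussian_L2 (U : T -> R) : gaussian_rv P U -> E U = 0 -> L2 P U.
Proof.
move=> gU U0; have mU : measurable_fun setT U by case: gU.
have [s sP] := gaussian_rvP gU U0; split => //.
have m2 : measurable_fun setT (fun x : R => x ^+ 2) by exact: measurable_funX.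
apply/(sP _ m2).1.
apply: (@L1_ext _ _ _ N01 setT measurableT (fun x => s ^+ 2 * x ^+ 2)).
  by move=> x _; rewrite exprMn.
by apply: L1Z => //; exact: normal_sq_integrable.
Qed.

Lemma gaussian_cos (U : T -> R) : gaussian_rv P U -> E U = 0 ->
  exists2 s : R, E (fun w => U w ^+ 2) = s ^+ 2 * normal_m2 R &
    E (fun w => cos (U w)) = Rintegral N01 setT (fun x => cos (s * x)).
Proof.
move=> gU U0; have [s sP] := gaussian_rvP gU U0; exists s.
- rewrite (sP (fun x : R => x ^+ 2) _).2; last exact: measurable_funX.
  rewrite /normal_m2 -RintegralZl//; last exact: normal_sq_integrable.
  by apply: Rint_ext => x _; rewrite exprMn.
- by rewrite (sP _ (@measurable_cosT R)).2.
Qed.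

Lemma gaussian_sin (U : T -> R) : gaussian_rv P U -> E U = 0 -> E (fun w => sin (U w)) = 0.
Proof.
move=> gU U0; have [s sP] := gaussian_rvP gU U0.
rewrite (sP _ (@measurable_sinT R)).2.
have msin : measurable_fun setT (fun x : R => sin (s * x)).
  by apply: (measurableT_comp (@measurable_sinT R)); exact: measurable_funM.
have := normal_sym msin.
rewrite [X in _ = X -> _](_ : _ = - Rintegral N01 setT (fun x => sin (s * x))).
  by move/eqP; rewrite -subr_eq0 opprK -mulr2n mulrn_eq0 => /eqP.
rewrite -mulN1r -RintegralZl//.
  by apply: Rint_ext => x _; rewrite mulrN sinN mulN1r.
by apply: (@L1_bounded _ _ _ _ _ 1) => // x; exact: sin_max.
Qed.

(** A first order term dominated by a second order one vanishes: for [C > 0] and [e = |c| / (2 C)]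
    the hypothesis reads [|c| <= |c| / 2]. *)
Lemma abs_le_small (c C : R) : (forall e, 0 < e -> e * `|c| <= e ^+ 2 * C) -> c = 0.
Proof.
move=> h; apply/eqP; rewrite -normr_le0 leNgt; apply/negP => c0.
have [C0|C0] := leP C 0.
  by have := h 1 ltr01; nra.
have e0 : 0 < `|c| / (2 * C) by rewrite divr_gt0// mulr_gt0.
have := h _ e0; rewrite expr2 -mulrA ler_pM2l// => h2.
have : `|c| <= `|c| / 2.
  by apply: le_trans h2 _; rewrite le_eqVlt; apply/orP; left; apply/eqP; field; rewrite gt_eqF.
lra.
Qed.

Lemma le_norm_E (f g : T -> R) : measurable_fun setT f -> L1 P setT g ->
  (forall w, `|f w| <= g w) -> `|E f| <= E g.
Proof.
move=> mf lg fg; have lf : L1 P setT f by apply: (L1_le measurableT mf _ lg) => w _.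
apply: (le_trans (le_normr_Rintegral measurableT lf)).
by apply: le_Rintegral => //; exact: integrable_norm.
Qed.

(* [E cos (U + e V)] depends on [e] only through the variance
   [E U^2 + e^2 E V^2], while its first order term at [e = 0] is
   [- E (V sin U)]. *)
Lemma gaussian_trig_orth (U V : T -> R) :
  (forall x y, gaussian_rv P (fun w => x * U w + y * V w)) ->
  E U = 0 -> E V = 0 -> E (fun w => V w * U w) = 0 ->
  trig_orth P V U.
Proof.
move=> gUV U0 V0 VU0.
have gU : gaussian_rv P U.
  by have := gUV 1 0; rewrite (_ : (fun w => _) = U)//; apply/funext => w; ring.
have gV : gaussian_rv P V.
  by have := gUV 0 1; rewrite (_ : (fun w => _) = V)//; apply/funext => w; ring.
have lU := gaussian_L2 gU U0; have lV := gaussian_L2 gV V0.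
have mU := lU.1; have mV := lV.1.
have l1U := L2_L1 lU; have l1V := L2_L1 lV.
pose q := E (fun w => V w ^+ 2).
have q0 : 0 <= q by apply: Rintegral_ge0 => w _; exact: sqr_ge0.
pose W e w := U w + e * V w.
have gW e : gaussian_rv P (W e).
  have := gUV 1 e; rewrite (_ : (fun w => _) = W e)//.
  by apply/funext => w; rewrite mul1r.
have W0 e : E (W e) = 0.
  by rewrite /W RintegralD ?RintegralZl ?U0 ?V0 ?mulr0 ?addr0//; by apply: L1Z.
have mW e : measurable_fun setT (W e) by exact: (gW e).1.
have W2 e : E (fun w => W e w ^+ 2) = E (fun w => U w ^+ 2) + e ^+ 2 * q.
  have lU2 := lU.2; have lV2 : L1 P setT (fun w => e ^+ 2 * V w ^+ 2).
    by apply: L1Z => //; exact: lV.2.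
  have lVU : L1 P setT (fun w => 2 * e * (V w * U w)) by apply: L1Z => //; exact: L2_mul.
  transitivity (E (fun w => (U w ^+ 2 + e ^+ 2 * V w ^+ 2) + 2 * e * (V w * U w))).
    by apply: Rint_ext => w _; rewrite /W; ring.
  rewrite RintegralD//; last by apply: L1D.
  rewrite RintegralD// RintegralZl//; last exact: lV.2.
  by rewrite RintegralZl ?VU0 ?mulr0 ?addr0//; exact: L2_mul.
have lcos e : L1 P setT (fun w => cos (W e w)).
  apply: (@L1_bounded _ _ _ _ _ 1); first exact: (measurableT_comp (@measurable_cosT R)).
  by move=> w; exact: cos_max.
have lsin e : L1 P setT (fun w => sin (W e w)).
  apply: (@L1_bounded _ _ _ _ _ 1); first exact: (measurableT_comp (@measurable_sinT R)).
  by move=> w; exact: sin_max.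
have WU w : W 0 w = U w by rewrite /W mul0r addr0.
split.
(* [E sin (W e)] vanishes for every [e] by symmetry, so the first order term is minus the mean of
   the Taylor remainder. *)
- apply: (abs_le_small (C := q)) => e e0.
  rewrite -[in leLHS](gtr0_norm e0) -normrM -RintegralZl//; last exact: L1_mul_cos.
  have -> : E (fun w => e * (V w * cos (U w))) =
      - E (fun w => sin (W e w) - sin (W 0 w) - e * (V w * cos (U w))).
    rewrite !RintegralB//; try (apply: L1Z => //; exact: L1_mul_cos); last by apply: L1B.
    by rewrite !gaussian_sin// subrr sub0r opprK.
  rewrite normrN /q -RintegralZl//; last exact: lV.2.
  apply: le_norm_E.
  + apply: measurable_funB; last by apply: measurable_funM => //; apply: (L1_meas (mu := P)); exact: L1_mul_cos.
    by apply: measurable_funB; apply: (measurableT_comp (@measurable_sinT R)).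
  + by apply: L1Z => //; exact: lV.2.
  + by move=> w; rewrite WU /W -exprMn mulrA; exact: sin_taylor.
(* The Taylor remainder contributes [q]. The change of [E cos (W e)] contributes [q / 2]: by
   [cos_sub_le] it is at most half the change [e ^+ 2 * q] of the variance. *)
- apply: (abs_le_small (C := q + q / 2)) => e e0.
  rewrite -[in leLHS](gtr0_norm e0) -normrM -RintegralZl//; last exact: L1_mul_sin.
  have -> : E (fun w => e * (V w * sin (U w))) =
      E (fun w => cos (W e w) - cos (W 0 w) + e * (V w * sin (U w)))
      - (E (fun w => cos (W e w)) - E (fun w => cos (W 0 w))).
    rewrite RintegralD//; try (apply: L1Z => //; exact: L1_mul_sin); last by apply: L1B.
    by rewrite RintegralB//; ring.
  apply: le_trans (ler_normB _ _) _; rewrite mulrDr lerD//.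
    rewrite /q -RintegralZl//; last exact: lV.2.
    apply: le_norm_E.
    + apply: measurable_funD; last by apply: measurable_funM => //;
      apply: (L1_meas (mu := P)); exact: L1_mul_sin.
      by apply: measurable_funB; apply: (measurableT_comp (@measurable_cosT R)).
    + by apply: L1Z => //; exact: lV.2.
    + by move=> w; rewrite WU /W -exprMn mulrA; exact: cos_taylor.
  have [s sW scos] := gaussian_cos (gW e) (W0 e).
  have [r rW rcos] := gaussian_cos (gW 0) (W0 0).
  have srq : e ^+ 2 * q = (s ^+ 2 - r ^+ 2) * normal_m2 R.
    by rewrite mulrBl -sW -rW !W2; ring.
  have m0 := normal_m2_gt0 R.
  have mc z : measurable_fun [set: R] (fun x : R => cos (z * x)).
    by apply: (measurableT_comp (@measurable_cosT R)); exact: measurable_funM.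
  have lc z : L1 N01 setT (fun x => cos (z * x)).
    by apply: (@L1_bounded _ _ _ _ _ 1); [exact: mc|move=> x; exact: cos_max].
  rewrite scos rcos -RintegralB//.
  have ls : L1 N01 setT (fun x => `|s ^+ 2 - r ^+ 2| / 2 * x ^+ 2).
    by apply: L1Z => //; exact: normal_sq_integrable.
  apply: le_trans (le_normr_Rintegral measurableT _) _; first by apply: L1B.
  apply: (@le_trans _ _ (Rintegral N01 setT (fun x => `|s ^+ 2 - r ^+ 2| / 2 * x ^+ 2))).
    apply: le_Rintegral => //; first by apply: integrable_norm; by apply: L1B.
    move=> x _; apply: le_trans (cos_sub_le _ _) _.
    by rewrite !exprMn -mulrBl normrM (ger0_norm (sqr_ge0 x)) mulrAC.
  rewrite RintegralZl//; last exact: normal_sq_integrable.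
  rewrite -/(normal_m2 R) mulrAC -[X in _ * X / _](gtr0_norm m0) -normrM -srq.
  have -> : `|e ^+ 2 * q| = e ^+ 2 * q by rewrite ger0_norm// mulr_ge0// sqr_ge0. 
  by rewrite -mulrA.
Qed.

End gaussian_orthogonality.

(** * Signed integrals of continuous paths *)

Section step_functions.
Variable R : realType.
Implicit Types (s x : R) (phi : R -> R).

Definition grid s (n k : nat) : R := s * (k%:R / n.+1%:R).

Definition cell s (n k : nat) : set (measurableTypeR R) :=
  `[0, s]%classic `&` [set x : R | k%:R <= x * (n.+1%:R / s) < k.+1%:R].

(** For [s > 0] there are [n.+1] cells of width [s / n.+1], and the cell of index [n.+1] meets the
    interval only in [s]; hence [n.+2] terms. The value on a cell is taken at its left end, a
    deterministic time, so a step approximation of a path is a finite combination of values of the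
    process. *)
Definition step s (n : nat) phi x : R :=
  \sum_(k < n.+2) phi (grid s n k) * \1_(cell s n k) x.

Lemma grid_itv s n (k : 'I_n.+2) : 0 <= s -> grid s n k \in `[0, s].
Proof.
move=> s0; rewrite in_itv/= /grid mulr_ge0//= ler_piMr// ler_pdivrMr// mul1r ler_nat.
by rewrite -ltnS.
Qed.

Lemma measurable_cell s n k : measurable (cell s n k).
Proof.
apply: measurableI; first exact: measurable_itv.
rewrite (_ : [set x | _] = (fun x : measurableTypeR R => x * (n.+1%:R / s) : measurableTypeR R)
    @^-1` `[k%:R, k.+1%:R[).
  rewrite -[_ @^-1` _]setTI; apply: measurable_funM => //; exact: measurable_itv.
by apply/seteqP; split => x /=; rewrite in_itv.
Qed.

Lemma step_notin s n phi x : x \notin `[0, s] -> step s n phi x = 0.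
Proof.
move=> xs; rewrite /step big1// => k _; rewrite indicE memNset ?mulr0//.
by move=> [/= x0s _]; rewrite x0s in xs.
Qed.

(* For [s = 0] the division in [cell] is by zero, so that [cell 0 n 0] is
   [set 0]. *)
Lemma step_eq s n x : x \in `[0, s] ->
  exists2 k : 'I_n.+2, (forall phi, step s n phi x = phi (grid s n k)) &
    `|grid s n k - x| <= s / n.+1%:R.
Proof.
rewrite in_itv/= => /andP[x0 xs].
have s0 : 0 <= s by exact: le_trans xs.
pose z := x * (n.+1%:R / s).
have z0 : 0 <= z by rewrite mulr_ge0// divr_ge0.
have zn : z <= n.+1%:R.
  rewrite /z; move: s0; rewrite le_eqVlt => /predU1P[<-|s0].
    by rewrite invr0 !mulr0.
  by rewrite mulrCA ler_piMr// ler_pdivrMr// mul1r.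
have /andP[kz zk] := truncn_itv z0.
have kn : (Num.truncn z < n.+2)%N.
  by rewrite ltnS -(ler_nat R) (le_trans kz).
exists (Ordinal kn) => [phi|/=].
  rewrite /step (bigD1 (Ordinal kn))//= big1 ?addr0.
    rewrite indicE mem_set ?mulr1//; split => /=; first by rewrite in_itv/= x0.
    by rewrite kz.
  move=> j jk; rewrite indicE memNset ?mulr0// => -[_ /= /truncn_def].
  rewrite -/z => zj; move/eqP: jk; apply; apply/val_inj => /=; by rewrite zj.
move: s0; rewrite le_eqVlt => /predU1P[s0|s0].
  have -> : x = 0 by apply/eqP; rewrite eq_le x0 andbT s0.
  by rewrite /grid -s0 !mul0r subrr normr0.
have xz : x = s * (z / n.+1%:R).
  by rewrite /z; field; rewrite nat1r pnatr_eq0/= gt_eqF.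
rewrite [X in _ - X]xz /grid -mulrBr -mulrBl normrM gtr0_norm// ler_wpM2l ?(ltW s0)//.
rewrite normrM [X in _ * X]gtr0_norm ?invr_gt0// ler_piMl ?invr_ge0//.
rewrite distrC ger0_norm ?subr_ge0// lerBlDr; move: zk.
by rewrite -addn1 natrD addrC => /ltW.
Qed.

Lemma within_cvg_seq (D : set R) phi (y : nat -> R) x : D x ->
  {within D, continuous phi} -> (forall n, D (y n)) -> y @ \oo --> x ->
  (fun n => phi (y n)) @ \oo --> phi x.
Proof.
move=> Dx /subspace_continuousP/(_ x Dx) cphi Dy yx.
apply: cvg_comp cphi => A /= wA.
have h : \forall n \near \oo, D (y n) -> A (y n) := yx _ wA.
by apply: filterS h => n; apply; exact: Dy.
Qed.

Lemma cvg_step s phi x : {within `[0, s], continuous phi} -> x \in `[0, s] ->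
  (fun n => step s n phi x) @ \oo --> phi x.
Proof.
move=> cphi xs.
have s0 : 0 <= s by move: xs; rewrite in_itv/= => /andP[]; exact: le_trans.
have /choice[y yP] : forall n, exists y : R, [/\ y \in `[0, s],
    step s n phi x = phi y & `|y - x| <= s / n.+1%:R].
  move=> n; have [k k1 k2] := step_eq n xs; exists (grid s n k); split => //.
  exact: grid_itv.
have -> : (fun n => step s n phi x) = (fun n => phi (y n)).
  by apply/funext => n; case: (yP n).
apply: (@within_cvg_seq `[0, s]%classic) => //; first by move=> n; case: (yP n).
have : (fun n => s / n.+1%:R) @ \oo --> (s * 0 : R).
  by apply: cvgMr; exact: cvg_harmonic.
rewrite mulr0 => cv; apply/cvgrPdist_le => e e0.
move/cvgrPdist_le : cv => /(_ _ e0); apply: filterS => n; rewrite sub0r normrN => h.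
case: (yP n) => _ _ h2; rewrite distrC (le_trans h2)// (le_trans _ h)//.
exact: ler_norm.
Qed.

Lemma within_continuous_bounded s phi : 0 <= s -> {within `[0, s], continuous phi} ->
  exists M, forall x, x \in `[0, s] -> `|phi x| <= M.
Proof.
move=> s0 cphi; have [c cs ub] := EVT_max s0 cphi.
have [c' cs' lb] := EVT_min s0 cphi.
exists (`|phi c| + `|phi c'|) => x xs.
have := ub _ xs; have := lb _ xs => h1 h2; rewrite ler_norml; apply/andP; split.
  have := ler_norm (- phi c'); rewrite normrN => h3; have := normr_ge0 (phi c); lra.
have := ler_norm (phi c); have := normr_ge0 (phi c'); lra.
Qed.

Lemma step_bounded s n phi M x : 0 <= M -> (forall y, y \in `[0, s] -> `|phi y| <= M) ->
  `|step s n phi x| <= M.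
Proof.
move=> M0 hM; have [xs|xs] := boolP (x \in `[0, s]); last by rewrite step_notin// normr0.
have s0 : 0 <= s by move: xs; rewrite in_itv/= => /andP[]; exact: le_trans.
by have [k -> _] := step_eq n xs; apply: hM; exact: grid_itv.
Qed.

Lemma measurable_step s n phi : measurable_fun [set: measurableTypeR R] (step s n phi).
Proof.
apply: measurable_sum => k; apply: measurable_funM => //.
by apply: measurable_indic; exact: measurable_cell.
Qed.

Lemma measurable_itv0 s : measurable (`[0, s]%classic : set (measurableTypeR R)).
Proof. exact: measurable_itv. Qed.

Lemma within_continuous_measurable s phi : {within `[0, s], continuous phi} ->
  measurable_fun (`[0, s]%classic : set (measurableTypeR R)) phi.
Proof.
move=> cphi; apply: (measurable_fun_cvg (h := fun n => step s n phi)).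
- by move=> n; apply: measurable_funTS; exact: measurable_step.
- by move=> x /= xs; exact: cvg_step.
Qed.

Section finite_measure.
Variable mu : {finite_measure set (measurableTypeR R) -> \bar R}.

Lemma continuous_L1 s phi : 0 <= s -> {within `[0, s], continuous phi} ->
  L1 mu `[0, s]%classic phi.
Proof.
move=> s0 cphi; have [M hM] := within_continuous_bounded s0 cphi.
apply: (@L1_le _ _ _ mu _ (measurable_itv0 s) phi (fun=> M)).
- exact: within_continuous_measurable.
- by move=> x; exact: hM.
- by apply: (finite_measure_integrable_cst mu M); exact: measurable_itv.
Qed.

Lemma Rint_step s n phi : Rintegral mu `[0, s]%classic (step s n phi) =
  \sum_(k < n.+2) fine (mu (cell s n k)) * phi (grid s n k).
Proof.
have mI := measurable_itv0 s.
have l1 k : L1 mu `[0, s]%classic (\1_(cell s n k)).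
  apply: (integrableS measurableT) => //; apply: integrable_indic; exact: measurable_cell.
rewrite Rint_sum//; last by move=> k; apply: L1Z.
apply: eq_bigr => k _; rewrite RintegralZl// mulrC; congr (_ * _).
rewrite /Rintegral integral_indic//; last exact: measurable_cell.
by rewrite (setIidl (_ : cell s n k `<=` _))// => x [].
Qed.

(** The weights depend on [mu], [s] and [n] only. Applied to a random path, this displays the
    integral as a pointwise limit of linear combinations of values of the process. *)
Lemma cvg_Rint_step s phi : 0 <= s -> {within `[0, s], continuous phi} ->
  (fun n => \sum_(k < n.+2) fine (mu (cell s n k)) * phi (grid s n k)) @ \oo -->
  Rintegral mu `[0, s]%classic phi.
Proof.
move=> s0 cphi; have [M hM] := within_continuous_bounded s0 cphi.
have mI := measurable_itv0 s.
have M0 : 0 <= M by apply: le_trans (hM 0 _); rewrite ?normr_ge0// in_itv/= lexx.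
have [] := @Rint_dominated _ _ _ mu _ mI (fun n => step s n phi) phi (fun=> M) _ _ _ _.
- by move=> n; apply: measurable_funTS; exact: measurable_step.
- by move=> x /= xs; exact: cvg_step.
- exact: (finite_measure_integrable_cst mu M).
- by move=> n x _; exact: step_bounded.
by move=> _; under eq_fun do rewrite Rint_step.
Qed.

End finite_measure.

End step_functions.

Section signed_integral.
Variable R : realType.
Implicit Types (a : condition R) (phi psi : R -> R) (s T : R).

Definition cpos a : {finite_measure set (measurableTypeR R) -> \bar R} :=
  jordan_pos (projT2 (cid (hahn_exists a))).

Definition cneg a : {finite_measure set (measurableTypeR R) -> \bar R} :=
  jordan_neg (projT2 (cid (hahn_exists a))).

Lemma cintE a D phi : cint a D phi = Rintegral (cpos a) D phi - Rintegral (cneg a) D phi.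
Proof. by []. Qed.

Definition cL1 a D phi := L1 (cpos a) D phi /\ L1 (cneg a) D phi.

Lemma cint_ext a D phi psi : (forall x, D x -> phi x = psi x) -> cint a D phi = cint a D psi.
Proof. by move=> e; rewrite !cintE; congr (_ - _); exact: Rint_ext. Qed.

Lemma cintD a (D : set (measurableTypeR R)) phi psi : measurable D -> cL1 a D phi -> cL1 a D psi ->
  cint a D (fun x => phi x + psi x) = cint a D phi + cint a D psi.
Proof. by move=> mD [l1 l2] [l3 l4]; rewrite !cintE !RintegralD//; ring. Qed.

Lemma cintZ a (D : set (measurableTypeR R)) c phi : measurable D -> cL1 a D phi ->
  cint a D (fun x => c * phi x) = c * cint a D phi.
Proof. by move=> mD [l1 l2]; rewrite !cintE !RintegralZl//; ring. Qed.

Lemma cL1Z a (D : set (measurableTypeR R)) c phi : measurable D -> cL1 a D phi ->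
  cL1 a D (fun x => c * phi x).
Proof. by move=> mD [l1 l2]; split; apply: L1Z. Qed.

Lemma cL1_sum a (D : set (measurableTypeR R)) n (phi : 'I_n -> R -> R) : measurable D ->
  (forall i, cL1 a D (phi i)) -> cL1 a D (fun x => \sum_(i < n) phi i x).
Proof. by move=> mD l; split; apply: L1_sum => // i; case: (l i). Qed.

Lemma cint_sum a (D : set (measurableTypeR R)) n (phi : 'I_n -> R -> R) : measurable D ->
  (forall i, cL1 a D (phi i)) ->
  cint a D (fun x => \sum_(i < n) phi i x) = \sum_(i < n) cint a D (phi i).
Proof.
move=> mD l; rewrite cintE !Rint_sum//; try (by move=> i; case: (l i)).
by rewrite -sumrB; apply: eq_bigr => i _; rewrite cintE.
Qed.

Lemma cL1_continuous a s phi : 0 <= s -> {within `[0, s], continuous phi} ->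
  cL1 a `[0, s]%classic phi.
Proof. by move=> s0 cphi; split; exact: continuous_L1. Qed.

Lemma cL1S a (D E : set (measurableTypeR R)) phi : measurable D -> measurable E ->
  D `<=` E -> cL1 a E phi -> cL1 a D phi.
Proof. by move=> mD mE DE [l1 l2]; split; exact: (integrableS mE). Qed.

Lemma cint_split a s T phi : 0 <= s <= T -> {within `[0, T], continuous phi} ->
  cint a `[0, T]%classic phi = cint a `[0, s]%classic phi + cint a `]s, T]%classic phi.
Proof.
move=> /andP[s0 sT] cphi.
have e : `[0, T]%classic = (`[0, s] `|` `]s, T])%classic :> set R.
  apply/seteqP; split => x /=; rewrite !in_itv/=.
    by move=> /andP[-> ->]; rewrite andbT; case: leP; [left|right].
  by move=> [/andP[-> /= xs]|/andP[sx ->]]; rewrite ?(le_trans xs)// (le_trans s0 (ltW sx)).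
have [l1 l2] := @cL1_continuous a T phi (le_trans s0 sT) cphi.
have dis : [disjoint `[0, s]%classic & (`]s, T]%classic : set R)].
  apply/disj_setPS => x /= []; rewrite !in_itv/= => /andP[_ xs] /andP[sx _].
  by move: (le_lt_trans xs sx); rewrite ltxx.
rewrite e in l1 l2.
rewrite !cintE e !Rintegral_setU//; try exact: measurable_itv.
by ring.
Qed.

Definition cweight a s n k : R := fine (cpos a (cell s n k)) - fine (cneg a (cell s n k)).

Lemma cvg_cint a s phi : 0 <= s -> {within `[0, s], continuous phi} ->
  (fun n => \sum_(k < n.+2) cweight a s n k * phi (grid s n k)) @ \oo -->
  cint a `[0, s]%classic phi.
Proof.
move=> s0 cphi.
have -> : (fun n => \sum_(k < n.+2) cweight a s n k * phi (grid s n k)) =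
    (fun n => \sum_(k < n.+2) fine (cpos a (cell s n k)) * phi (grid s n k) -
              \sum_(k < n.+2) fine (cneg a (cell s n k)) * phi (grid s n k)).
  by apply/funext => n; rewrite -sumrB; apply: eq_bigr => k _; rewrite mulrBl.
by rewrite cintE; apply: cvgB; exact: cvg_Rint_step.
Qed.

End signed_integral.

Section fubini_paths.
Context d (Omega : measurableType d) (R : realType) (P : probability Omega R).
Variables (X : R -> Omega -> R) (s : R).
Hypothesis s_ge0 : 0 <= s.
Hypothesis mX : forall x, x \in `[0, s] -> measurable_fun setT (X x).
Hypothesis cX : forall w, {within `[0, s], continuous (X ^~ w)}.
Local Notation D := (`[0, s]%classic : set (measurableTypeR R)).
Local Notation E := (Rintegral P setT).

(** Path continuity makes the process a pointwise limit of step processes, which are finite sums of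
    a function of time times a random variable. The indicator extends it by zero to all times. *)
Lemma joint_measurable :
  measurable_fun setT (fun z : measurableTypeR R * Omega => X z.1 z.2 * \1_D z.1).
Proof.
apply: (measurable_fun_cvg (h := fun n (z : measurableTypeR R * Omega) =>
  step s n (X ^~ z.2) z.1)).
- move=> n; apply: measurable_sum => k; apply: measurable_funM.
    by apply: (measurableT_comp (mX (grid_itv _ s_ge0))); exact: measurable_snd.
  by apply: measurableT_comp; [apply: measurable_indic; exact: measurable_cell|exact: measurable_fst].
- move=> [x w] _ /=; have [xs|xs] := boolP (x \in `[0, s]).
    by rewrite indicE mem_set// mulr1; exact: cvg_step.
  rewrite indicE memNset ?mulr0; last by move=> /=; exact/negP.
  rewrite (_ : (fun n => _) = cst 0); first exact: cvg_cst.
  by apply/funext => n; rewrite step_notin.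
Qed.

Variable (mu : {finite_measure set (measurableTypeR R) -> \bar R}).

(** The bound [C], uniform in time, and the finiteness of [mu] give integrability on the product
    space. The factor [psi] is there so that products of a path integral with any test variable can
    be treated. *)
Lemma Rint_fubini (psi : Omega -> R) (C : R) : measurable_fun setT psi ->
  (forall x, x \in `[0, s] -> L1 P setT (fun w => X x w * psi w)) ->
  (forall x, x \in `[0, s] -> E (fun w => `|X x w * psi w|) <= C) ->
  L1 P setT (fun w => Rintegral mu D (X ^~ w) * psi w) /\
  E (fun w => Rintegral mu D (X ^~ w) * psi w) =
  Rintegral mu D (fun x => E (fun w => X x w * psi w)).
Proof.
move=> mpsi lX bX.
have mD : measurable D by exact: measurable_itv.
pose F (z : measurableTypeR R * Omega) := (X z.1 z.2 * \1_D z.1 * psi z.2)%:E.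
have mF : measurable_fun setT F.
  apply/measurable_EFinP; apply: measurable_funM; first exact: joint_measurable.
  exact: (measurableT_comp mpsi measurable_snd).
have F_in x w : x \in `[0, s] -> F (x, w) = (X x w * psi w)%:E.
  by move=> xs; rewrite /F /= indicE mem_set// mulr1.
have F_out x w : x \notin `[0, s] -> F (x, w) = 0%E.
  by move=> xs; rewrite /F /= indicE memNset ?mulr0 ?mul0r//=; exact/negP.
have C0 : 0 <= C.
  by apply: le_trans (bX 0 _); [exact: Rintegral_ge0|rewrite in_itv/= lexx].
have intF : (mu \x P)%E.-integrable setT F.
  apply/integrable12ltyP => //.
  apply: (@le_lt_trans _ _ (\int[mu]_x C%:E)%E); last first.
    rewrite integral_cst// lte_mul_pinfty ?lee_fin// ltey_eq fin_num_measure//.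
  apply: ge0_le_integral => //.
  - by move=> x _; apply: integral_ge0.
  - apply: (measurable_fun_fubini_tonelli_F (abse \o F)) => //.
      exact: measurableT_comp.
    by move=> z; exact: abse_ge0.
  - move=> x _; have [xs|xs] := boolP (x \in `[0, s]); last first.
      by under eq_integral do rewrite F_out// abse0; rewrite integral0 lee_fin.
    rewrite -(@fineK _ (\int[P]_y _)%E); last first.
      under eq_integral do rewrite F_in//.
      apply: (integrable_fin_num measurableT).
      by apply: integrable_abse; exact: lX.
    rewrite lee_fin; apply: le_trans (bX _ xs); rewrite le_eqVlt; apply/orP; left; apply/eqP.
    by congr fine; apply: eq_integral => w _; rewrite F_in.
have lpath w : L1 mu D (X ^~ w) by exact: continuous_L1.
have GE w : (\int[mu]_x F (x, w) = (Rintegral mu D (X ^~ w) * psi w)%:E)%E.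
  rewrite mulrC -RintegralZl// /Rintegral fineK; last first.
    by apply: (integrable_fin_num mD); apply: L1Z.
  rewrite integral_mkcond; apply: eq_integral => x _; rewrite patchE.
  case: ifPn => [|xD].
    by rewrite inE/= => xs; rewrite F_in// mulrC.
  by rewrite F_out//; apply/negP => xs; move/negP: xD; apply; rewrite inE.
have FE x : (\int[P]_w F (x, w) = ((fun x => (E (fun w => X x w * psi w))%:E) \_ D) x)%E.
  rewrite patchE; case: ifPn => [|xD].
    rewrite inE/= => xs; rewrite /Rintegral fineK; last first.
      by apply: (integrable_fin_num measurableT); exact: lX.
    by apply: eq_integral => w _; rewrite F_in.
  have xs : x \notin `[0, s] by apply/negP => xs; move/negP: xD; apply; rewrite inE.
  by under eq_integral do rewrite F_out//; rewrite integral0.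
split.
  apply/integrableP; split.
    have := measurable_fubini_G intF; apply: eq_measurable_fun => w _.
    exact: GE.
  have := (integrable21ltyP mu P mF).1 intF; apply: le_lt_trans.
  apply: ge0_le_integral => //.
  - apply: measurableT_comp => //.
    have := measurable_fubini_G intF; apply: eq_measurable_fun => w _.
    exact: GE.
  - apply: (measurable_fun_fubini_tonelli_G (abse \o F)) => //.
      exact: measurableT_comp.
    by move=> z; exact: abse_ge0.
  - move=> w _; rewrite -[leLHS]/(`|(Rintegral mu D (X ^~ w) * psi w)%:E|)%E -GE.
    apply: le_abse_integral => //.
    exact: (measurableT_comp mF (pair2_measurable w)).
rewrite /Rintegral; congr fine.
rewrite [RHS]integral_mkcond.
under [RHS]eq_integral do rewrite -FE.
under [LHS]eq_integral do rewrite -GE.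
by rewrite -Fubini.
Qed.

End fubini_paths.

(** * Independent standard normal variables *)

Section binary_digits.
Variable R : realType.
Local Notation MR := (measurableTypeR R).
Local Notation leb := (@lebesgue_measure R).
Local Notation U01 := (@uniform_prob R 0 1 ltr01).

Lemma uniform01E (A : set MR) : measurable A -> U01 A = leb (A `&` `[0, 1]%classic).
Proof.
move=> mA; rewrite /uniform_prob integral_uniform_pdf.
rewrite (eq_integral (fun=> 1%E)); last first.
  by move=> x; rewrite inE/= in_itv/= /uniform_pdf => -[_ ->]; rewrite subr0 invr1.
by rewrite integral_cst ?mul1e//; apply: measurableI.
Qed.

Definition digit (c : bool) : set MR := if c then `[2^-1, +oo[%classic else `]-oo, 2^-1[%classic.

(** The doubling map, which drops the leading binary digit; the point 1 is sent to 1. *)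
Definition dshift (x : R) : R := 2 * x - ((2^-1 <= x)%R)%:R.

Lemma in_digit c (x : R) : digit c x <-> (2^-1 <= x) = c.
Proof.
by case: c; rewrite /digit/= in_itv/= ?andbT//; split; rewrite ltNge; [move/negbTE|move=> ->].
Qed.

Lemma measurable_digit c : measurable (digit c).
Proof. by case: c; exact: measurable_itv. Qed.

Lemma measurable_dshift : measurable_fun [set: MR] (dshift : MR -> MR).
Proof.
apply: measurable_funB; first exact: measurable_funM.
rewrite (_ : (fun x : MR => _) = \1_(digit true)); first exact: measurable_indic (measurable_digit true).
apply/funext => x; rewrite indicE; congr (nat_of_bool _)%:R.
by apply/idP/idP => [h|/set_mem/in_digit]//; apply/mem_set/in_digit.
Qed.

(** On each half of the unit interval [dshift] is affine with slope 2, so the leading digit is a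
    fair coin independent of the remaining uniform digits. *)
Lemma digit_indep c (A : set MR) : measurable A ->
  U01 (digit c `&` dshift @^-1` A) = (2^-1%:E * U01 A)%E.
Proof.
move=> mA.
have mdA : measurable (digit c `&` dshift @^-1` A).
  apply: measurableI; first exact: measurable_digit.
  by rewrite -[_ @^-1` _]setTI; exact: measurable_dshift.
(* The images of the two halves differ at one point: the left half, without its right end, is mapped
   onto [[0, 1[], the right half onto [[0, 1]]. The point 1 is null. *)
pose J : set MR := if c then `[0, 1]%classic else `[0, 1[%classic.
have mJ : measurable J by rewrite /J; case: (c); exact: measurable_itv.
have m : measurable (A `&` J) by apply: measurableI.
have -> : U01 A = leb (A `&` J).
  rewrite uniform01E// /J; case: (c) => //.
  have e : A `&` `[0, 1]%classic = (A `&` `[0, 1[) `|` (A `&` [set 1%R : MR]).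
    rewrite -setIUr; congr (_ `&` _); apply/seteqP; split => x /=; rewrite !in_itv/=.
      by move=> /andP[-> /=]; rewrite le_eqVlt => /predU1P[->|->]; [right|left].
    by move=> [/andP[-> /ltW ->]//|->]; rewrite ler01 lexx.
  rewrite e measureU0//; try apply: measurableI => //; try exact: measurable_itv; try exact: measurable_set1.
  apply: (subset_measure0 (B := [set 1%R : MR])) => //.
  - by apply: measurableI => //; exact: measurable_set1.
  - exact: lebesgue_measure_set1.
rewrite uniform01E// (lebesgue_affine (- c%:R) (_ : 2 != 0 :> R) m)// muleA.
rewrite -EFinM ger0_norm// mulVf// mul1e; congr (leb _).
apply/seteqP; split => x /=.
  move=> [[/in_digit h Ax] /=]; rewrite in_itv/= => /andP[x0 x1].
  have e : affine (- c%:R) 2 x = dshift x by rewrite /affine /dshift h addrC.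
  rewrite e; split => //; rewrite /J -e /affine; case: (c) h => h /=; rewrite in_itv/=.
    by apply/andP; split; lra.
  have : x < 2^-1 by rewrite ltNge h.
  by move=> h2; apply/andP; split; lra.
move=> [Ax Jx].
have h : (2^-1 <= x) = c.
  move: Jx; rewrite /J /affine; case: (c) => /=; rewrite in_itv/= => /andP[h1 h2].
    lra.
  by apply/negbTE; rewrite -ltNge; lra.
have e : affine (- c%:R) 2 x = dshift x by rewrite /affine /dshift h addrC.
rewrite -e; split; first by split => //; apply/in_digit.
move: Jx h; rewrite /J /affine; case: (c) => /=; rewrite !in_itv/= => /andP[h1 h2] h;
  apply/andP; split; lra.
Qed.

(** The number whose first [n] binary digits are those of [x] at the even positions 0, 2, 4, ...:
    each round reads one digit and skips the next. *)
Fixpoint even_part (n : nat) (x : R) : R :=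
  if n is n'.+1 then ((2^-1 <= x)%R)%:R / 2 + even_part n' (dshift (dshift x)) / 2 else 0.

Lemma even_part_ge0 n x : 0 <= even_part n x.
Proof. by elim: n x => [|n ih] x //=; rewrite addr_ge0// divr_ge0. Qed.

Lemma even_part_le1 n x : even_part n x <= 1.
Proof.
elim: n x => [|n ih] x //=; have := ih (dshift (dshift x)).
by case: (2^-1 <= x) => /= h; lra.
Qed.

Lemma even_part_nd x : nondecreasing_seq (even_part ^~ x).
Proof.
apply/nondecreasing_seqP => n; elim: n x => [|n ih] x /=.
  by rewrite mul0r addr0 divr_ge0.
by rewrite lerD2l ler_pM2r ?invr_gt0// ih.
Qed.

Definition even_digits (x : R) : R := limn (even_part ^~ x).
Definition odd_digits (x : R) : R := even_digits (dshift x).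

Lemma cvg_even_part x : even_part ^~ x @ \oo --> even_digits x.
Proof.
apply: nondecreasing_is_cvgn; first exact: even_part_nd.
by exists 1 => _ [n _ <-]; exact: even_part_le1.
Qed.

Lemma even_digits_itv x : 0 <= even_digits x <= 1.
Proof.
apply/andP; split.
  apply: limr_ge; first exact: cvg_even_part.
  by apply: nearW => n; exact: even_part_ge0.
apply: limr_le; first exact: cvg_even_part.
by apply: nearW => n; exact: even_part_le1.
Qed.

(** Self-similarity: after removal of the leading digit the former even positions are the odd ones.
    The laws below are derived from this equation alone, without expanding the series. *)
Lemma even_digitsE x : even_digits x = ((2^-1 <= x)%R)%:R / 2 + odd_digits (dshift x) / 2.
Proof.
have h := @cvg_even_part x.
rewrite -(cvg_shiftS (even_part ^~ x)) /= in h.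
have h2 : (fun n => ((2^-1 <= x)%R)%:R / 2 + even_part n (dshift (dshift x)) / 2) @ \oo -->
   ((2^-1 <= x)%R)%:R / 2 + odd_digits (dshift x) / 2.
  by apply: cvgD; [exact: cvg_cst|apply: cvgMl; exact: cvg_even_part].
exact: (cvg_unique (@Rhausdorff R) h h2).
Qed.

Lemma measurable_even_part n : measurable_fun [set: MR] (even_part n).
Proof.
elim: n => [|n ih] /=; first exact: measurable_cst.
apply: measurable_funD.
  apply: measurable_funM => //.
  rewrite (_ : (fun x : MR => _) = \1_(digit true)); first exact: measurable_indic (measurable_digit true).
  apply/funext => x; rewrite indicE; congr (nat_of_bool _)%:R.
  by apply/idP/idP => [h|/set_mem/in_digit]//; apply/mem_set/in_digit.
apply: measurable_funM => //.
apply: (measurableT_comp ih); apply: measurableT_comp; exact: measurable_dshift.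
Qed.

Lemma measurable_even_digits : measurable_fun [set: MR] even_digits.
Proof.
apply: (measurable_fun_cvg (h := even_part)) => [n|x _].
  exact: measurable_even_part.
exact: cvg_even_part.
Qed.

Lemma measurable_odd_digits : measurable_fun [set: MR] odd_digits.
Proof. exact: (measurableT_comp measurable_even_digits measurable_dshift). Qed.

End binary_digits.

(** Iterating the second hypothesis bounds [delta] by [C / 2^n] for every [n]. It plays the role of
    a contraction argument: two bounded solutions of the same self-similarity equation coincide. *)
Lemma halving_zero (R : realType) (T : Type) (delta : T -> R) (C : R) :
  (forall t, `|delta t| <= C) ->
  (forall t, exists t', `|delta t| <= `|delta t'| / 2) ->
  forall t, delta t = 0.
Proof.
move=> dC dh.
have bound n t : `|delta t| <= C * (2^-1) ^+ n.
  elim: n t => [|n ih] t; first by rewrite expr0 mulr1.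
  have [t' /le_trans] := dh t; apply.
  by rewrite exprSr mulrA ler_pM2r ?invr_gt0// ih.
move=> t; apply/eqP; rewrite -normr_le0.
have h : (fun n => C * (2^-1) ^+ n) @ \oo --> C * 0.
  by apply: cvgMr; apply: cvg_expr; rewrite ger0_norm ?invr_ge0// invf_lt1 ?ltr1n.
rewrite mulr0 in h; rewrite -(cvg_lim (@Rhausdorff R) h).
by apply: limr_ge; [exact: cvgP h|apply: nearW => n; exact: bound].
Qed.

Section uniform_digits.
Variable R : realType.
Local Notation MR := (measurableTypeR R).
Local Notation U01 := (@uniform_prob R 0 1 ltr01).
Local Notation dshift := (@dshift R).
Local Notation even_digits := (@even_digits R).
Local Notation odd_digits := (@odd_digits R).

Definition uprob (A : set MR) : R := fine (U01 A).

Lemma uprobE A : measurable A -> U01 A = (uprob A)%:E.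
Proof. by move=> mA; rewrite fineK// fin_num_measure. Qed.

Lemma uprob_itv A : measurable A -> 0 <= uprob A <= 1.
Proof.
by move=> mA; rewrite -!lee_fin -uprobE// measure_ge0 probability_le1.
Qed.

Lemma measurable_preim_odd a : measurable ([set x | a < odd_digits x] : set MR).
Proof.
rewrite -[X in measurable X]setTI -preimage_itvoy.
by apply: measurable_odd_digits => //; exact: measurable_itv.
Qed.

Lemma measurable_preim_even a : measurable ([set x | a < even_digits x] : set MR).
Proof.
rewrite -[X in measurable X]setTI -preimage_itvoy.
by apply: measurable_even_digits => //; exact: measurable_itv.
Qed.

Lemma digit_split (S A0 A1 : set MR) : measurable A0 -> measurable A1 ->
  (forall x, S x <-> (if (2^-1 <= x)%R then A1 else A0) (dshift x)) ->
  uprob S = (uprob A0 + uprob A1) / 2.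
Proof.
move=> m0 m1 SA.
have mdc c A : measurable A -> measurable (digit c `&` dshift @^-1` A : set MR).
  move=> mA; apply: measurableI; first exact: measurable_digit.
  by rewrite -[_ @^-1` _]setTI; exact: measurable_dshift.
have -> : S = (digit false `&` dshift @^-1` A0) `|` (digit true `&` dshift @^-1` A1).
  apply/seteqP; split => x.
    move=> /SA; case h : (2^-1 <= x)%R => Ax; [right|left]; split => //; exact/in_digit.
  by move=> [[/in_digit h Ax]|[/in_digit h Ax]]; apply/SA; rewrite h.
rewrite {1}/uprob; transitivity (fine (U01 (digit false `&` dshift @^-1` A0) +
  U01 (digit true `&` dshift @^-1` A1))%E).
  congr fine; rewrite measureU//; [exact: mdc|exact: mdc|].
  rewrite -subset0 => x [[/in_digit h _] [/in_digit]].
  by rewrite h.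
rewrite !digit_indep// !uprobE// -!EFinM -EFinD /=; by field.
Qed.

(** The tail of the uniform law on the unit interval. *)
Definition ctail (a : R) : R := if a < 0 then 1 else if a < 1 then 1 - a else 0.

Lemma ctail_itv a : 0 <= ctail a <= 1.
Proof. by rewrite /ctail; case: ltP => h; [lra|case: ltP => h2; lra]. Qed.

Lemma ctail_split a : ctail a = (ctail (2 * a) + ctail (2 * a - 1)) / 2.
Proof.
rewrite /ctail; case: (ltP a 0) => h1; case: (ltP a 1) => h2;
 case: (ltP (2 * a) 0) => h3; case: (ltP (2 * a) 1) => h4;
 case: (ltP (2 * a - 1) 0) => h5; case: (ltP (2 * a - 1) 1) => h6; lra.
Qed.

Lemma even_gt_split x a : (a < even_digits x) =
  (2 * a - ((2^-1 <= x)%R)%:R < odd_digits (dshift x)).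
Proof.
rewrite even_digitsE; set b := _%:R; set o := odd_digits _.
by apply/idP/idP => h; lra.
Qed.

Lemma odd_law a : uprob [set x | a < odd_digits x] = uprob [set x | a < even_digits x].
Proof.
have m := measurable_preim_even a.
rewrite (@digit_split _ [set x | a < even_digits x] [set x | a < even_digits x])//; first by field.
by move=> x; case: ifP.
Qed.

Lemma digits_lt0 (F : MR -> R) (a : R) : (forall x, 0 <= F x) -> a < 0 -> [set x | a < F x] = setT.
Proof. by move=> F0 a0; apply/seteqP; split => // x _ /=; exact: lt_le_trans (F0 x). Qed.

Lemma digits_ge1 (F : MR -> R) (a : R) : (forall x, F x <= 1) -> 1 <= a -> [set x | a < F x] = set0.
Proof.
move=> F1 a1; apply/seteqP; split => // x /= aF.
by have := lt_le_trans aF (F1 x); rewrite ltNge a1.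
Qed.

Lemma uprobT : uprob setT = 1.
Proof. by rewrite /uprob; have -> : U01 setT = 1%E := probability_setT U01. Qed.

Lemma uprob0 : uprob set0 = 0.
Proof. by rewrite /uprob; have -> : U01 set0 = 0%E := measure0 U01. Qed.

Lemma even_ge0 x : 0 <= even_digits x. Proof. by case/andP: (even_digits_itv x). Qed.
Lemma even_le1 x : even_digits x <= 1. Proof. by case/andP: (even_digits_itv x). Qed.

(** Conditioning on the leading digit replaces the level [a] by [2 * a] and [2 * a - 1]. One of
    these lies outside [[0, 1[], where both sides are 0 or 1, so the defect at [a] is half the
    defect at the other level. *)
Lemma even_law a : uprob [set x | a < even_digits x] = ctail a.
Proof.
apply/eqP; rewrite -subr_eq0; apply/eqP; move: a.
apply: (@halving_zero R R _ 1) => a.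
  have /andP[h1 h2] := ctail_itv a.
  have /andP[h3 h4] := uprob_itv (measurable_preim_even a).
  by rewrite ler_norml; lra.
have split : uprob [set x | a < even_digits x] =
    (uprob [set x | 2 * a < even_digits x] + uprob [set x | 2 * a - 1 < even_digits x]) / 2.
  rewrite -!odd_law; rewrite odd_law; apply: digit_split; try exact: measurable_preim_odd.
  by move=> x; rewrite /= even_gt_split; case: (2^-1 <= x)%R; rewrite ?subr0.
have low b : b < 0 -> uprob [set x | b < even_digits x] = ctail b.
  by move=> b0; rewrite digits_lt0 ?uprobT ?/ctail ?b0//; exact: even_ge0.
have high b : 1 <= b -> uprob [set x | b < even_digits x] = ctail b.
  move=> b1; rewrite digits_ge1 ?uprob0 ?/ctail//; last exact: even_le1.
  by rewrite !ltNge b1 (le_trans ler01 b1).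
have [a2|a2] := ltP a 2^-1.
  exists (2 * a); rewrite split ctail_split (low (2 * a - 1)); last by lra.
  rewrite (_ : _ - _ = (uprob [set x | 2 * a < even_digits x] - ctail (2 * a)) / 2); last by field.
  by rewrite normrM (@ger0_norm _ 2^-1).
exists (2 * a - 1); rewrite split ctail_split (high (2 * a)); last by lra.
rewrite (_ : _ - _ = (uprob [set x | 2 * a - 1 < even_digits x] - ctail (2 * a - 1)) / 2); last by field.
by rewrite normrM (@ger0_norm _ 2^-1).
Qed.

(* Splitting on the leading digit expresses the defect at [(a, b)] as half the
   defect at another point, the other half being a trivial case; a bounded
   function with this property vanishes. *)
Lemma even_odd_law a b :
  uprob ([set x | a < even_digits x] `&` [set x | b < odd_digits x]) = ctail a * ctail b.
Proof.
pose J a b : set MR := [set x | a < even_digits x] `&` [set x | b < odd_digits x].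
have mJ c e : measurable (J c e).
  by apply: measurableI; [exact: measurable_preim_even|exact: measurable_preim_odd].
apply/eqP; rewrite -subr_eq0; apply/eqP.
pose delta (p : R * R) := uprob (J p.1 p.2) - ctail p.1 * ctail p.2.
rewrite -[LHS]/(delta (a, b)); move: (a, b) => {a b}.
apply: (@halving_zero R _ delta 1) => -[a b]; rewrite /delta /=.
  have /andP[h1 h2] := ctail_itv a; have /andP[h1' h2'] := ctail_itv b.
  have /andP[h3 h4] := uprob_itv (mJ a b).
  have h5 : 0 <= ctail a * ctail b by exact: mulr_ge0.
  have h6 : ctail a * ctail b <= 1 by rewrite mulr_ile1.
  by rewrite ler_norml; lra.
have split : uprob (J a b) = (uprob (J b (2 * a)) + uprob (J b (2 * a - 1))) / 2.
  apply: digit_split => // x; rewrite /J /= even_gt_split /odd_digits.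
  by case: (2^-1 <= x)%R; rewrite ?subr0; split => -[].
have low c : c < 0 -> uprob (J b c) = ctail b * ctail c.
  move=> c0; rewrite /J (@digits_lt0 odd_digits)//; last by move=> x; exact: even_ge0.
  by rewrite setIT even_law [ctail c]/ctail c0 mulr1.
have high c : 1 <= c -> uprob (J b c) = ctail b * ctail c.
  move=> c1; rewrite /J (@digits_ge1 odd_digits)//; last by move=> x; exact: even_le1.
  by rewrite setI0 uprob0 [ctail c]/ctail !ltNge c1 (le_trans ler01 c1) mulr0.
have [a2|a2] := ltP a 2^-1.
  exists (b, 2 * a); rewrite /= split (ctail_split a) (low (2 * a - 1)); last by lra.
  rewrite (_ : _ - _ = (uprob (J b (2 * a)) - ctail b * ctail (2 * a)) / 2); last by field.
  by rewrite normrM (@ger0_norm _ 2^-1).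
exists (b, 2 * a - 1); rewrite /= split (ctail_split a) (high (2 * a)); last by lra.
rewrite (_ : _ - _ = (uprob (J b (2 * a - 1)) - ctail b * ctail (2 * a - 1)) / 2); last by field.
by rewrite normrM (@ger0_norm _ 2^-1).
Qed.

End uniform_digits.

Lemma ray_cover (R : realType) : \bigcup_k (`](- k%:R : R), +oo[%classic : set R) = setT.
Proof.
rewrite -subTset => x _; exists (Num.bound `|x|) => //=.
rewrite in_itv/= andbT ltrNl (le_lt_trans _ (archi_boundP (normr_ge0 x)))//.
by rewrite -normrN ler_norm.
Qed.

Lemma law_unique_tail d1 (T1 : measurableType d1) d2 (T2 : measurableType d2)
    (R : realType) (P1 : probability T1 R) (P2 : probability T2 R)
    (Y1 : T1 -> measurableTypeR R) (Y2 : T2 -> measurableTypeR R) :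
  measurable_fun setT Y1 -> measurable_fun setT Y2 ->
  (forall a : R, P1 (Y1 @^-1` `]a, +oo[%classic) = P2 (Y2 @^-1` `]a, +oo[%classic)) ->
  forall B : set (measurableTypeR R), measurable B -> P1 (Y1 @^-1` B) = P2 (Y2 @^-1` B).
Proof.
move=> mY1 mY2 h B mB.
rewrite -[LHS]/(pushforward P1 Y1 B) -[RHS]/(pushforward P2 Y2 B).
apply: (@measure_unique _ R (measurableTypeR R) (@RGenOInfty.G R)
  (fun k => `](- k%:R : R), +oo[%classic)) => //.
- exact: RGenOInfty.measurableE.
- move=> _ _ [x ->] [y ->]; exists (Num.max x y).
  by apply/seteqP; split => z /=; rewrite !in_itv/= !andbT gt_max => /andP.
- by move=> k; exists (- k%:R).
- exact: ray_cover.
- by move=> _ [x ->]; exact: h.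
- move=> k; rewrite /= /pushforward (le_lt_trans (probability_le1 _ _)) ?ltry//.
  by rewrite -[_ @^-1` _]setTI; apply: mY1 => //; exact: measurable_itv.
Qed.

Section independence.
Context d (T : measurableType d) (R : realType) (P : probability T R).
Local Notation p A := (fine (P A)).

Lemma Rint_indic (A : set T) : measurable A -> Rintegral P setT (\1_A : T -> R) = p A.
Proof. by move=> mA; rewrite /Rintegral integral_indic// setIT. Qed.

Lemma Rint_cst (c : R) : Rintegral P setT (fun=> c) = c.
Proof.
rewrite Rintegral_cst// (_ : fine _ = 1) ?mulr1//.
exact: (congr1 fine (probability_setT P)).
Qed.

Lemma L1_indic (A : set T) : measurable A -> L1 P setT (\1_A : T -> R).
Proof. by move=> mA; exact: integrable_indic. Qed.

(** [orth_rays] is applied twice, each time to a centred indicator [\1_A - p A]: the first use frees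
    the event of [Y1], the second that of [Y2]. *)
Lemma indep_tails (Y1 Y2 : T -> R) : measurable_fun setT Y1 -> measurable_fun setT Y2 ->
  (forall a b : R, p (Y1 @^-1` `]a, +oo[%classic `&` Y2 @^-1` `]b, +oo[%classic) =
    p (Y1 @^-1` `]a, +oo[%classic) * p (Y2 @^-1` `]b, +oo[%classic)) ->
  forall B1 B2 : set R, measurable B1 -> measurable B2 ->
    p (Y1 @^-1` B1 `&` Y2 @^-1` B2) = p (Y1 @^-1` B1) * p (Y2 @^-1` B2).
Proof.
move=> mY1 mY2 h.
have mp (Y : T -> R) (B : set R) : measurable_fun setT Y -> measurable B -> measurable (Y @^-1` B).
  by move=> mY mB; rewrite -[_ @^-1` _]setTI; exact: mY.
have aux (Y : T -> R) (A : set T) (B : set R) : measurable_fun setT Y -> measurable A -> measurable B ->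
    Rintegral P setT (fun w => (\1_A w - p A) * \1_B (Y w)) = p (Y @^-1` B `&` A) - p (Y @^-1` B) * p A.
  move=> mY mA mB.
  have mYB := mp _ _ mY mB.
  rewrite -!Rint_indic//; last exact: measurableI.
  rewrite -RintegralZr//; last exact: L1_indic.
  rewrite -RintegralB//; last 2 first.
  - by apply: L1_indic; exact: measurableI.
  - apply: (L1_ext measurableT (f := fun w => p A * \1_(Y @^-1` B) w)).
      by move=> w _; rewrite Rint_indic// mulrC.
    by apply: L1Z => //; exact: L1_indic.
  apply: Rint_ext => w _; rewrite !Rint_indic//.
  rewrite in_setI !indicE (_ : (w \in Y @^-1` B) = (Y w \in B))//.
  by case: (_ \in B); case: (_ \in A) => /=; ring.
have lA (A : set T) : measurable A -> L1 P setT (fun w => \1_A w - p A) /\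
    Rintegral P setT (fun w => \1_A w - p A) = 0.
  move=> mA; have lc : L1 P setT (fun=> p A) by exact: finite_measure_integrable_cst.
  have lA := L1_indic mA.
  split; first by apply: L1B.
  by rewrite RintegralB// Rint_indic// Rint_cst subrr.
have step1 (b : R) B1 : measurable B1 -> p (Y1 @^-1` B1 `&` Y2 @^-1` `]b, +oo[%classic) =
    p (Y1 @^-1` B1) * p (Y2 @^-1` `]b, +oo[%classic).
  move=> mB1; pose A := Y2 @^-1` `]b, +oo[%classic.
  have mA : measurable A by apply: mp => //; exact: measurable_itv.
  have [l0 e0] := lA _ mA.
  apply/eqP; rewrite -subr_eq0 -aux//; apply/eqP.
  apply: orth_rays => // c; rewrite aux//.
  by rewrite h subrr.
move=> B1 B2 mB1 mB2; have mA := mp _ _ mY1 mB1.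
have [l0 e0] := lA _ mA.
rewrite setIC mulrC; apply/eqP; rewrite -subr_eq0 -aux//; apply/eqP.
apply: orth_rays => // c; rewrite aux//.
by rewrite setIC step1// mulrC subrr.
Qed.

End independence.

(** * Quantile transform and construction of the normal sequence *)

Section normal_quantile.
Variable R : realType.
Local Notation MR := (measurableTypeR R).
Local Notation N01 := (@normal_prob R 0 1).

(** The identity as a random variable under N(0,1), which gives access to the general properties of
    distribution functions. *)
Let idMR : MR -> R := idfun.

#[local] HB.instance Definition _ :=
  @isMeasurableFun.Build _ _ _ _ idMR (@measurable_id _ _ setT).

Let Fe (x : R) := cdf (idMR : {RV N01 >-> R}) x.

Definition normal_cdf (x : R) : R := fine (N01 `]-oo, x]%classic).

Let FeE x : Fe x = (normal_cdf x)%:E.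
Proof. by rewrite /normal_cdf fineK// fin_num_measure. Qed.

Lemma normal_cdf_itv x : 0 <= normal_cdf x <= 1.
Proof. by rewrite -!lee_fin -FeE cdf_ge0 cdf_le1. Qed.

Lemma normal_cdf_nd : {homo normal_cdf : x y / x <= y}.
Proof. by move=> x y xy; rewrite -lee_fin -!FeE; exact: cdf_nondecreasing. Qed.

Let normal_cdf_right x p : normal_cdf x < p -> exists2 y, x < y & normal_cdf y < p.
Proof.
move=> xp; have : Fe y @[y --> x^'+] --> Fe x by exact: cdf_right_continuous.
rewrite FeE => /fine_cvgP[_ /cvgr_lt/(_ _ xp) h].
have : \forall y \near x^'+, (x < y) /\ (fine \o Fe) y < p.
  by near=> y; split; [by []|near: y].
by move=> /filter_ex[y [xy yp]]; exists y => //; move: yp; rewrite /= FeE.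
Unshelve. all: by end_near. Qed.

Let normal_cdf_small p : 0 < p -> exists y, normal_cdf y < p.
Proof.
move=> p0; have : Fe y @[y --> -oo%R] --> 0%E by exact: cvg_cdfNy0.
move=> /fine_cvgP[_ /cvgr_lt/(_ _ p0)] /filter_ex[y].
by rewrite /= FeE /= => h; exists y.
Qed.

Let normal_cdf_large p : p < 1 -> exists y, p < normal_cdf y.
Proof.
move=> p1; have : Fe y @[y --> +oo%R] --> 1%E by exact: cvg_cdfy1.
move=> /fine_cvgP[_ /cvgr_gt/(_ _ p1)] /filter_ex[y].
by rewrite /= FeE /= => h; exists y.
Qed.

(** The generalised inverse of the distribution function. Outside []0, 1[] the infimum would be over
    an empty or an unbounded set or depend on attained limits, so the value 0 is put there; a
    uniform variable avoids these levels almost surely. *)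
Definition normal_quantile (p : R) : R :=
  if 0 < p < 1 then inf [set y | p <= normal_cdf y] else 0.

(** Right continuity is essential from right to left: it yields some [y > x] with
    [normal_cdf y < p], and such a [y] bounds the defining set from below. *)
Lemma normal_quantile_gt p x : 0 < p < 1 -> (x < normal_quantile p) = (normal_cdf x < p).
Proof.
move=> p01; rewrite /normal_quantile p01; have /andP[p0 p1] := p01.
pose S := [set y | p <= normal_cdf y].
have lbS y : normal_cdf y < p -> lbound S y.
  move=> yp z /= pz; rewrite leNgt; apply/negP => zy.
  have := le_lt_trans pz (le_lt_trans (normal_cdf_nd (ltW zy)) yp).
  by rewrite ltxx.
have S0 : S !=set0 by have [y /ltW py] := normal_cdf_large p1; exists y.
apply/idP/idP => [xS|xp].
  rewrite ltNge; apply/negP => px.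
  have [y yp] := normal_cdf_small p0.
  have := ge_inf (E := S) (ex_intro _ y (lbS _ yp)) px.
  by rewrite leNgt xS.
have [y xy yp] := normal_cdf_right xp.
by apply: (lt_le_trans xy); apply: lb_le_inf => //; exact: lbS.
Qed.

Lemma measurable_normal_quantile :
  measurable_fun [set: MR] (normal_quantile : MR -> MR).
Proof.
apply: (measurability _ (RGenOInfty.measurableE R)) => // _ [_ [x ->] <-].
rewrite setTI.
have -> : normal_quantile @^-1` `]x, +oo[%classic =
  (`]0, 1[ `&` `]normal_cdf x, +oo[) `|` (~` `]0, 1[ `&` (if x < 0 then setT else set0)) :> set MR.
  apply/seteqP; split => p /=.
    rewrite in_itv/= andbT; have [p01|p01] := boolP (0 < p < 1).
      by rewrite normal_quantile_gt// => h; left; rewrite !in_itv/= p01 h.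
    rewrite /normal_quantile (negbTE p01) => x0; right; rewrite in_itv/= (negbTE p01) x0.
    by split.
  rewrite !in_itv/= !andbT => -[[p01 h]|[/negP p01 h]].
    by rewrite normal_quantile_gt.
  by rewrite /normal_quantile (negbTE p01); move: h; case: ifP.
apply: measurableU; apply: measurableI; try exact: measurable_itv.
  by apply: measurableC; exact: measurable_itv.
by case: ifP.
Qed.

End normal_quantile.

Section iid_existence.
Variable R : realType.
Local Notation MR := (measurableTypeR R).
Local Notation N01 := (@normal_prob R 0 1).
Local Notation U01 := (@uniform_prob R 0 1 ltr01).
Local Notation even_digits := (@even_digits R).
Local Notation odd_digits := (@odd_digits R).
Local Notation uprob := (@uprob R).

Lemma uprob_ray a : uprob `]a, +oo[%classic = ctail a.
Proof.
rewrite /uprob uniform01E; last exact: measurable_itv.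
have -> : (`]a, +oo[ `&` `[0, 1])%classic =
    [set` if a < 0 then `[0, 1] else `]a, 1]] :> set R.
  apply/seteqP; split => x /=; case: ifPn => a0; rewrite !in_itv/= ?andbT.
  - by move=> [].
  - by move=> [-> /andP[_ ->]].
  - by move=> /andP[x0 x1]; rewrite (lt_le_trans a0 x0) x0 x1.
  - by rewrite -leNgt in a0 => /andP[ax x1]; rewrite ax x1 (le_trans a0 (ltW ax)).
rewrite /ctail; case: ifPn => a0; rewrite lebesgue_measure_itv/= lte_fin.
  by rewrite ltr01 sube0.
by case: ifPn => a1.
Qed.

Lemma odd_digits_uniform (B : set MR) : measurable B -> U01 (odd_digits @^-1` B) = U01 B.
Proof.
move=> mB; apply: (@law_unique_tail _ MR _ MR R U01 U01 odd_digits idfun) => //;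
  [exact: measurable_odd_digits|exact: measurable_id|].
move=> a; rewrite (_ : odd_digits @^-1` _ = [set x | a < odd_digits x]); last exact: preimage_itvoy.
transitivity ((ctail a)%:E).
  by rewrite -even_law -odd_law -uprobE//; exact: measurable_preim_odd.
by rewrite -uprob_ray -uprobE//; exact: measurable_itv.
Qed.

Lemma digits_indep (A B : set MR) : measurable A -> measurable B ->
  U01 (even_digits @^-1` A `&` odd_digits @^-1` B) = (U01 (even_digits @^-1` A) * U01 B)%E.
Proof.
move=> mA mB.
have mpe C : measurable C -> measurable (even_digits @^-1` C : set MR).
  by move=> mC; rewrite -[_ @^-1` _]setTI; exact: measurable_even_digits.
have mpo C : measurable C -> measurable (odd_digits @^-1` C : set MR).
  by move=> mC; rewrite -[_ @^-1` _]setTI; exact: measurable_odd_digits.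
have h : uprob (even_digits @^-1` A `&` odd_digits @^-1` B) =
    uprob (even_digits @^-1` A) * uprob (odd_digits @^-1` B).
  apply: (@indep_tails _ MR R U01 even_digits odd_digits) => //.
  - exact: measurable_even_digits.
  - exact: measurable_odd_digits.
  move=> a b; rewrite !preimage_itvoy.
  by rewrite -!/(uprob _) even_odd_law even_law odd_law even_law.
rewrite -(odd_digits_uniform mB) uprobE; last by apply: measurableI; [exact: mpe|exact: mpo].
by rewrite h EFinM -!uprobE//; [exact: mpo|exact: mpe].
Qed.

(** Each [odd_digits] discards the positions already used, so distinct indices read disjoint sets of
    binary positions of the same [x]. *)
Definition gauss_seq (i : nat) (x : MR) : R :=
  normal_quantile (even_digits (iter i odd_digits x)).

Lemma measurable_iter_odd i : measurable_fun [set: MR] (iter i odd_digits : MR -> MR).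
Proof.
elim: i => [|i ih]; first exact: measurable_id.
exact: (measurableT_comp (@measurable_odd_digits R) ih).
Qed.

Lemma measurable_gauss_seq i : measurable_fun [set: MR] (gauss_seq i : MR -> MR).
Proof.
apply: (measurableT_comp (@measurable_normal_quantile R)).
apply: (measurableT_comp (@measurable_even_digits R)); exact: measurable_iter_odd.
Qed.

Lemma iter_odd_uniform i (B : set MR) : measurable B -> U01 (iter i odd_digits @^-1` B) = U01 B.
Proof.
elim: i B => [|i ih] B mB//.
rewrite -[LHS]/(U01 (iter i odd_digits @^-1` (odd_digits @^-1` B))) ih ?odd_digits_uniform//.
by rewrite -[_ @^-1` _]setTI; exact: measurable_odd_digits.
Qed.

Lemma ctail_cdf x : (ctail (normal_cdf x))%:E = N01 `]x, +oo[%classic.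
Proof.
have /andP[h0 h1] := @normal_cdf_itv R x.
have -> : ctail (normal_cdf x) = 1 - normal_cdf x.
  rewrite /ctail ltNge h0 /=; case: ltP => // h; apply/esym/eqP.
  by rewrite subr_eq0 eq_le h h1.
have -> : (`]x, +oo[ = ~` `]-oo, x])%classic.
  by apply/seteqP; split => y /=; rewrite !in_itv/= andbT ltNge => /negP.
have -> : N01 (~` `]-oo, x]%classic) = (1 - N01 `]-oo, x]%classic)%E.
  by apply: probability_setC; exact: measurable_itv.
by rewrite EFinB /normal_cdf fineK// fin_num_measure//; exact: measurable_itv.
Qed.

Lemma uprob_le A B : measurable A -> measurable B -> A `<=` B -> uprob A <= uprob B.
Proof.
by move=> mA mB AB; rewrite -lee_fin -!uprobE//; apply: le_measure => //; rewrite inE.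
Qed.

Lemma quantile_law (B : set MR) : measurable B -> U01 (gauss_seq 0 @^-1` B) = N01 B.
Proof.
move=> mB; apply: (@law_unique_tail _ MR _ MR R U01 N01 (gauss_seq 0) idfun) => //;
  [exact: measurable_gauss_seq|exact: measurable_id|].
move=> x; have mray : measurable (`]x, +oo[%classic : set MR) by exact: measurable_itv.
have mpz : measurable (gauss_seq 0 @^-1` `]x, +oo[%classic).
  by rewrite -[_ @^-1` _]setTI; exact: measurable_gauss_seq.
have mpe (c : R) : measurable ([set z | c < even_digits z] : set MR).
  exact: measurable_preim_even.
transitivity (uprob (gauss_seq 0 @^-1` `]x, +oo[%classic))%:E; first by rewrite -uprobE.
transitivity (ctail (normal_cdf x))%:E; last exact: ctail_cdf.
congr EFin; rewrite -even_law.
have upU (A C : set MR) : measurable A -> measurable C -> uprob (A `|` C) <= uprob A + uprob C.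
  move=> mA mC; rewrite -lee_fin EFinD -!uprobE//; last exact: measurableU.
  exact: measureU2.
have small (c : R) : 0 < c < 1 -> uprob [set z | 1 - c < even_digits z] = c.
  by move=> /andP[c0 c1]; rewrite even_law /ctail ltNge subr_ge0 (ltW c1)/= ltrBlDr ltrDl c0; ring.
pose Z0 : set MR := [set z | 0 < even_digits z].
have low0 : uprob (~` Z0) = 0.
  have : uprob Z0 = 1 by rewrite even_law /ctail ltxx ltr01 subr0.
  rewrite [in X in _ -> X]/uprob; have -> : U01 (~` Z0) = (1 - U01 Z0)%E.
    by apply: probability_setC; exact: mpe.
  by rewrite uprobE ?[fine _]/= => [->|]; [rewrite subrr|exact: mpe].
(* [normal_quantile_gt] applies only at levels in []0, 1[]. Level 0 is excluded by a null set, and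
   level 1 by a set of probability [c] that can be made arbitrarily small. *)
have all_small (A C : set MR) : measurable A -> measurable C ->
    (forall z, 0 < even_digits z < 1 -> A z -> C z) -> uprob A <= uprob C.
  move=> mA mC AC; apply/ler_addgt0Pr => e e0.
  pose c := Num.min e 2^-1.
  have c01 : 0 < c < 1 by rewrite lt_min e0 invr_gt0 ltr0n /= gt_min invf_lt1 ?ltr1n ?orbT.
  have ce : c <= e by rewrite ge_min lexx.
  have sub : A `<=` (C `|` ~` Z0) `|` [set z | 1 - c < even_digits z].
    move=> z Az; have [h1|h1] := ltP (1 - c) (even_digits z); first by right.
    have [h0|h0] := ltP 0 (even_digits z); last by left; right; apply/negP; rewrite -leNgt.
    left; left; apply: AC => //; rewrite h0 (le_lt_trans h1)//.
    by rewrite ltrBlDr ltrDl; case/andP: c01.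
  have mC0 : measurable (~` Z0 : set MR) by apply: measurableC; exact: mpe.
  have m1 := measurableU _ _ mC mC0.
  apply: (le_trans (uprob_le mA (measurableU _ _ m1 (mpe _)) sub)).
  apply: (le_trans (upU _ _ m1 (mpe _))); rewrite small// lerD//.
  by apply: (le_trans (upU _ _ mC mC0)); rewrite low0 addr0.
apply/eqP; rewrite eq_le; apply/andP; split; apply: all_small => //.
- by move=> z z01; rewrite /= in_itv/= andbT /gauss_seq /= normal_quantile_gt.
- by move=> z z01; rewrite /= in_itv/= andbT /gauss_seq /= normal_quantile_gt.
Qed.

Lemma gauss_seq_law i (B : set MR) : measurable B -> U01 (gauss_seq i @^-1` B) = N01 B.
Proof.
move=> mB; rewrite -quantile_law//.
rewrite -[LHS]/(U01 (iter i odd_digits @^-1` (gauss_seq 0 @^-1` B))) iter_odd_uniform//.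
by rewrite -[_ @^-1` _]setTI; exact: measurable_gauss_seq.
Qed.

(** The variable of index 0 depends on the even digits and all the others on the odd digits, on
    which they form the same sequence shifted by one index; this drives the induction. *)
Lemma gauss_seq_indep n (B : nat -> set MR) : (forall i, measurable (B i)) ->
  U01 (\bigcap_(i in `I_n) (gauss_seq i @^-1` B i)) = (\prod_(i < n) N01 (B i))%E.
Proof.
elim: n B => [|n ih] B mB.
  by rewrite II0 bigcap_set0 big_ord0; exact: probability_setT.
rewrite big_ord_recl.
have := ih (fun i => B i.+1) (fun i => mB i.+1); rewrite /= => <-.
have mpg i (C : set MR) : measurable C -> measurable (gauss_seq i @^-1` C).
  by move=> mC; rewrite -[_ @^-1` _]setTI; exact: measurable_gauss_seq.
have -> : \bigcap_(i in `I_n.+1) (gauss_seq i @^-1` B i) =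
    even_digits @^-1` (@normal_quantile R @^-1` B 0%N) `&`
    odd_digits @^-1` (\bigcap_(i in `I_n) (gauss_seq i @^-1` B i.+1)).
  apply/seteqP; split => z.
    move=> h; split; first exact: (h 0%N).
    move=> i /= ilt; have := h i.+1 ilt.
    by rewrite /gauss_seq /= -iterSr.
  move=> [h0 h] [|i] /= ilt //; have := h i ilt.
  by rewrite /gauss_seq /= -iterSr.
rewrite digits_indep//; last 2 first.
- by rewrite -[_ @^-1` _]setTI; exact: measurable_normal_quantile.
- by apply: fin_bigcap_measurable => // i _; exact: mpg.
congr (_ * _)%E; exact: (quantile_law (mB 0%N)).
Qed.

Lemma exists_iid_standard_normal : iid_standard_normal (U01 : probability MR R) gauss_seq.
Proof.
split.
- by move=> i; exact: measurable_gauss_seq.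
- by move=> i B mB; exact: gauss_seq_law.
move=> J B mB.
pose n := (\max_(i <- J) i).+1.
have Jn i : i \in J -> (i < n)%N by move=> iJ; rewrite ltnS; exact: leq_bigmax_seq.
(* A general finite index set is completed to an initial segment by trivial events. *)
pose B' i := if i \in J then B i else setT.
have mB' i : measurable (B' i) by rewrite /B'; case: ifP.
have := gauss_seq_indep n mB'.
have -> : \bigcap_(i in `I_n) (gauss_seq i @^-1` B' i) =
   \bigcap_(i in [set` J]) (gauss_seq i @^-1` B i).
  apply/seteqP; split => z h i /= iJ.
    by have := h i (Jn i iJ); rewrite /B' iJ.
  by rewrite /B'; case: ifPn => // iJ'; exact: h.
move=> h; apply: (eq_trans h).
rewrite -(big_mkord xpredT (fun i => N01 (B' i))).
rewrite (bigID (fun i => i \in J)) /= [X in (_ * X)%E]big1 ?mule1; last first.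
  by move=> i /negbTE iJ; rewrite /B' iJ; exact: probability_setT.
rewrite -big_filter.
transitivity (\prod_(i <- J) N01 (B' i))%E.
  apply: perm_big; apply: uniq_perm.
  - by rewrite filter_uniq// iota_uniq.
  - exact: fset_uniq.
  - move=> i; rewrite mem_filter mem_index_iota /=.
    by apply/andP/idP => [[]//|iJ]; split => //; exact: Jn.
rewrite big_seq [in RHS]big_seq; apply: eq_bigr => i iJ.
by rewrite /B' iJ; apply/esym; exact: gauss_seq_law.
Qed.

End iid_existence.

Section iid_moments.
Context d (Omega : measurableType d) (R : realType) (P : probability Omega R).
Variable omega : nat -> Omega -> R.
Hypothesis iid : iid_standard_normal P omega.
Local Notation N01 := (@normal_prob R 0 1).
Local Notation MR := (measurableTypeR R).

Let momega i : measurable_fun setT (omega i : Omega -> MR).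
Proof. by case: iid. Qed.

Let law i (B : set MR) : measurable B -> P (omega i @^-1` B) = N01 B.
Proof. by case: iid => _ h _; exact: h. Qed.

Lemma iid_L2 i : L2 P (omega i).
Proof.
split; first exact: momega.
apply: (@same_law_integrable _ MR _ Omega _ MR R N01 P idfun (omega i) _ _ _ (fun x => x ^+ 2)) => //.
- exact: measurable_id.
- by move=> B mB; exact/esym/law.
- exact: normal_sq_integrable.
Qed.

Lemma iid_sq i : Rintegral P setT (fun w => omega i w ^+ 2) = normal_m2 R.
Proof.
apply: (@same_law_Rint _ Omega _ MR _ MR R P N01 (omega i) idfun _ _ _ (fun x => x ^+ 2)) => //.
- exact: measurable_id.
- by move=> B mB; exact: law.
Qed.

(** By independence and the symmetry of N(0,1), both pairs have the product law N(0,1) x N(0,1).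
    Applied to the product of the coordinates, this makes the covariance equal to its opposite. *)
Let pair_law (phi : MR * MR -> R) i j : i != j -> measurable_fun setT phi ->
  Rintegral P setT (fun w => phi (omega i w, omega j w)) =
  Rintegral P setT (fun w => phi (- omega i w, omega j w)).
Proof.
move=> ij mphi.
have indep (A B : set MR) : measurable A -> measurable B ->
    P (omega i @^-1` A `&` omega j @^-1` B) = (N01 A * N01 B)%E.
  move=> mA mB; case: iid => _ _ /(_ [fset i; j]%fset (fun k => if k == i then A else B)).
  rewrite big_fsetU1 ?inE//= big_seq_fset1 eqxx eq_sym (negbTE ij) !law// => <-//.
    congr (P _); apply/seteqP; split => w /=.
      move=> [Ai Bj] k; rewrite /= !inE => /orP[] /eqP ->; rewrite ?eqxx//.
      by rewrite eq_sym (negbTE ij).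
    move=> h; split.
      by have := h i; rewrite /= !inE eqxx /=; exact.
    by have := h j; rewrite /= !inE eqxx orbT eq_sym (negbTE ij) /=; exact.
  by move=> k; case: ifP.
have mN : measurable_fun setT (fun w => - omega i w : MR).
  exact: (measurable_funN (momega i)).
have m1 : measurable_fun setT (fun w => (omega i w, omega j w) : MR * MR).
  by apply/measurable_fun_pairP; split; exact: momega.
have m2 : measurable_fun setT (fun w => (- omega i w, omega j w) : MR * MR).
  by apply/measurable_fun_pairP; split; [exact: mN|exact: momega].
have unique (V : Omega -> MR * MR) : measurable_fun setT V ->
    (forall A B, measurable A -> measurable B -> P (V @^-1` (A `*` B)) = (N01 A * N01 B)%E) ->
    forall X, measurable X -> P (V @^-1` X) = (N01 \x N01)%E X.
  move=> mV h X mX; rewrite -[LHS]/(pushforward P V X); apply/esym.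
  by apply: (@product_measure_unique _ _ MR MR R N01 N01).
apply: (same_law_Rint m1 m2 _ mphi) => X mX.
transitivity ((N01 \x N01)%E X).
  by apply: (unique _ m1) => // A B mA mB; rewrite -indep.
apply/esym; apply: (unique _ m2) => // A B mA mB.
have mNA : measurable (-%R @^-1` A : set MR).
  by rewrite -[_ @^-1` _]setTI; exact: oppr_measurable.
by rewrite [in RHS](normal_prob_opp mA) -indep.
Qed.

Lemma iid_orth i j : i != j -> Rintegral P setT (fun w => omega i w * omega j w) = 0.
Proof.
move=> ij; have lij := L2_mul (iid_L2 i) (iid_L2 j).
have /eqP := pair_law (phi := fun z => z.1 * z.2) ij (measurable_funM measurable_fst measurable_snd).
have -> : Rintegral P setT (fun w => - omega i w * omega j w) =
    - Rintegral P setT (fun w => omega i w * omega j w).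
  rewrite -mulN1r -RintegralZl//; apply: Rint_ext => w _; ring.
by rewrite -subr_eq0 opprK -mulr2n mulrn_eq0 => /eqP.
Qed.

Lemma iid_cov i j : Rintegral P setT (fun w => omega i w * omega j w) = normal_m2 R * (i == j)%:R.
Proof.
have [<-|ij] := eqVneq i j; last by rewrite mulr0 iid_orth.
by rewrite mulr1 -(iid_sq i).
Qed.

End iid_moments.

(** * Orthonormal bases and Riesz representation *)

Section hilbert.
Variables (R : realType) (H : completeNormedModType R) (ip : {dot H for idfun}).
Hypothesis ip_norm : hilbert_norm ip.
Implicit Types x y z : H.

Lemma ipC x y : ip x y = ip y x.
Proof. by rewrite (hermC ip) expr0 mul1r. Qed.

Lemma ipDr x y z : ip x (y + z) = ip x y + ip x z. Proof. exact: linearDr. Qed.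
Lemma ipDl x y z : ip (x + y) z = ip x z + ip y z. Proof. exact: linearDl. Qed.
Lemma ipBr x y z : ip x (y - z) = ip x y - ip x z. Proof. exact: linearBr. Qed.
Lemma ipBl x y z : ip (x - y) z = ip x z - ip y z. Proof. exact: linearBl. Qed.
Lemma ipZl c x y : ip (c *: x) y = c * ip x y. Proof. exact: linearZl_LR. Qed.
Lemma ipZr c x y : ip x (c *: y) = c * ip x y. Proof. by rewrite ipC ipZl ipC. Qed.
Lemma ip0l x : ip 0 x = 0. Proof. exact: linear0l. Qed.
Lemma ip0r x : ip x 0 = 0. Proof. exact: linear0r. Qed.

Lemma ip_suml I (r : seq I) (F : I -> H) x :
  ip (\sum_(i <- r) F i) x = \sum_(i <- r) ip (F i) x.
Proof. exact: linear_sumlz. Qed.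

Lemma ip_sumr I (r : seq I) (F : I -> H) x :
  ip x (\sum_(i <- r) F i) = \sum_(i <- r) ip x (F i).
Proof. exact: linear_sumr. Qed.

Lemma ip_eq0 x : ip x x = 0 -> x = 0.
Proof. by rewrite ip_norm => /eqP; rewrite sqrf_eq0 normr_eq0 => /eqP. Qed.

Lemma cauchy_schwarz x y : `|ip x y| <= `|x| * `|y|.
Proof.
have [->|y0] := eqVneq y 0; first by rewrite ip0r !normr0 mulr0.
have n0 : 0 < `|y| ^+ 2 by rewrite exprn_gt0// normr_gt0.
have h : 0 <= ip (`|y| ^+ 2 *: x - ip x y *: y) (`|y| ^+ 2 *: x - ip x y *: y).
  by rewrite ip_norm sqr_ge0.
rewrite !(ipBl, ipBr, ipZl, ipZr) (ipC y x) !ip_norm in h.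
have {}h : 0 <= `|y| ^+ 2 * (`|x| ^+ 2 * `|y| ^+ 2 - ip x y ^+ 2).
  by move: h; congr (_ <= _); ring.
rewrite pmulr_rge0// subr_ge0 -exprMn in h.
by rewrite -ler_sqr ?nnegrE// ?mulr_ge0// real_normK ?num_real.
Qed.

Lemma cvg_ip (v : nat -> H) x y : v @ \oo --> x -> (fun n => ip (v n) y) @ \oo --> ip x y.
Proof.
move=> vx; apply/cvgrPdist_le => e e0.
have e1 : 0 < e / (`|y| + 1) by rewrite divr_gt0// ltr_wpDl.
move/cvgrPdist_le : vx => /(_ _ e1); apply: filterS => n h.
rewrite -ipBl (le_trans (cauchy_schwarz _ _))//.
apply: (le_trans (ler_wpM2r (normr_ge0 y) h)).
rewrite mulrAC ler_pdivrMr; last by rewrite ltr_wpDl.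
by rewrite ler_wpM2l ?(ltW e0)// lerDl.
Qed.

Section gram_schmidt.
Variable d : nat -> H.

Definition residual (s : seq H) x := x - \sum_(h <- s) ip x h *: h.

(** Normalising the first vector of the sequence that is not yet spanned, instead of treating [d n]
    at stage [n], ensures that zero vectors occur only once the sequence is exhausted, as
    [orthonormal_basis] requires. *)
Definition next_vector (s : seq H) : H :=
  if pselect (exists m, residual s (d m) != 0) is left ex
  then let r := residual s (d (ex_minn ex)) in `|r|^-1 *: r
  else 0.

Fixpoint gs_seq n : seq H := if n is n'.+1 then rcons (gs_seq n') (next_vector (gs_seq n')) else [::].

Definition gs n := next_vector (gs_seq n).

Lemma gs_seqE n x : residual (gs_seq n) x = x - \sum_(i < n) ip x (gs i) *: gs i.
Proof.
rewrite /residual; congr (_ - _); elim: n => [|n ih] /=; first by rewrite big_nil big_ord0.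
by rewrite big_rcons /= big_ord_recr /= ih addrC.
Qed.

Lemma residualS n x : residual (gs_seq n.+1) x = residual (gs_seq n) x - ip x (gs n) *: gs n.
Proof. by rewrite !gs_seqE big_ord_recr /= opprD addrA. Qed.

Lemma residualD n x y : residual (gs_seq n) (x - y) = residual (gs_seq n) x - residual (gs_seq n) y.
Proof.
elim: n => [|n ih]; first by rewrite /residual !big_nil !subr0.
by rewrite !residualS ih ipBl scalerBl !opprD !opprK addrACA.
Qed.

Lemma gs_cases n : gs n = 0 /\ (forall m, residual (gs_seq n) (d m) = 0) \/
  exists m, [/\ residual (gs_seq n) (d m) != 0,
    forall k, (k < m)%N -> residual (gs_seq n) (d k) = 0 &
    gs n = `|residual (gs_seq n) (d m)|^-1 *: residual (gs_seq n) (d m)].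
Proof.
rewrite /gs /next_vector; case: pselect => [ex|nex]; [right|left; split => //].
  case: ex_minnP => m rm mmin; exists m; split => // k km.
  by apply/eqP; apply: contraTT km => rk; rewrite -leqNgt; exact: mmin.
by move=> m; apply/eqP; apply: contrapT => /negP rm; apply: nex; exists m.
Qed.

Definition ortho_upto n := forall i j, (i < n)%N -> (j < n)%N ->
  ip (gs i) (gs j) = (if gs i == 0 then 0 else (i == j)%:R).

Lemma residual_orth n x i : ortho_upto n -> (i < n)%N -> ip (residual (gs_seq n) x) (gs i) = 0.
Proof.
move=> on lin; rewrite gs_seqE ipBl ip_suml (bigD1 (Ordinal lin))//= big1 ?addr0.
  rewrite ipZl on// eqxx; case: eqP => [->|_]; first by rewrite ip0r mul0r subr0.
  by rewrite mulr1 subrr.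
move=> j ji; rewrite ipZl on//; case: ifP => _; rewrite ?mulr0//.
case: eqP => [e|_]; last by rewrite mulr0.
by move: ji; rewrite -val_eqE /= e eqxx.
Qed.

Lemma ortho_all n : ortho_upto n.
Proof.
elim: n => [|n ih]; first by [].
have new i : (i < n)%N -> ip (gs n) (gs i) = 0.
  move=> lin; have [[-> _]|[m [_ _ ->]]] := gs_cases n; first by rewrite ip0l.
  by rewrite ipZl residual_orth ?mulr0.
have unit : ip (gs n) (gs n) = if gs n == 0 then 0 else 1.
  case: eqP => [->|]; first by rewrite ip0l.
  have [[-> _]//|[m [r0 _ ->]] _] := gs_cases n.
  by rewrite ip_norm normrZ normfV normr_id mulVf ?expr1n// normr_eq0.
move=> i j; rewrite !ltnS (leq_eqVlt i) (leq_eqVlt j) => /predU1P[->|lin] /predU1P[->|ljn].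
- by rewrite unit eqxx.
- by rewrite new// gtn_eqF//; case: ifP.
- by rewrite ipC new// ltn_eqF//; case: ifP.
- exact: ih.
Qed.

Lemma gs_ortho i j : ip (gs i) (gs j) = if gs i == 0 then 0 else (i == j)%:R.
Proof. by apply: (@ortho_all (maxn i j).+1); rewrite ltnS ?leq_maxl ?leq_maxr. Qed.

(** The index selected at stage [n] is at least [n] by induction. If it equals [n], the residual of
    [d n] is removed at this stage; if it is larger, or if nothing is selected, that residual was
    already zero. *)
Lemma gs_dense n m : (m < n)%N -> residual (gs_seq n) (d m) = 0.
Proof.
elim: n m => // n ih m.
have keep x : residual (gs_seq n) x = 0 -> residual (gs_seq n.+1) x = 0.
  move=> r0; rewrite residualS r0 sub0r; apply/eqP; rewrite oppr_eq0; apply/eqP.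
  move/eqP: r0; rewrite gs_seqE subr_eq0 => /eqP ->.
  rewrite ip_suml big1 ?scale0r// => i _; rewrite ipZl gs_ortho.
  by case: ifP; rewrite ?mulr0// ltn_eqF// mulr0.
rewrite ltnS (leq_eqVlt m) => /predU1P[->|/ih /keep //].
have [[_ all0]|[k [r0 kmin gsn]]] := gs_cases n; first exact/keep/all0.
have [kn|nk|kn] := ltngtP k n.
- by move: r0; rewrite ih ?eqxx.
- exact/keep/kmin.
move: r0 gsn; rewrite kn => r0 gsn {kmin}.
have orth : ip (d n) (gs n) = `|residual (gs_seq n) (d n)|.
  have e : d n = residual (gs_seq n) (d n) + \sum_(i < n) ip (d n) (gs i) *: gs i.
    by rewrite gs_seqE subrK.
  rewrite {1}e ipDl ip_suml big1 ?addr0.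
    rewrite gsn ipZr ip_norm expr2 mulrA mulVf ?mul1r// normr_eq0//.
  by move=> i _; rewrite ipZl gs_ortho; case: ifP; rewrite ?mulr0// ltn_eqF// mulr0.
by rewrite residualS orth gsn scalerA mulfV ?normr_eq0// scale1r subrr.
Qed.

Lemma residual_le n x : `|residual (gs_seq n) x| <= `|x|.
Proof.
elim: n => [|n ih]; first by rewrite /residual big_nil subr0.
apply: le_trans ih; rewrite residualS.
rewrite -ler_sqr ?nnegrE// -!ip_norm.
have e : ip (residual (gs_seq n) x) (gs n) = ip x (gs n).
  rewrite gs_seqE ipBl ip_suml big1 ?subr0// => i _; rewrite ipZl gs_ortho.
  by case: ifP; rewrite ?mulr0// ltn_eqF// mulr0.
move: (residual (gs_seq n) x) e => r e.
rewrite !(ipBl, ipBr, ipZl, ipZr) (ipC (gs n)) e gs_ortho eqxx.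
case: ifPn => [/eqP ->|_]; first by rewrite ip0r !mul0r !subr0.
by rewrite mulr1 subrr subr0 gerBl -expr2 sqr_ge0.
Qed.

End gram_schmidt.

Lemma exists_orthonormal_basis : separable_space H -> exists h : nat -> H, orthonormal_basis ip h.
Proof.
move=> [S [/countable_injP[f finj] Sdense]].
have /choice[d dP] : forall n, exists x, forall y, S y -> f y = n -> x = y.
  move=> n; have [[y [Sy fy]]|no] := pselect (exists y, S y /\ f y = n).
    exists y => z Sz fz; apply: finj; rewrite ?inE//; by rewrite fy fz.
  by exists 0 => z Sz fz; exfalso; apply: no; exists z.
exists (gs d); split.
- by move=> i j i0 j0; rewrite gs_ortho (negbTE i0).
- move=> i i0; have [[_ all0]|[m [r0 _ e]]] := gs_cases d i; last first.
    move: i0; rewrite e => /eqP; rewrite scaler_eq0 invr_eq0 normr_eq0 orbb.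
    by rewrite (negbTE r0).
  have [[//]|[m [r0 _ _]]] := gs_cases d i.+1.
  by move: r0; rewrite residualS all0 i0 scaler0 subrr eqxx.
- move=> x; apply/cvgrPdist_le => e e0.
  have [y [By Sy]] : ball x e `&` S !=set0.
    apply: Sdense; first by exists x; exact: ballxx.
    exact: ball_open.
  have dy : d (f y) = y by apply: dP.
  exists (f y).+1 => // n /= fyn.
  rewrite -gs_seqE.
  have -> : residual (gs_seq d n) x = residual (gs_seq d n) (x - y).
    by rewrite residualD -[in RHS]dy gs_dense// subr0.
  apply: (le_trans (residual_le _ _ _)); apply: ltW.
  by move: By; rewrite -ball_normE.
Qed.

Section riesz.
Variable h : nat -> H.
Hypothesis hb : orthonormal_basis ip h.

Lemma onb_ip i j : ip (h i) (h j) = if h i == 0 then 0 else (i == j)%:R.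
Proof.
case: hb => h1 _ _; case: eqP => [->|/eqP i0]; first by rewrite ip0l.
have [j0|j0] := eqVneq (h j) 0; last exact: h1.
by rewrite j0 ip0r; case: eqP => // ij; move: i0; rewrite ij j0 eqxx.
Qed.

Lemma onb_partial_sq (c : nat -> R) m n : (forall i, h i = 0 -> c i = 0) -> (m <= n)%N ->
  ip (\sum_(m <= i < n) c i *: h i) (\sum_(m <= i < n) c i *: h i) = \sum_(m <= i < n) c i ^+ 2.
Proof.
move=> c0 _; rewrite ip_suml; apply: eq_big_nat => i mi.
rewrite ipZl ip_sumr (bigD1_seq i) ?iota_uniq ?mem_index_iota//= big1 ?addr0.
  rewrite ipZr onb_ip eqxx; case: eqP => [/c0 ->|_]; first by rewrite !mul0r expr0n.
  by rewrite mulr1 expr2.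
move=> j ji; rewrite ipZr onb_ip; case: ifP => _; rewrite ?mulr0//.
by rewrite eq_sym (negbTE ji) mulr0.
Qed.

(** The representer is the sum of the [L (h i) *: h i]. Its partial sums satisfy
    [|v n|^2 = L (v n) <= M |v n|], so the squared coefficients are summable and the partial sums
    are Cauchy. *)
Lemma riesz (L : H -> R) (M : R) :
  (forall c x y, L (c *: x + y) = c * L x + L y) -> 0 <= M -> (forall x, `|L x| <= M * `|x|) ->
  exists v, forall x, L x = ip v x.
Proof.
move=> Llin M0 Lbd.
have LD x y : L (x + y) = L x + L y by rewrite -[x]scale1r Llin scale1r mul1r.
have L0 : L 0 = 0 by have /eqP := LD 0 0; rewrite addr0 -subr_eq0 opprD addrA subrr sub0r oppr_eq0 => /eqP.
have LZ c x : L (c *: x) = c * L x by rewrite -[c *: x]addr0 Llin L0 addr0.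
have LB x y : L (x - y) = L x - L y by rewrite -scaleN1r LD LZ mulN1r.
have Lsum (c : nat -> R) (n : nat) : L (\sum_(0 <= i < n) c i *: h i) = \sum_(0 <= i < n) c i * L (h i).
  elim: n => [|n ih]; first by rewrite !big_geq.
  by rewrite !big_nat_recr//= LD ih LZ.
pose c i := L (h i).
have c0 i : h i = 0 -> c i = 0 by rewrite /c => ->.
pose v n := \sum_(0 <= i < n) c i *: h i.
have vv n : ip (v n) (v n) = \sum_(0 <= i < n) c i ^+ 2 by exact: onb_partial_sq.
have vM n : `|v n| <= M.
  have := Lbd (v n); rewrite Lsum.
  rewrite (eq_bigr (fun i => c i ^+ 2)); last by move=> i _; rewrite expr2.
  rewrite -vv ip_norm ger0_norm ?sqr_ge0// expr2.
  have := normr_ge0 (v n); rewrite le_eqVlt => /predU1P[<- _//|n0].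
  by rewrite ler_pM2r.
have sq_cvg : cvgn (fun n => \sum_(0 <= i < n) c i ^+ 2).
  apply: nondecreasing_is_cvgn.
    apply/nondecreasing_seqP => n; rewrite big_nat_recr//= lerDl sqr_ge0//.
  exists (M ^+ 2) => _ [n _ <-]; rewrite -vv ip_norm ler_sqr ?nnegrE//.
have /cauchy_cvgP v_cvg : cauchy (v @ \oo).
  apply: cauchy_exP => e e0; have e2 : 0 < e ^+ 2 by rewrite exprn_gt0.
  move/cauchy_cvgP/cauchy_seriesP : sq_cvg => /(_ _ e2)[[A B] /= [[a _ hA] [b _ hB]] hAB].
  pose N := maxn a b; exists (v N); exists N => // n /= Nn.
  rewrite -ball_normE /= -normrN opprB /v (big_cat_nat _ Nn)//= addrAC subrr add0r.
  rewrite -ltr_sqr ?nnegrE// ?(ltW e0)// -ip_norm onb_partial_sq//.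
  have := hAB (N, n); rewrite /= ger0_norm ?sumr_ge0//; last by move=> i _; exact: sqr_ge0.
  apply; split; first by apply: hA; rewrite /= leq_maxl.
  by apply: hB; rewrite /= (leq_trans (leq_maxr a b)).
exists (lim (v @ \oo)) => x.
have c1 : (fun n => ip (v n) x) @ \oo --> ip (lim (v @ \oo)) x by exact: cvg_ip v_cvg.
have hx : (fun n => \sum_(i < n) ip x (h i) *: h i) @ \oo --> x by case: hb.
have c2 : (fun n => ip (v n) x) @ \oo --> L x.
  apply/cvgrPdist_le => e e0.
  have e1 : 0 < e / (M + 1) by rewrite divr_gt0// ltr_wpDl.
  move/cvgrPdist_le : hx => /(_ _ e1); apply: filterS => n hn.
  have -> : ip (v n) x = L (\sum_(i < n) ip x (h i) *: h i).
    rewrite -(big_mkord xpredT (fun i => ip x (h i) *: h i)) (Lsum (fun i => ip x (h i))).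
    by rewrite /v ip_suml; apply: eq_bigr => i _; rewrite ipZl /c mulrC ipC.
  rewrite -LB (le_trans (Lbd _))//.
  apply: (le_trans (ler_wpM2l M0 hn)).
  rewrite mulrA ler_pdivrMr; last by rewrite ltr_wpDl.
  by rewrite mulrC ler_wpM2l ?(ltW e0)// lerDl.
exact: (cvg_unique (@Rhausdorff R) c2 c1).
Qed.

End riesz.
End hilbert.

(** * Covariance of the generated process *)

Section fatou_square.
Context d (T : measurableType d) (R : realType) (P : probability T R).
Local Notation E := (Rintegral P setT).

(** The exceptional null set is cut out by an indicator, so that Fatou applies to an everywhere
    convergent sequence; [V] then differs from the limit only on that set. *)
Lemma fatou_L2 (f : nat -> T -> R) (V : T -> R) (C : R) :
  (forall n, L2 P (f n)) -> (forall n, E (fun w => f n w ^+ 2) <= C) ->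
  measurable_fun setT V ->
  {ae P, forall w, (f ^~ w) @ \oo --> V w} ->
  L2 P V /\ E (fun w => V w ^+ 2) <= C.
Proof.
move=> lf fC mV [N [mN N0 subN]].
have mA : measurable (~` N) by exact: measurableC.
have C0 : 0 <= C by apply: le_trans (fC 0%N); apply: Rintegral_ge0 => w _; exact: sqr_ge0.
pose g n w := f n w * \1_(~` N) w; pose G w := V w * \1_(~` N) w.
have ind2 w : (\1_(~` N) w : R) ^+ 2 = \1_(~` N) w.
  by rewrite indicE; case: (w \in _); rewrite ?expr1n ?expr0n.
have mind : measurable_fun setT (\1_(~` N) : T -> R) by exact: measurable_indic.
have mg n : measurable_fun setT (g n) by apply: measurable_funM => //; case: (lf n).
have mG : measurable_fun setT G by exact: measurable_funM.
have gG w : (g ^~ w) @ \oo --> G w.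
  rewrite /g /G indicE; have [/set_mem wN|wN] := boolP (w \in ~` N).
    rewrite mulr1 (_ : (fun n => _) = f ^~ w); last by apply/funext => n; rewrite mulr1.
    by apply: contrapT => h; apply: wN; apply: subN.
  rewrite mulr0 (_ : (fun n => _) = cst 0); first exact: cvg_cst.
  by apply/funext => n; rewrite mulr0.
have m2 n : measurable_fun setT (fun w => (g n w ^+ 2)%:E).
  by apply/measurable_EFinP; exact: measurable_funX.
have intg n : (\int[P]_w (g n w ^+ 2)%:E <= C%:E)%E.
  apply: (@le_trans _ _ (\int[P]_w (f n w ^+ 2)%:E)%E).
    apply: ge0_le_integral => //.
    - by move=> w _; rewrite lee_fin sqr_ge0.
    - by apply/measurable_EFinP; apply: measurable_funX; case: (lf n).
    - by move=> w _; rewrite lee_fin /g exprMn ind2 ler_piMr ?sqr_ge0// indicE; case: (_ == _).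
  by rewrite -(fineK (integrable_fin_num measurableT (lf n).2)) lee_fin; exact: fC.
have intG : (\int[P]_w (G w ^+ 2)%:E <= C%:E)%E.
  have p2 n w : setT w -> (0 <= (g n w ^+ 2)%:E)%E by rewrite lee_fin sqr_ge0.
  have fat := @fatou _ _ _ P setT measurableT (fun n w => (g n w ^+ 2)%:E) m2 p2.
  apply: (@le_trans _ _ (limn_einf (fun n => \int[P]_w (g n w ^+ 2)%:E)%E)).
    apply: le_trans fat.
    rewrite le_eqVlt; apply/orP; left; apply/eqP; apply: eq_integral => w _.
    have cw : (fun n => (g n w ^+ 2)%:E) @ \oo --> (G w ^+ 2)%:E.
      by apply: cvg_EFin; [exact: nearW|apply: cvgM; exact: gG].
    by rewrite is_cvg_limn_einfE; [apply/esym/cvg_lim|apply: cvgP cw].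
  rewrite limn_einf_lim; apply: lime_le; first exact: is_cvg_einfs.
  apply: nearW => n; apply: le_trans (intg n).
  by rewrite /einfs /sdrop; apply: ereal_inf_lbound; exists n => //=.
have lG : L1 P setT (fun w => G w ^+ 2).
  apply/integrableP; split; first by apply/measurable_EFinP; exact: measurable_funX.
  under eq_integral do rewrite /= ger0_norm ?sqr_ge0//.
  by rewrite (le_lt_trans intG) ?ltry.
have GV : ae_eq P setT (fun w => G w ^+ 2) (fun w => V w ^+ 2).
  exists N; split => // w /= h; apply: contrapT => Nw; apply: h => _.
  by rewrite /G indicE mem_set ?mulr1.
have [lV eV] := Rint_ae_eq measurableT (measurable_funX 2 mV) lG GV.
split; first by split.
by rewrite -eV -lee_fin /Rintegral fineK// (integrable_fin_num measurableT lG).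
Qed.

End fatou_square.

Section gaussian_series.
Context d (Omega : measurableType d) (R : realType) (P : probability Omega R).
Variable omega : nat -> Omega -> R.
Hypothesis iid : iid_standard_normal P omega.
Local Notation E := (Rintegral P setT).

Lemma iid_partial_L2 (a : nat -> R) m n : L2 P (fun w => \sum_(m <= i < n) omega i w * a i).
Proof.
elim: n => [|n ih].
  rewrite (_ : (fun w => _) = fun=> 0); first exact: L2_cst.
  by apply/funext => w; rewrite big_geq.
have [nm|mn] := ltnP n m.
  rewrite (_ : (fun w => _) = fun=> 0); first exact: L2_cst.
  by apply/funext => w; rewrite big_geq.
rewrite (_ : (fun w => _) = fun w => \sum_(m <= i < n) omega i w * a i + a n * omega n w).
  by apply: L2D => //; apply: L2Z; exact: (iid_L2 iid).
by apply/funext => w; rewrite big_nat_recr//= mulrC.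
Qed.

Lemma iid_partial_orth (a : nat -> R) m n k : (n <= k)%N ->
  E (fun w => (\sum_(m <= i < n) omega i w * a i) * omega k w) = 0.
Proof.
move=> nk; elim: n nk => [|n ih] nk.
  transitivity (E (fun=> 0)); first by apply: Rint_ext => w _; rewrite big_geq// mul0r.
  by rewrite Rint_cst.
have [nm|mn] := ltnP n m.
  transitivity (E (fun=> 0)); first by apply: Rint_ext => w _; rewrite big_geq// mul0r.
  by rewrite Rint_cst.
transitivity (E (fun w => (\sum_(m <= i < n) omega i w * a i) * omega k w
   + a n * (omega n w * omega k w))).
  by apply: Rint_ext => w _; rewrite big_nat_recr//=; ring.
have l1 := L2_mul (iid_partial_L2 a m n) (iid_L2 iid k).
have l2 := L2_mul (iid_L2 iid n) (iid_L2 iid k).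
rewrite RintegralD//; last by apply: L1Z.
by rewrite ih ?(ltnW nk)// RintegralZl// (iid_cov iid) ltn_eqF// !mulr0 addr0.
Qed.

Lemma iid_partial_sq (a : nat -> R) m n :
  E (fun w => (\sum_(m <= i < n) omega i w * a i) ^+ 2) =
  normal_m2 R * \sum_(m <= i < n) a i ^+ 2.
Proof.
elim: n => [|n ih].
  rewrite big_geq// mulr0; transitivity (E (fun=> 0)).
    by apply: Rint_ext => w _; rewrite big_geq// expr0n.
  by rewrite Rint_cst.
have [nm|mn] := ltnP n m.
  rewrite big_geq// mulr0; transitivity (E (fun=> 0)).
    by apply: Rint_ext => w _; rewrite big_geq// expr0n.
  by rewrite Rint_cst.
transitivity (E (fun w => ((\sum_(m <= i < n) omega i w * a i) ^+ 2 +
   a n ^+ 2 * omega n w ^+ 2) + 2 * a n * ((\sum_(m <= i < n) omega i w * a i) * omega n w))).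
  by apply: Rint_ext => w _; rewrite big_nat_recr//=; ring.
have l1 := (iid_partial_L2 a m n).2.
have l2 := (iid_L2 iid n).2.
have l3 := L2_mul (iid_partial_L2 a m n) (iid_L2 iid n).
have l4 := L1Z measurableT (a n ^+ 2) l2.
rewrite RintegralD//; [|by apply: L1D|by apply: L1Z].
rewrite RintegralD// !RintegralZl// ih iid_partial_orth// (iid_sq iid) mulr0 addr0.
by rewrite big_nat_recr//= mulrDr [in RHS](mulrC _ (a n ^+ 2)).
Qed.

(** Fatou bounds the second moments of [V] and of the tails [V - S m] from above. The lower bound
    comes from [S^2 <= (1 + r) V^2 + (1 + 1/r) (V - S)^2], letting [m] tend to infinity and then [r]
    to 0. *)
Lemma iid_series_sq (a : nat -> R) (A : R) (V : Omega -> R) :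
  (fun n => \sum_(0 <= i < n) a i ^+ 2) @ \oo --> A ->
  measurable_fun setT V ->
  {ae P, forall w, (fun n => \sum_(0 <= i < n) omega i w * a i) @ \oo --> V w} ->
  L2 P V /\ E (fun w => V w ^+ 2) = normal_m2 R * A.
Proof.
move=> aA mV SV.
pose A_ n := \sum_(0 <= i < n) a i ^+ 2.
pose S n w := \sum_(0 <= i < n) omega i w * a i.
have k0 := normal_m2_gt0 R; set kappa := normal_m2 R in k0 *.
have A_nd : nondecreasing_seq A_.
  by apply/nondecreasing_seqP => n; rewrite /A_ big_nat_recr//= lerDl sqr_ge0.
have A_le n : A_ n <= A.
  rewrite -(cvg_lim (@Rhausdorff R) aA).
  by apply: nondecreasing_cvgn_le => //; exact: cvgP aA.
have A0 : 0 <= A by apply: le_trans (A_le 0%N); rewrite /A_ big_geq.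
have tail m : L2 P (fun w => V w - S m w) /\
    E (fun w => (V w - S m w) ^+ 2) <= kappa * (A - A_ m).
  apply: (@fatou_L2 _ _ _ P (fun n w => \sum_(m <= i < n + m) omega i w * a i)).
  - by move=> n; exact: iid_partial_L2.
  - move=> n; rewrite iid_partial_sq ler_pM2l// lerBrDl /A_ -big_cat_nat ?leq_addl//.
    exact: A_le.
  - by apply: measurable_funB => //; case: (iid_partial_L2 a 0 m).
  - apply: filterS SV => w cw.
    have e : (fun n => \sum_(m <= i < n + m) omega i w * a i) = (fun n => S (n + m)%N w - S m w).
      by apply/funext => n; rewrite /S (big_cat_nat (leq0n m) (leq_addl n m))/= addrAC subrr add0r.
    rewrite e; apply: cvgB; last exact: cvg_cst.
    by rewrite (cvg_shiftn m (fun n => S n w)).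
have [lV0 EV0] := tail 0%N.
have lV : L2 P V.
  move: lV0; rewrite (_ : (fun w => _) = V)//.
  by apply/funext => w; rewrite /S big_geq// subr0.
split => //.
have EVA : E (fun w => V w ^+ 2) <= kappa * A.
  have -> : A = A - A_ 0%N by rewrite /A_ big_geq// subr0.
  apply: le_trans EV0; rewrite le_eqVlt; apply/orP; left; apply/eqP.
  by apply: Rint_ext => w _; rewrite /S big_geq// subr0.
apply/eqP; rewrite eq_le EVA /=.
set v := E (fun w => V w ^+ 2).
have v0 : 0 <= v by apply: Rintegral_ge0 => w _; exact: sqr_ge0.
have young (r : R) : 0 < r -> kappa * A <= (1 + r) * v.
  move=> r0; rewrite -subr_ge0.
  have cr : (fun m => (1 + r) * v + (1 + r^-1) * (kappa * (A - A_ m)) - kappa * A_ m) @ \oo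
      --> (1 + r) * v + (1 + r^-1) * (kappa * (A - A)) - kappa * A.
    apply: cvgB; last by apply: cvgMr; exact: aA.
    apply: cvgD; first exact: cvg_cst.
    by do 2 apply: cvgMr; apply: cvgB => //; exact: cvg_cst.
  move: (cr); rewrite subrr !mulr0 addr0 => {}cr.
  rewrite -(cvg_lim (@Rhausdorff R) cr); apply: limr_ge; first by apply: cvgP cr.
  apply: nearW => m; rewrite subr_ge0 -iid_partial_sq.
  have [[mt lt] et] := tail m.
  have l1 := L1Z measurableT (1 + r) lV.2.
  have l2 := L1Z measurableT (1 + r^-1) lt.
  apply: (@le_trans _ _ (E (fun w => (1 + r) * V w ^+ 2 + (1 + r^-1) * (V w - S m w) ^+ 2))).
    apply: le_Rintegral => //; first exact: (iid_partial_L2 a 0 m).2.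
      exact: L1D.
    move=> w _; rewrite -/(S m w) -subr_ge0.
    rewrite (_ : _ - _ = (r * V w + (V w - S m w)) ^+ 2 / r); last by field; rewrite gt_eqF.
    by rewrite divr_ge0 ?sqr_ge0// ltW.
  rewrite RintegralD// RintegralZl//; last exact: lV.2.
  by rewrite RintegralZl// lerD2l ler_wpM2l// addr_ge0// invr_ge0 ltW.
apply/ler_addgt0Pr => r r0.
have v1 : 0 < v + 1 by rewrite ltr_wpDl.
(* With this parameter the excess [r / (v + 1) * v] is at most [r]; adding 1 avoids division by
   zero. *)
apply: le_trans (young (r / (v + 1)) _) _; first exact: divr_gt0.
rewrite mulrDl mul1r lerD2l mulrAC ler_pdivrMr// ler_wpM2l// ?(ltW r0)// lerDl.
exact: ler01.
Qed.

End gaussian_series.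

(** * Functions measurable for a generated sigma-algebra *)

Section sigma_rv_functions.
Context (R : realType) (Omega : pointedType) (I : Type) (D : set I) (X : I -> Omega -> R).
Implicit Types Z W : Omega -> R.
Local Notation MT := (g_sigma_algebraType (\bigcup_(i in D)
  preimage_set_system setT (X i : Omega -> measurableTypeR R) measurable)).

(** Turns measurability for a sub-sigma-algebra into ordinary measurability on a type carrying that
    sigma-algebra, to which the general closure properties apply. *)
Lemma measurable_wrtE Z : measurable_wrt (sigma_rv D X) Z <->
  measurable_fun [set: MT] (Z : MT -> R).
Proof.
split=> h.
  by move=> _ B mB; rewrite setTI; exact: h.
by move=> B mB; have := h measurableT B mB; rewrite setTI.
Qed.

Lemma wrt_gen i : D i -> measurable_wrt (sigma_rv D X) (X i).
Proof.
move=> Di B mB; apply: sub_gen_smallest; exists i => //; exists B => //.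
by rewrite setTI.
Qed.

Lemma wrt_cst (c : R) : measurable_wrt (sigma_rv D X) (fun=> c).
Proof. by apply/measurable_wrtE; exact: measurable_cst. Qed.

Lemma wrtD Z W : measurable_wrt (sigma_rv D X) Z -> measurable_wrt (sigma_rv D X) W ->
  measurable_wrt (sigma_rv D X) (fun w => Z w + W w).
Proof.
by move=> /measurable_wrtE mZ /measurable_wrtE mW; apply/measurable_wrtE; exact: measurable_funD.
Qed.

Lemma wrtM Z W : measurable_wrt (sigma_rv D X) Z -> measurable_wrt (sigma_rv D X) W ->
  measurable_wrt (sigma_rv D X) (fun w => Z w * W w).
Proof.
by move=> /measurable_wrtE mZ /measurable_wrtE mW; apply/measurable_wrtE; exact: measurable_funM.
Qed.

Lemma wrtZ c Z : measurable_wrt (sigma_rv D X) Z ->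
  measurable_wrt (sigma_rv D X) (fun w => c * Z w).
Proof. exact: wrtM (wrt_cst c). Qed.

Lemma wrt_sum n (Z : 'I_n -> Omega -> R) : (forall i, measurable_wrt (sigma_rv D X) (Z i)) ->
  measurable_wrt (sigma_rv D X) (fun w => \sum_(i < n) Z i w).
Proof.
move=> mZ; apply/measurable_wrtE; apply: measurable_sum => i; apply/measurable_wrtE; exact: mZ.
Qed.

Lemma wrt_cvg (Z_ : nat -> Omega -> R) Z : (forall n, measurable_wrt (sigma_rv D X) (Z_ n)) ->
  (forall w, (Z_ ^~ w) @ \oo --> Z w) -> measurable_wrt (sigma_rv D X) Z.
Proof.
move=> mZ cZ; apply/measurable_wrtE; apply: (measurable_fun_cvg (D := [set: MT]) (h := Z_)) => //.
  by move=> n; apply/measurable_wrtE; exact: mZ.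
Qed.

End sigma_rv_functions.

Section kernel.
Context (R : realType) (T : R) (H : completeNormedModType R) (ip : {dot H for idfun}).
Hypotheses (H_hilbert : hilbert_norm ip) (H_separable : separable_space H).
Variable u : H -> R -> R.
Hypothesis u_op : bounded_operator T u.

(** The uniform bound on the representers follows by testing [u] on [k s] itself:
    [|k s|^2 = u (k s) s <= M |k s|]. *)
Lemma exists_kernel : exists (k : R -> H) (M : R), [/\ 0 <= M,
  forall s x, s \in `[0, T] -> u x s = ip (k s) x &
  forall s, s \in `[0, T] -> `|k s| <= M].
Proof.
have [h hb] := exists_orthonormal_basis H_hilbert H_separable.
case: u_op => _ ulin [M0 uM0]; pose M := Num.max M0 0.
have uM x s : s \in `[0, T] -> `|u x s| <= M * `|x|.
  by move=> sT; apply: le_trans (uM0 x s sT) _; rewrite ler_wpM2r// le_max lexx.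
have M_ge0 : 0 <= M by rewrite le_max lexx orbT.
have [k kP] : {k : R -> H & forall s, s \in `[0, T] -> forall x, u x s = ip (k s) x}.
  apply: (@choice R H (fun s v => s \in `[0, T] -> forall x, u x s = ip v x)) => s.
  have [sT|_] := boolP (s \in `[0, T]); last by exists 0.
  have [v vP] := @riesz _ _ ip H_hilbert h hb (fun x => u x s) M
    (fun c x y => ulin c x y s sT) M_ge0 (fun x => uM x s sT).
  by exists v.
exists k, M; split => // [s x sT|s sT]; first exact: kP.
have := uM (k s) s sT; rewrite kP// H_hilbert ger0_norm ?sqr_ge0// expr2.
have := normr_ge0 (k s); rewrite le_eqVlt => /predU1P[<- _//|n0].
by rewrite ler_pM2r.
Qed.

End kernel.

Section gaussian_centered.
Context d (Omega : measurableType d) (R : realType) (P : probability Omega R) (T : R).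
Variable X : R -> Omega -> R.
Hypotheses (X_gaussian : gaussian_process P T X) (X_centered : centered_process P T X).
Local Notation E := (Rintegral P setT).

Lemma gaussian_point s : s \in `[0, T] -> gaussian_rv P (X s).
Proof.
move=> sT; have := X_gaussian (n := 1%N) (t := fun=> s) (fun=> 1) (fun=> sT).
rewrite (_ : (fun w => _) = X s)//; apply/funext => w.
by rewrite big_ord_recl big_ord0 mul1r addr0.
Qed.

Lemma centered_E s : s \in `[0, T] -> E (X s) = 0.
Proof. by move=> sT; have := X_centered sT; rewrite unlock /Rintegral => ->. Qed.

Lemma point_L2 s : s \in `[0, T] -> L2 P (X s).
Proof. by move=> sT; apply: gaussian_L2; [exact: gaussian_point|exact: centered_E]. Qed.

End gaussian_centered.

Section covariance.
Context (R : realType) (T : R) (H : completeNormedModType R) (ip : {dot H for idfun}).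
Hypotheses (H_hilbert : hilbert_norm ip) (H_separable : separable_space H).
Variable u : H -> R -> R.
Hypothesis u_op : bounded_operator T u.
Context d (Omega : measurableType d) (P : probability Omega R).
Variable X : R -> Omega -> R.
Hypothesis X_generated : generated_by ip T u P X.
Hypotheses (X_gaussian : gaussian_process P T X) (X_centered : centered_process P T X).
Variable k : R -> H.
Hypothesis kP : forall (s : R) x, s \in `[0, T] -> u x s = ip (k s) x.
Local Notation E := (Rintegral P setT).

(** [generated_by] is instantiated at the Gram-Schmidt basis and at [gauss_seq]. The combination of
    values is then a random series with coefficients [ip z (h i)], whose squares sum to [ip z z] by
    Parseval; equality of path laws transfers its second moment to [X]. *)
Let covar_comb (s t c : R) : s \in `[0, T] -> t \in `[0, T] ->
  E (fun w => (X s w + c * X t w) ^+ 2) = normal_m2 R * ip (k s + c *: k t) (k s + c *: k t).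
Proof.
move=> sT tT; have [h hb] := exists_orthonormal_basis H_hilbert H_separable.
have [W [mW cW law]] := X_generated hb (@exists_iid_standard_normal R).
pose z := k s + c *: k t; pose a i := ip z (h i).
pose phi (p : R -> R) := p s + c * p t.
have wphi : measurable_wrt (sigma_rv `[0, T] (fun (s : R) (p : R -> R) => p s)) phi.
  by apply: wrtD; [|apply: wrtZ]; apply: wrt_gen.
have mV : measurable_fun setT (fun w => W s w + c * W t w).
  by apply: measurable_funD; [exact: mW|apply: measurable_funM => //; exact: mW].
have mX r : r \in `[0, T] -> measurable_fun setT (X r).
  by move=> rT; case: (gaussian_point X_gaussian rT).
have mXV : measurable_fun setT (fun w => X s w + c * X t w).
  by apply: measurable_funD; [exact: mX|apply: measurable_funM => //; exact: mX].
have <- := @same_law_Rint _ _ _ _ _ _ _ _ _ _ _ mV mXV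
  (fun B mB => law _ (wphi B mB)) (fun x => x ^+ 2) (measurable_funX 2 (@measurable_id _ _ _)).
apply: (iid_series_sq (@exists_iid_standard_normal R) (a := a) _ mV _).2.
  have hz : (fun n => \sum_(i < n) ip z (h i) *: h i) @ \oo --> z by case: hb.
  have := @cvg_ip _ _ ip H_hilbert _ z z hz; apply: cvg_trans; apply: near_eq_cvg; apply: nearW => n.
  rewrite ip_suml big_mkord; apply: eq_bigr => i _.
  by rewrite ipZl (ipC _ _ z) expr2.
apply: filterS cW => w cw.
(* Only convergence at single times is used of the uniform convergence of the series. *)
have pt r : r \in `[0, T] -> (fun n => \sum_(0 <= i < n) gauss_seq i w * u (h i) r) @ \oo --> W r w.
  move=> rT.
  have : {uniform [set r], (fun (n : nat) (s : R) => \sum_(i < n) gauss_seq i w * u (h i) s) @ \oo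
            --> W ^~ w}.
    by apply: uniform_subset_cvg cw => _ ->.
  rewrite uniform_set1 => h1.
  rewrite (_ : (fun n => _) = fun n => \sum_(i < n) gauss_seq i w * u (h i) r)//.
  by apply/funext => n; rewrite big_mkord.
have -> : (fun n => \sum_(0 <= i < n) gauss_seq i w * a i) =
    (fun n => \sum_(0 <= i < n) gauss_seq i w * u (h i) s +
              c * \sum_(0 <= i < n) gauss_seq i w * u (h i) t).
  apply/funext => n; rewrite mulr_sumr -big_split/=; apply: eq_bigr => i _.
  by rewrite /a /z ipDl ipZl !kP//; ring.
by apply: cvgD; [exact: pt|apply: cvgMr; exact: pt].
Qed.

(** Polarisation of [covar_comb] at [c = 1] and [c = -1]. *)
Lemma process_covariance (s t : R) : s \in `[0, T] -> t \in `[0, T] ->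
  E (fun w => X s w * X t w) = normal_m2 R * ip (k s) (k t).
Proof.
move=> sT tT; have h1 := covar_comb 1 sT tT; have h2 := covar_comb (-1) sT tT.
have lX r : r \in `[0, T] -> L2 P (X r) by exact: point_L2.
have lp : L1 P setT (fun w => (X s w + 1 * X t w) ^+ 2).
  by apply: (L2D (lX _ sT) (L2Z 1 (lX _ tT))).2.
have lm : L1 P setT (fun w => (X s w + -1 * X t w) ^+ 2).
  by apply: (L2D (lX _ sT) (L2Z (-1) (lX _ tT))).2.
transitivity (E (fun w => 4^-1 * ((X s w + 1 * X t w) ^+ 2 - (X s w + -1 * X t w) ^+ 2))).
  by apply: Rint_ext => w _; field.
rewrite RintegralZl//; last exact: L1B.
rewrite RintegralB// h1 h2.
rewrite !(ipDl, ipDr, ipZl, ipZr) (ipC _ (k t) (k s)).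
by field.
Qed.

End covariance.

(** * Gaussian regression *)

Section lin_span_facts.
Context d (Omega : measurableType d) (R : realType) (I : Type) (D : set I).
Variable X : I -> Omega -> R.

Lemma lin_spanZ x U : lin_span D X U -> lin_span D X (fun w => x * U w).
Proof.
elim => [|c i {}U Di _ h].
  by rewrite (_ : (fun w => _) = fun=> 0); [exact: lin_span0|apply/funext => w; rewrite mulr0].
rewrite (_ : (fun w => _) = fun w => x * U w + x * c * X i w); first exact: lin_spanD.
by apply/funext => w; rewrite mulrDr mulrA.
Qed.

Lemma lin_span_sub (D' : set I) U : D `<=` D' -> lin_span D X U -> lin_span D' X U.
Proof.
by move=> DD'; elim => [|c i {}U Di _ h]; [exact: lin_span0|apply: lin_spanD => //; exact: DD'].
Qed.

Lemma lin_span_sum U n (c : 'I_n -> R) (t : 'I_n -> I) : lin_span D X U -> (forall k, D (t k)) ->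
  lin_span D X (fun w => U w + \sum_(k < n) c k * X (t k) w).
Proof.
move=> lU; elim: n c t => [|n ih] c t Dt.
  by rewrite (_ : (fun w => _) = U)//; apply/funext => w; rewrite big_ord0 addr0.
rewrite (_ : (fun w => _) = fun w => (U w + \sum_(k < n) c (widen_ord (leqnSn n) k) *
  X (t (widen_ord (leqnSn n) k)) w) + c ord_max * X (t ord_max) w).
  by apply: lin_spanD => //; exact: ih.
by apply/funext => w; rewrite big_ord_recr/= addrA.
Qed.

End lin_span_facts.

Section square_zero.
Context d (T : measurableType d) (R : realType) (P : probability T R).

Lemma sq_ae0 (U : T -> R) : L2 P U -> Rintegral P setT (fun w => U w ^+ 2) = 0 ->
  ae_eq P setT U (fun=> 0).
Proof.
move=> [mU lU] U0.
have mU2 : measurable_fun setT (fun w => (U w ^+ 2)%:E).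
  by apply/measurable_EFinP; exact: measurable_funX.
have : ae_eq P setT (fun w => (U w ^+ 2)%:E) (cst 0%E).
  apply/(ae_eq_integral_abs P measurableT mU2).
  transitivity (\int[P]_w (U w ^+ 2)%:E)%E.
    by apply: eq_integral => w _; rewrite /= ger0_norm// sqr_ge0.
  by rewrite -(fineK (integrable_fin_num measurableT lU)); congr EFin.
apply: filterS => w h _; have := h I => /= -[] /eqP.
by rewrite sqrf_eq0 => /eqP.
Qed.

End square_zero.

Section gaussian_odd.
Context d (T : measurableType d) (R : realType) (P : probability T R).
Local Notation N01 := (@normal_prob R 0 1).
Local Notation E := (Rintegral P setT).

Lemma gaussian_odd (U : T -> R) (phi : R -> R) : gaussian_rv P U -> E U = 0 ->
  measurable_fun setT phi -> (forall x, phi (- x) = - phi x) ->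
  L1 P setT (fun w => phi (U w)) -> E (fun w => phi (U w)) = 0.
Proof.
move=> gU U0 mphi odd lphi; have [s sP] := gaussian_rvP gU U0.
have lN := (sP _ mphi).1.2 lphi.
rewrite (sP _ mphi).2.
have ms : measurable_fun setT (fun x : R => phi (s * x)).
  by apply: measurableT_comp => //; exact: measurable_funM.
have := normal_sym ms.
rewrite [X in _ = X -> _](_ : _ = - Rintegral N01 setT (fun x => phi (s * x))).
  by move/eqP; rewrite -subr_eq0 opprK -mulr2n mulrn_eq0 => /eqP.
rewrite -mulN1r -RintegralZl//.
by apply: Rint_ext => x _; rewrite mulrN odd mulN1r.
Qed.

End gaussian_odd.

Section trig_linear.
Context d (Omega : measurableType d) (R : realType) (P : probability Omega R).
Variables (T : R) (Z : R -> Omega -> R).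
Hypotheses (T_ge0 : 0 <= T) (Z_gaussian : gaussian_process P T Z) (Z_centered : centered_process P T Z).
Local Notation E := (Rintegral P setT).
Local Notation span := (lin_span `[0, T] Z).

Lemma span_gaussian U : span U -> gaussian_rv P U.
Proof.
move=> sU; suff [n [t [c [tT ->]]]] : exists n (t c : nat -> R), (forall i, t i \in `[0, T]) /\
    U = fun w => \sum_(i < n) c i * Z (t i) w.
  exact: (@Z_gaussian n (fun i => t i) (fun i => c i) (fun i => tT i)).
elim: sU => [|c s {}U sT _ [n [t [b [tT ->]]]]].
  exists 0%N, (fun=> 0), (fun=> 0); split; first by move=> _; rewrite in_itv/= lexx.
  by apply/funext => w; rewrite big_ord0.
exists n.+1, (fun i => if i == n then s else t i), (fun i => if i == n then c else b i); split.
  by move=> i; case: ifP.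
apply/funext => w; rewrite big_ord_recr/= eqxx; congr (_ + _).
by apply: eq_bigr => i _; rewrite ltn_eqF.
Qed.

Lemma span_L2 U : span U -> L2 P U.
Proof.
elim => [|c s {}U sT _ lU]; first exact: L2_cst.
by apply: L2D => //; apply: L2Z; apply: (point_L2 Z_gaussian Z_centered).
Qed.

Lemma span_E U : span U -> E U = 0.
Proof.
elim => [|c s {}U sT sU EU]; first exact: Rint_cst.
have lZ : L1 P setT (Z s) by apply: L2_L1; apply: (point_L2 Z_gaussian Z_centered).
rewrite RintegralD//; [|exact: L2_L1 (span_L2 sU)|exact: L1Z].
by rewrite RintegralZl// EU (centered_E Z_centered sT) mulr0 addr0.
Qed.

(** For a centred Gaussian [U] of variance [v > 0] this is [exp (- v / 2)], by integration by parts;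
    only the bound by 1 is needed. For variance 0 the quotient is 0 by convention. *)
Definition kappa (U : Omega -> R) : R :=
  E (fun w => U w * sin (U w)) / E (fun w => U w ^+ 2).

Lemma abs_sin_le (x : R) : `|sin x| <= `|x|.
Proof. by have := sin_lip 0 x; rewrite sin0 !subr0. Qed.

Lemma kappa_le1 U : span U -> `|kappa U| <= 1.
Proof.
move=> sU; have lU := span_L2 sU; rewrite /kappa.
have q0 : 0 <= E (fun w => U w ^+ 2) by apply: Rintegral_ge0 => w _; exact: sqr_ge0.
rewrite normrM normfV (ger0_norm q0).
have [->|qn0] := eqVneq (E (fun w => U w ^+ 2)) 0; first by rewrite invr0 mulr0.
rewrite ler_pdivrMr ?lt_def ?qn0// mul1r; apply: le_norm_E; last 1 first.
- by move=> w; rewrite normrM -[leRHS](ger0_norm (sqr_ge0 _)) normrX expr2 ler_wpM2l// abs_sin_le.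
- by apply: measurable_funM; [|apply: (measurableT_comp (@measurable_sinT R))]; case: lU.
- exact: lU.2.
Qed.

(* Satisfied by every [V] jointly Gaussian with the process, and, unlike joint
   Gaussianity, visibly linear in [V] and preserved by integration against a
   condition. *)
Definition trig_linear V := L2 P V /\ forall U, span U ->
  E (fun w => V w * cos (U w)) = 0 /\
  E (fun w => V w * sin (U w)) = kappa U * E (fun w => V w * U w).

Lemma trig_linear0 : trig_linear (fun=> 0).
Proof.
split; first exact: L2_cst.
have z (F : Omega -> R) : E (fun w => 0 * F w) = 0.
  by rewrite -[RHS](Rint_cst P); apply: Rint_ext => w _; rewrite mul0r.
by move=> U _; rewrite !z mulr0.
Qed.

Lemma trig_linearD V W c : trig_linear V -> trig_linear W ->
  trig_linear (fun w => V w + c * W w).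
Proof.
move=> [lV hV] [lW hW]; split; first by apply: L2D => //; exact: L2Z.
move=> U sU; have [V1 V2] := hV U sU; have [W1 W2] := hW U sU.
have lU := span_L2 sU.
have mU : measurable_fun setT U by case: lU.
have aux (F : Omega -> R) : L1 P setT (fun w => V w * F w) -> L1 P setT (fun w => W w * F w) ->
    E (fun w => (V w + c * W w) * F w) = E (fun w => V w * F w) + c * E (fun w => W w * F w).
  move=> l1 l2; rewrite -RintegralZl// -RintegralD//; last exact: L1Z.
  by apply: Rint_ext => w _; ring.
have l1 := L2_L1 lV; have l2 := L2_L1 lW.
rewrite !aux; try (exact: L1_mul_cos); try (exact: L1_mul_sin); try exact: L2_mul.
by rewrite V1 V2 W1 W2 mulr0 addr0; split => //; ring.
Qed.

Lemma trig_linear_sum n (c : 'I_n -> R) (V : 'I_n -> Omega -> R) :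
  (forall i, trig_linear (V i)) -> trig_linear (fun w => \sum_(i < n) c i * V i w).
Proof.
move=> hV; elim: n c V hV => [|n ih] c V hV.
  by rewrite (_ : (fun w => _) = fun=> 0); [exact: trig_linear0|apply/funext => w; rewrite big_ord0].
rewrite (_ : (fun w => _) = fun w => \sum_(i < n) c (widen_ord (leqnSn n) i) *
  V (widen_ord (leqnSn n) i) w + c ord_max * V ord_max w).
  by apply: trig_linearD => //; apply: ih.
by apply/funext => w; rewrite big_ord_recr.
Qed.

(** After subtraction of its regression [b * U], the variable [Z s] is uncorrelated with [U], so
    [gaussian_trig_orth] applies and leaves the terms [E (U cos U) = 0] by oddness and
    [b * E (U sin U)], which is the right side. If [U] has variance 0, it vanishes almost
    everywhere. *)
Lemma trig_linear_point s : s \in `[0, T] -> trig_linear (Z s).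
Proof.
move=> sT; have lZ := point_L2 Z_gaussian Z_centered sT; split => // U sU.
have lU := span_L2 sU; have mU : measurable_fun setT U by case: lU.
have lZU := L2_mul lZ lU; have l1 := L2_L1 lZ; have l2 := L2_L1 lU.
pose q := E (fun w => U w ^+ 2); pose b := E (fun w => Z s w * U w) / q.
have gV x y : gaussian_rv P (fun w => x * U w + y * (Z s w - b * U w)).
  apply: span_gaussian; rewrite (_ : (fun w => _) = fun w => (x - y * b) * U w + y * Z s w).
    by apply: lin_spanD => //; exact: lin_spanZ.
  by apply/funext => w; ring.
have EU := span_E sU.
have EV : E (fun w => Z s w - b * U w) = 0.
  by rewrite RintegralB//; [rewrite RintegralZl// EU (centered_E Z_centered sT) mulr0 subr0|exact: L1Z].
have EVU : q != 0 -> E (fun w => (Z s w - b * U w) * U w) = 0.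
  move=> q0; transitivity (E (fun w => Z s w * U w - b * U w ^+ 2)).
    by apply: Rint_ext => w _; ring.
  rewrite RintegralB//; last by apply: L1Z => //; exact: lU.2.
  by rewrite RintegralZl//; [rewrite -/q /b divfK// subrr|exact: lU.2].
have [q0|q0] := eqVneq q 0.
  have U0 : ae_eq P setT U (fun=> 0).
    exact: sq_ae0.
  have zero (F G : Omega -> R) : measurable_fun setT F -> measurable_fun setT (fun w => F w * G (w)) ->
      (forall w, U w = 0 -> G w = 0) -> E (fun w => F w * G w) = 0.
    move=> mF mFG UG; rewrite -[RHS](Rint_cst P).
    apply/esym; apply: (Rint_ae_eq measurableT mFG _ _).2; first exact: L2_L1 (L2_cst P 0).
    by apply: filterS U0 => w h /h /UG ->; rewrite mulr0.
  have ms := L1_meas (L1_mul_sin l1 mU).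
  have mZU := L1_meas lZU.
  split; last first.
    rewrite (zero _ _ _ ms) ?(zero _ _ _ mZU) ?mulr0//; try by case: lZ.
    by move=> w ->; rewrite sin0.
  transitivity (E (fun w => Z s w + Z s w * (cos (U w) - 1))).
    by apply: Rint_ext => w _; ring.
  have l3 : L1 P setT (fun w => Z s w * (cos (U w) - 1)).
    apply: (@L1_ext _ _ _ P setT measurableT (fun w => Z s w * cos (U w) - Z s w)).
      by move=> w _; ring.
    by apply: L1B => //; exact: L1_mul_cos.
  rewrite RintegralD// (centered_E Z_centered sT) add0r.
  apply: zero; [by case: lZ|exact: (L1_meas l3)|].
  by move=> w ->; rewrite cos0 subrr.
have [c1 c2] := gaussian_trig_orth gV EU EV (EVU q0).
have Ucos : E (fun w => U w * cos (U w)) = 0.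
  apply: (@gaussian_odd _ _ _ P U (fun x => x * cos x)) => //.
  - exact: span_gaussian.
  - by apply: measurable_funM => //; exact: (@measurable_cosT R).
  - by move=> x; rewrite cosN mulNr.
  - exact: L1_mul_cos.
have aux (F : Omega -> R) : L1 P setT (fun w => Z s w * F w) -> L1 P setT (fun w => U w * F w) ->
    E (fun w => (Z s w - b * U w) * F w) = E (fun w => Z s w * F w) - b * E (fun w => U w * F w).
  move=> h1 h2; rewrite -RintegralZl// -RintegralB//; last exact: L1Z.
  by apply: Rint_ext => w _; ring.
move: c1 c2; rewrite !aux; try (exact: L1_mul_cos); try (exact: L1_mul_sin).
rewrite Ucos mulr0 subr0 => c1 /eqP; rewrite subr_eq0 => /eqP c2; split => //.
by rewrite c2 /b /kappa -/q; field.
Qed.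

Lemma trig_linear_orth (D : set R) V : D `<=` `[0, T] -> trig_linear V ->
  (forall r, D r -> E (fun w => V w * Z r w) = 0) ->
  forall F, sigma_rv D Z F -> E (fun w => V w * \1_F w) = 0.
Proof.
move=> DT [lV hV] VD.
have mZ r : D r -> measurable_fun setT (Z r).
  by move=> /DT rT; case: (point_L2 Z_gaussian Z_centered rT).
apply: trig_orth_sigma => //; first exact: L2_L1.
move=> U sU; have sU' : span U by exact: lin_span_sub sU.
have [h1 h2] := hV U sU'; split => //; rewrite h2.
suff -> : E (fun w => V w * U w) = 0 by rewrite mulr0.
elim: sU {sU' h1 h2} => [|c r {}U Dr sU ih].
  by rewrite -[RHS](Rint_cst P); apply: Rint_ext => w _; rewrite mulr0.
have lU : L2 P U by apply: span_L2; exact: lin_span_sub sU.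
have lZ : L2 P (Z r) by apply: (point_L2 Z_gaussian Z_centered); exact: DT.
transitivity (E (fun w => V w * U w + c * (V w * Z r w))).
  by apply: Rint_ext => w _; ring.
rewrite RintegralD//; [|exact: L2_mul|by apply: L1Z => //; exact: L2_mul].
by rewrite RintegralZl//; [rewrite ih VD// mulr0 addr0|exact: L2_mul].
Qed.

End trig_linear.

Section condition_integral.
Context d (Omega : measurableType d) (R : realType) (P : probability Omega R).
Variables (T : R) (Z : R -> Omega -> R) (C : R).
Hypotheses (Z_continuous : continuous_process T Z).
Hypotheses (Z_gaussian : gaussian_process P T Z) (Z_centered : centered_process P T Z).
Hypothesis Z_bound : forall s : R, s \in `[0, T] -> Rintegral P setT (fun w => Z s w ^+ 2) <= C.
Local Notation E := (Rintegral P setT).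

Lemma wrt_measurable I (D : set I) (X : I -> Omega -> R) (V : Omega -> R) :
  (forall i, D i -> measurable_fun setT (X i)) -> measurable_wrt (sigma_rv D X) V ->
  measurable_fun setT V.
Proof. by move=> mX mV _ B mB; rewrite setTI; exact: (sigma_rv_measurable mX (mV B mB)). Qed.

Variables (s : R) (s0T : 0 <= s <= T).

Let s_ge0 : 0 <= s. Proof. by case/andP: s0T. Qed.

Let sub_itv (x : R) : x \in `[0, s] -> x \in `[0, T].
Proof.
by case/andP: s0T => _ sT; rewrite !in_itv/= => /andP[-> xs]; rewrite (le_trans xs).
Qed.

Lemma path_within w : {within `[0, s], continuous (Z ^~ w)}.
Proof.
apply: (continuous_subspaceW (B := `[0, T]%classic)); last by case: Z_continuous.
by move=> x; exact: sub_itv.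
Qed.

Lemma cint_path_wrt a : measurable_wrt (natural_filtration Z s) (fun w => cint a `[0, s] (Z ^~ w)).
Proof.
apply: (wrt_cvg (Z_ := fun n w => \sum_(k < n.+2) cweight a s n k * Z (grid s n k) w)).
  by move=> n; apply: wrt_sum => k; apply: wrtZ; apply: wrt_gen; exact: grid_itv.
by move=> w; apply: cvg_cint => //; exact: path_within.
Qed.

Lemma cint_path_measurable a : measurable_fun setT (fun w => cint a `[0, s] (Z ^~ w)).
Proof.
apply: wrt_measurable (cint_path_wrt a) => r rs.
by case: Z_continuous => mZ _; apply: mZ; exact: sub_itv.
Qed.

(** For each Jordan part the weights are nonnegative and their sums converge, being the step sums of
    the constant 1; convergent sequences are bounded. *)
Lemma cweight_bounded a : exists2 M, 0 <= M & forall n, \sum_(k < n.+2) `|cweight a s n k| <= M.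
Proof.
have one : {within `[0, s], continuous (fun=> 1 : R)} by move=> x; exact: cvg_cst.
have bd (mu : {finite_measure set (measurableTypeR R) -> \bar R}) :
    exists2 M, 0 <= M & forall n, \sum_(k < n.+2) fine (mu (cell s n k)) <= M.
  have /cvg_seq_bounded/pinfty_ex_gt0[M M0 hM] := cvgP _ (cvg_Rint_step (mu := mu) s_ge0 one).
  exists M; first exact: ltW.
  move=> n; have := hM n I; apply: le_trans.
  rewrite (eq_bigr (fun k : 'I_n.+2 => fine (mu (cell s n k)) * 1)) => [|k _]; last by rewrite mulr1.
  exact: ler_norm.
have [M1 M10 h1] := bd (cpos a); have [M2 M20 h2] := bd (cneg a).
exists (M1 + M2); first exact: addr_ge0.
move=> n; apply: le_trans (lerD (h1 n) (h2 n)); rewrite -big_split/=; apply: ler_sum => k _.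
by rewrite (le_trans (ler_normB _ _))// !ger0_norm ?fine_ge0.
Qed.

(** Fatou along the step sums. Their second moments are at most [M ^+ 2 * C], by expanding the
    square and using [|x y| <= (x^2 + y^2) / 2] with the variance bound at each grid time. *)
Lemma cint_path_L2 a : L2 P (fun w => cint a `[0, s] (Z ^~ w)).
Proof.
have [M M0 hM] := cweight_bounded a.
pose f n w := \sum_(k < n.+2) cweight a s n k * Z (grid s n k) w.
have lZ r : r \in `[0, T] -> L2 P (Z r) by exact: (point_L2 Z_gaussian Z_centered).
have gT n (k : 'I_n.+2) : grid s n k \in `[0, T] by apply: sub_itv; exact: grid_itv.
have C0 : 0 <= C.
  apply: le_trans (Z_bound (s := 0) _); first by apply: Rintegral_ge0 => w _; exact: sqr_ge0.
  by apply: sub_itv; rewrite in_itv/= lexx.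
apply: (fatou_L2 (f := f) (C := M ^+ 2 * C) _ _ (cint_path_measurable a) _).1.
- by move=> n; apply: L2_sum => k; apply: L2Z; apply: lZ; exact: gT.
- move=> n; pose c k := `|cweight a s n k|.
  have c0 k : 0 <= c k by exact: normr_ge0.
  have lq (k l : 'I_n.+2) : L1 P setT (fun w => Z (grid s n k) w ^+ 2 + Z (grid s n l) w ^+ 2).
    by apply: L1D => //; [exact: (lZ _ (gT n k)).2|exact: (lZ _ (gT n l)).2].
  apply: (@le_trans _ _ (E (fun w => \sum_(k < n.+2) \sum_(l < n.+2) c k * c l / 2 *
      (Z (grid s n k) w ^+ 2 + Z (grid s n l) w ^+ 2)))).
    apply: le_Rintegral => //.
    + by apply: (@L2_sum _ _ _ P n.+2 _ _).2 => k; apply: L2Z; apply: lZ; exact: gT.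
    + by apply: L1_sum => // k; apply: L1_sum => // l; apply: L1Z.
    + move=> w _; rewrite /f expr2 mulr_suml; apply: ler_sum => k _.
      rewrite mulr_sumr; apply: ler_sum => l _.
      rewrite (le_trans (ler_norm _))// !normrM mulrACA -/(c k) -/(c l) -[leRHS]mulrA ler_wpM2l ?mulr_ge0//.
      have := sqr_ge0 (`|Z (grid s n k) w| - `|Z (grid s n l) w|).
      rewrite sqrrB !real_normK ?num_real//; lra.
  rewrite Rint_sum//; last by move=> k; apply: L1_sum => // l; apply: L1Z.
  apply: (@le_trans _ _ (\sum_(k < n.+2) \sum_(l < n.+2) c k * c l * C)).
    apply: ler_sum => k _; rewrite Rint_sum//; last by move=> l; apply: L1Z.
    apply: ler_sum => l _; rewrite RintegralZl// -[leLHS]mulrA ler_wpM2l ?mulr_ge0//.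
    rewrite RintegralD//; [|exact: (lZ _ (gT n k)).2|exact: (lZ _ (gT n l)).2].
    have := Z_bound (gT n k); have := Z_bound (gT n l); lra.
  rewrite (eq_bigr (fun k : 'I_n.+2 => c k * (\sum_(l < n.+2) c l) * C)); last first.
    by move=> k _; rewrite mulr_sumr mulr_suml.
  rewrite -!mulr_suml expr2 ler_wpM2r//.
  by apply: ler_pM; rewrite ?sumr_ge0//; exact: hM.
- apply: nearW => w.
  by apply: cvg_cint => //; exact: path_within.
Qed.

Lemma cint_path_fubini a psi : L2 P psi ->
  E (fun w => cint a `[0, s] (Z ^~ w) * psi w) = cint a `[0, s] (fun x => E (fun w => Z x w * psi w)).
Proof.
move=> lpsi; have mpsi : measurable_fun setT psi by case: lpsi.
have mZ x : x \in `[0, s] -> measurable_fun setT (Z x).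
  by move=> xs; case: Z_continuous => mZ _; apply: mZ; exact: sub_itv.
have lZ x : x \in `[0, s] -> L2 P (Z x) by move=> xs; apply: (point_L2 Z_gaussian Z_centered); exact: sub_itv.
have lX x : x \in `[0, s] -> L1 P setT (fun w => Z x w * psi w).
  by move=> xs; apply: L2_mul => //; exact: lZ.
have bX x : x \in `[0, s] -> E (fun w => `|Z x w * psi w|) <= C + E (fun w => psi w ^+ 2).
  move=> xs; have lZx := lZ x xs; apply: le_trans (lerD (Z_bound (sub_itv xs)) (lexx _)).
  rewrite -RintegralD//; [|exact: lZx.2|exact: lpsi.2].
  apply: le_Rintegral => //.
  - by apply: (L1_ext measurableT (f := fun w => `|(Z x w * psi w)|)) => //; apply: integrable_norm; exact: lX.
  - by apply: L1D => //; [exact: lZx.2|exact: lpsi.2].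
  - move=> w _; rewrite normrM.
    have := sqr_ge0 (`|Z x w| - `|psi w|); have := sqr_ge0 (Z x w); have := sqr_ge0 (psi w).
    rewrite sqrrB !real_normK ?num_real//; lra.
have fub (mu : {finite_measure set (measurableTypeR R) -> \bar R}) :=
  Rint_fubini s_ge0 mZ path_within mu mpsi lX bX.
have [lp ep] := fub (cpos a); have [ln en] := fub (cneg a).
rewrite cintE -ep -en -RintegralB//.
by apply: Rint_ext => w _; rewrite cintE mulrBl.
Qed.

Lemma trig_linear_cint a : trig_linear P T Z (fun w => cint a `[0, s] (Z ^~ w)).
Proof.
have T0 : 0 <= T by case/andP: s0T; exact: le_trans.
split; first exact: cint_path_L2.
move=> U sU.
have lU : L2 P U by apply: (span_L2 Z_gaussian Z_centered sU).
have mU : measurable_fun setT U by case: lU.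
have bd (F : Omega -> R) : measurable_fun setT F -> (forall w, `|F w| <= 1) -> L2 P F.
  move=> mF F1; split => //; apply: (@L1_bounded _ _ _ _ _ 1); first exact: measurable_funX.
  by move=> w; rewrite normrX exprn_ile1.
have lc : L2 P (fun w => cos (U w)).
  by apply: bd; [exact: (measurableT_comp (@measurable_cosT R))|move=> w; exact: cos_max].
have ls : L2 P (fun w => sin (U w)).
  by apply: bd; [exact: (measurableT_comp (@measurable_sinT R))|move=> w; exact: sin_max].
have pt (x : R) : x \in `[0, s] -> _ :=
  fun xs => (trig_linear_point T0 Z_gaussian Z_centered (sub_itv xs)).2 U sU.
have zero (F : Omega -> R) : E (fun w => F w * 0) = 0.
  by rewrite -[RHS](Rint_cst P); apply: Rint_ext => w _; rewrite mulr0.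
have lk : L2 P (fun w => kappa P U * U w) by exact: L2Z.
have pullk V : L2 P V -> E (fun w => V w * (kappa P U * U w)) = kappa P U * E (fun w => V w * U w).
  move=> lV; rewrite -RintegralZl//; last exact: L2_mul.
  by apply: Rint_ext => w _; ring.
split.
  (* The value 0 is written with the test variable 0, so that Fubini turns both sides into integrals
     over time that are compared pointwise. *)
  transitivity (E (fun w => cint a `[0, s] (Z ^~ w) * 0)); last exact: zero.
  rewrite !cint_path_fubini//; last exact: (L2_cst P 0).
  by apply: cint_ext => x xs; rewrite (pt x xs).1 zero.
rewrite -pullk; last exact: cint_path_L2.
rewrite !cint_path_fubini//; apply: cint_ext => x xs.
rewrite (pt x xs).2 pullk//; apply: (point_L2 Z_gaussian Z_centered); exact: sub_itv.
Qed.

End condition_integral.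

(** * The conditioned process *)

Section dirac_condition.
Variable R : realType.

(** Evaluations as conditions: [conditioned_process] speaks of conditions only, and these recover
    the values of the processes. *)
Definition dirac_charge (t : R) : condition R :=
  charge_of_finite_measure (@dirac _ (measurableTypeR R) t R).

(** Whatever Hahn decomposition was chosen, the negative part is minus the restriction of a
    nonnegative charge, and it is nonnegative itself. *)
Lemma dirac_neg0 t (A : set (measurableTypeR R)) : measurable A -> cneg (dirac_charge t) A = 0%E.
Proof.
move=> mA; rewrite /cneg; case: (cid _) => -[P N] /= h.
have [_ [mN negN] _ _] := h.
apply/eqP; rewrite eq_le measure_ge0 andbT.
rewrite jordan_negE cjordan_negE.
rewrite /crestr0 mem_set// /crestr leeNl oppe0.
exact: (measure_ge0 (@dirac _ (measurableTypeR R) t R)).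
Qed.

Lemma dirac_pos t (A : set (measurableTypeR R)) : measurable A ->
  cpos (dirac_charge t) A = @dirac _ (measurableTypeR R) t R A.
Proof.
move=> mA; have := jordan_decomp (projT2 (cid (hahn_exists (dirac_charge t)))) mA.
rewrite /cadd /= => e; apply/esym; rewrite e cscaleN1.
transitivity (cpos (dirac_charge t) A - cneg (dirac_charge t) A)%E; first by [].
by rewrite dirac_neg0// sube0.
Qed.

Lemma capp_dirac (T t : R) phi : t \in `[0, T] -> {within `[0, T], continuous phi} ->
  capp T (dirac_charge t) phi = phi t.
Proof.
move=> tT cphi; have mphi := within_continuous_measurable cphi.
have mphiE : measurable_fun (`[0, T]%classic : set (measurableTypeR R)) (EFin \o phi).
  exact/measurable_EFinP.
rewrite /capp cintE /Rintegral.
rewrite (@eq_measure_integral _ (measurableTypeR R) R _ (@dirac _ (measurableTypeR R) t R)); last first.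
  by move=> A mA _; exact: dirac_pos.
rewrite (@eq_measure_integral _ (measurableTypeR R) R _ mzero (cneg (dirac_charge t))); last first.
  by move=> A mA _; exact: dirac_neg0.
have e1 := @integral_dirac _ (measurableTypeR R) t R _ (measurable_itv0 T) _ mphiE.
have e2 := @integral_measure_zero _ (measurableTypeR R) R `[0, T]%classic (EFin \o phi).
transitivity (fine (phi t)%:E - fine (0 : \bar R)); last by rewrite subr0.
congr (fine _ - fine _); last exact: e2.
apply: (etrans e1).
by rewrite diracE mem_set// mul1e.
Qed.

End dirac_condition.

Section projection.
Variables (R : realType) (H : completeNormedModType R) (ip : {dot H for idfun}).
Hypothesis ip_norm : hilbert_norm ip.

Lemma exists_projection (al : nat -> H) n x : exists c : nat -> R, forall j, (j < n)%N ->
  ip (x - \sum_(i < n) c i *: al i) (al j) = 0.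
Proof.
elim: n x => [|n ih] x; first by exists (fun=> 0).
have [c hc] := ih x; have [b hb] := ih (al n).
pose be := al n - \sum_(i < n) b i *: al i.
have be_span v : (forall j, (j < n)%N -> ip v (al j) = 0) -> ip v be = ip v (al n).
  move=> hv; rewrite ipBr ip_sumr big1 ?subr0// => i _.
  by rewrite ipZr hv// mulr0.
pose ga := ip (x - \sum_(i < n) c i *: al i) be / ip be be.
exists (fun i => if i == n then ga else c i - ga * b i).
have -> : \sum_(i < n.+1) (if i == n :> nat then ga else c i - ga * b i) *: al i =
    \sum_(i < n) c i *: al i + ga *: be.
  rewrite big_ord_recr/= eqxx /be scalerBr scaler_sumr addrCA addrC; congr (_ + _).
  rewrite -sumrB; apply: eq_bigr => i _.
  by rewrite ltn_eqF// scalerBl scalerA.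
set r := x - _ in ga *.
have rj j : (j < n)%N -> ip r (al j) = 0 by exact: hc.
have bej j : (j < n)%N -> ip be (al j) = 0 by exact: hb.
move=> j; rewrite opprD addrA ipBl ipZl -/r ltnS leq_eqVlt => /predU1P[->|jn].
  rewrite -(be_span r rj) -(be_span be bej) /ga.
  have [/(ip_eq0 ip_norm) ->|b0] := eqVneq (ip be be) 0; first by rewrite !ip0r mulr0 subr0.
  by rewrite divfK// subrr.
by rewrite rj// bej// mulr0 subr0.
Qed.

(** The difference of [x] and its projection [s] on the span is annihilated by all [al i], hence
    orthogonal to [x] by hypothesis; it is also orthogonal to [s], and so to itself. *)
Lemma mem_span_orth N (al : 'I_N -> H) x :
  (forall y, (forall i, ip (al i) y = 0) -> ip x y = 0) ->
  exists c : 'I_N -> R, x = \sum_(i < N) c i *: al i.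
Proof.
move=> hx; pose be (i : nat) := oapp al 0 (insub i).
have beE (i : 'I_N) : be i = al i by rewrite /be valK.
have [c hc] := exists_projection be N x; exists (fun i => c i).
set s := \sum_(i < N) _.
have sE : \sum_(i < N) c i *: be i = s by apply: eq_bigr => i _; rewrite beE.
rewrite sE in hc.
have orth i : ip (al i) (x - s) = 0 by rewrite (ipC ip) -beE hc.
have : ip (x - s) (x - s) = 0.
  rewrite {1}ipBl hx// ip_suml big1 ?subr0// => i _.
  by rewrite ipZl orth mulr0.
by move/(ip_eq0 ip_norm)/eqP; rewrite subr_eq0 => /eqP.
Qed.

End projection.

Section representer.
Context (R : realType) (T : R) (H : completeNormedModType R) (ip : {dot H for idfun}).
Hypotheses (T_ge0 : 0 <= T) (H_hilbert : hilbert_norm ip) (H_separable : separable_space H).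
Variable u : H -> R -> R.
Hypothesis u_op : bounded_operator T u.

(** Continuity for the supremum norm, inherited in the limit by the step sums, whose absolute
    weights have bounded sums. *)
Lemma cint_bounded a : exists2 B : R, 0 <= B & forall (phi : R -> R) (M : R),
  {within `[0, T], continuous phi} ->
  (forall x : R, x \in `[0, T] -> `|phi x| <= M) -> `|cint a `[0, T] phi| <= B * M.
Proof.
have TT : 0 <= T <= T by rewrite T_ge0 lexx.
have [B B0 hB] := cweight_bounded TT a.
exists B => // phi M cphi hM.
have M0 : 0 <= M.
  by apply: le_trans (hM 0 _); [exact: normr_ge0|rewrite in_itv/= lexx].
have cv : (fun n => `|\sum_(k < n.+2) cweight a T n k * phi (grid T n k)|) @ \oo -->
    `|cint a `[0, T] phi| by apply: cvg_norm; exact: cvg_cint.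
rewrite -(cvg_lim (@Rhausdorff R) cv); apply: limr_le; first by apply: cvgP cv.
apply: nearW => n; apply: (le_trans (ler_norm_sum _ _ _)).
apply: (@le_trans _ _ (\sum_(k < n.+2) `|cweight a T n k| * M)).
  by apply: ler_sum => k _; rewrite normrM ler_wpM2l// hM// grid_itv.
by rewrite -mulr_suml ler_wpM2r.
Qed.

Lemma exists_representer a : exists v, forall x, capp T a (u x) = ip v x.
Proof.
have [h hb] := exists_orthonormal_basis H_hilbert H_separable.
case: u_op => ucont ulin [M0 uM0]; pose M := Num.max M0 0.
have uM x s : s \in `[0, T] -> `|u x s| <= M * `|x|.
  by move=> sT; apply: le_trans (uM0 x s sT) _; rewrite ler_wpM2r// le_max lexx.
have M_ge0 : 0 <= M by rewrite le_max lexx orbT.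
have [B B0 hB] := cint_bounded a.
apply: (@riesz _ _ ip H_hilbert h hb (fun x => capp T a (u x)) (B * M)).
- move=> c x y; rewrite /capp.
  have mT := measurable_itv0 T.
  have l1 := cL1_continuous a T_ge0 (ucont x).
  have l2 := cL1_continuous a T_ge0 (ucont y).
  rewrite -cintZ// -cintD//; last exact: cL1Z.
  by apply: cint_ext => s sT; exact: ulin.
- exact: mulr_ge0.
- by move=> x; rewrite -mulrA; apply: hB => // s sT; exact: uM.
Qed.

End representer.

Section condexp_facts.
Context d (Omega : measurableType d) (R : realType) (P : probability Omega R).
Local Notation E := (Rintegral P setT).
Context (I : Type) (D : set I) (X : I -> Omega -> R).
Hypothesis mX : forall i, D i -> measurable_fun setT (X i).
Implicit Types (V Z W : Omega -> R) (F : set Omega).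

Lemma integral_indicE V F : (\int[P]_(w in F) (V w)%:E = \int[P]_w (V w * \1_F w)%:E)%E.
Proof.
rewrite integral_mkcond; apply: eq_integral => w _.
by rewrite patchE indicE; case: ifP; rewrite ?mulr1 ?mulr0.
Qed.

Lemma condexp_orth V Z F : is_condexp P (sigma_rv D X) V Z -> sigma_rv D X F ->
  E (fun w => (V w - Z w) * \1_F w) = 0.
Proof.
move=> [lV lZ _ h] GF; have mF := sigma_rv_measurable mX GF.
transitivity (E (fun w => V w * \1_F w - Z w * \1_F w)).
  by apply: Rint_ext => w _; rewrite mulrBl.
rewrite RintegralB//; try exact: L1_indic_mul.
by rewrite /Rintegral -!integral_indicE h// subrr.
Qed.

Lemma orth_condexp V Z : L1 P setT V -> L1 P setT Z -> measurable_wrt (sigma_rv D X) Z ->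
  (forall F, sigma_rv D X F -> E (fun w => (V w - Z w) * \1_F w) = 0) ->
  is_condexp P (sigma_rv D X) V Z.
Proof.
move=> lV lZ mZ h; split => // F GF; have mF := sigma_rv_measurable mX GF.
have lVF := L1_indic_mul lV mF; have lZF := L1_indic_mul lZ mF.
rewrite (integral_indicE V F) (integral_indicE Z F).
rewrite -(fineK (integrable_fin_num measurableT lVF)) -(fineK (integrable_fin_num measurableT lZF)).
congr EFin; apply/eqP; rewrite eq_sym -subr_eq0; apply/eqP.
rewrite -[LHS]/(E (fun w => V w * \1_F w) - E (fun w => Z w * \1_F w)) -RintegralB//.
by rewrite -[RHS](h _ GF); apply: Rint_ext => w _; rewrite mulrBl.
Qed.

(** The events where [V] is nonnegative and where it is negative belong to the sigma-algebra; the
    difference of the two integrals is [E |V|]. *)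
Lemma wrt_orth0 V : L1 P setT V -> measurable_wrt (sigma_rv D X) V ->
  (forall F, sigma_rv D X F -> E (fun w => V w * \1_F w) = 0) -> ae_eq P setT V (fun=> 0).
Proof.
move=> lV mV h; have mV' := L1_meas lV.
pose F := V @^-1` `[0, +oo[%classic; pose F' := V @^-1` `]-oo, 0[%classic.
have GF : sigma_rv D X F by apply: mV; exact: measurable_itv.
have GF' : sigma_rv D X F' by apply: mV; exact: measurable_itv.
have lF := L1_indic_mul lV (sigma_rv_measurable mX GF).
have lF' := L1_indic_mul lV (sigma_rv_measurable mX GF').
have e0 : E (fun w => `|V w|) = 0.
  transitivity (E (fun w => V w * \1_F w - V w * \1_F' w)).
    apply: Rint_ext => w _; rewrite !indicE.
    have [v0|v0] := leP 0 (V w).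
      rewrite mem_set ?memNset; [by rewrite mulr1 mulr0 subr0 ger0_norm|..].
        by rewrite /F' /= in_itv/= ltNge v0.
      by rewrite /F /= in_itv/= v0.
    rewrite memNset ?mem_set; [by rewrite mulr1 mulr0 sub0r ltr0_norm|..].
      by rewrite /F' /= in_itv.
    by rewrite /F /= in_itv/= andbT leNgt v0.
  by rewrite RintegralB// !h// subrr.
have mVE : measurable_fun setT (EFin \o V) by exact/measurable_EFinP.
have : ae_eq P setT (EFin \o V) (cst 0%E).
  apply/(ae_eq_integral_abs P measurableT mVE).
  transitivity (\int[P]_w (`|V w|)%:E)%E; first by [].
  by rewrite -(fineK (integrable_fin_num measurableT (integrable_norm lV))); congr EFin.
by apply: filterS => w /= hw wT; have := hw wT => -[].
Qed.

Lemma condexp_unique V Z W : is_condexp P (sigma_rv D X) V Z -> L1 P setT W ->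
  measurable_wrt (sigma_rv D X) W ->
  (forall F, sigma_rv D X F -> E (fun w => (V w - W w) * \1_F w) = 0) -> ae_eq P setT Z W.
Proof.
move=> cZ lW mW h; have [lV lZ mZ _] := cZ.
suff : ae_eq P setT (fun w => Z w + -1 * W w) (fun=> 0).
  by apply: filterS => w hw wT; apply/eqP; rewrite -subr_eq0 -mulN1r hw.
apply: wrt_orth0; [by apply: L1D => //; exact: L1Z|by apply: wrtD => //; exact: wrtZ|].
move=> F GF; have mF := sigma_rv_measurable mX GF.
have l1 : L1 P setT (fun w => (V w - W w) * \1_F w) by apply: L1_indic_mul => //; exact: L1B.
have l2 : L1 P setT (fun w => (V w - Z w) * \1_F w) by apply: L1_indic_mul => //; exact: L1B.
transitivity (E (fun w => (V w - W w) * \1_F w - (V w - Z w) * \1_F w)).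
  by apply: Rint_ext => w _; ring.
by rewrite RintegralB// h// condexp_orth// subrr.
Qed.

End condexp_facts.

Section conditioning.
Context (R : realType) (T : R) (T_ge0 : 0 <= T).
Context (H : completeNormedModType R) (ip : {dot H for idfun}).
Hypothesis H_hilbert : hilbert_norm ip.
Variable u : H -> R -> R.
Hypothesis u_cont : forall x, {within `[0, T], continuous (u x)}.
Variables (k : R -> H) (M : R).
Hypothesis kP : forall (s : R) x, s \in `[0, T] -> u x s = ip (k s) x.
Hypothesis kM : forall s : R, s \in `[0, T] -> `|k s| <= M.
Context d (Omega : measurableType d) (P : probability Omega R) (X : R -> Omega -> R).
Hypotheses (X_continuous : continuous_process T X) (X_gaussian : gaussian_process P T X).
Hypothesis X_centered : centered_process P T X.
Variable q : R.
Hypothesis q_ge0 : 0 <= q.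
Local Notation E := (Rintegral P setT).
Hypothesis X_cov : forall s t : R, s \in `[0, T] -> t \in `[0, T] ->
  E (fun w => X s w * X t w) = q * ip (k s) (k t).
Variables (N : nat) (a : 'I_N -> condition R) (al : 'I_N -> H) (e : 'I_N -> H).
Hypothesis alP : forall i x, capp T (a i) (u x) = ip (al i) x.
Hypothesis e_basis : padded_orthonormal_basis ip (detached_space ip T u a) e.

Local Notation aX := (fun i w => capp T (a i) (X ^~ w)).

Let TT : 0 <= T <= T. Proof. by rewrite T_ge0 lexx. Qed.

Lemma X_bound (s : R) : s \in `[0, T] -> E (fun w => X s w ^+ 2) <= q * M ^+ 2.
Proof.
move=> sT; have -> : E (fun w => X s w ^+ 2) = E (fun w => X s w * X s w).
  by apply: Rint_ext => w _; rewrite expr2.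
rewrite X_cov// H_hilbert ler_wpM2l// ler_sqr ?nnegrE// ?kM//.
by apply: le_trans (kM sT).
Qed.

(** This expresses the basis of [H_(A)] through the representers of the conditions, so that the
    random variable attached to [e j] is a combination of the [a_i(X)]. *)
Lemma e_span : exists c : 'I_N -> 'I_N -> R, forall j, e j = \sum_(i < N) c j i *: al i.
Proof.
have [_ _ [_ _ eS]] := e_basis.
suff [c cP] : {c : 'I_N -> 'I_N -> R & forall j, e j = \sum_(i < N) c j i *: al i} by exists c.
apply: (@choice _ _ (fun j (c : 'I_N -> R) => e j = \sum_(i < N) c i *: al i)) => j.
apply: (mem_span_orth H_hilbert) => y hy.
have : detached_space ip T u a (e j).
  rewrite eS; exists (fun i => (i == j)%:R); rewrite (bigD1 j)//= eqxx scale1r big1 ?addr0//.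
  by move=> i /negbTE ->; rewrite scale0r.
by apply => i; rewrite alP.
Qed.

(** The orthogonal projection on the reduced space [H^(A)]; padding zeros among the [e j] contribute
    nothing. *)
Definition residue (x : H) := x - \sum_(j < N) ip x (e j) *: e j.

Lemma residue_orth i x : ip (al i) (residue x) = 0.
Proof.
have [m mN [e1 e0 eS]] := e_basis.
have : detached_space ip T u a (al i) by move=> y hy; rewrite -alP hy.
rewrite eS => -[c ->]; rewrite ip_suml big1// => j _; rewrite ipZl.
suff -> : ip (e j) (residue x) = 0 by rewrite mulr0.
have [jm|mj] := ltnP j m; last by rewrite e0// ip0l.
rewrite /residue ipBr ip_sumr (bigD1 j)//= ipZr e1// eqxx mulr1 (ipC ip x).
rewrite big1 ?addr0 ?subrr// => l lj; rewrite ipZr.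
have [lm|ml] := ltnP l m; last by rewrite (e0 l)// !ip0r mul0r.
by rewrite e1// eq_sym (negbTE lj) mulr0.
Qed.

Lemma point_L2X (s : R) : s \in `[0, T] -> L2 P (X s).
Proof. exact: (point_L2 X_gaussian X_centered). Qed.

Lemma aX_L2 i : L2 P (aX i).
Proof. exact: (cint_path_L2 X_continuous X_gaussian X_centered X_bound TT). Qed.

Lemma aX_fubini i psi : L2 P psi ->
  E (fun w => aX i w * psi w) = capp T (a i) (fun x => E (fun w => X x w * psi w)).
Proof. exact: (cint_path_fubini X_continuous X_gaussian X_centered X_bound TT). Qed.

Lemma capp_Zu i c x (phi : R -> R) : (forall s : R, s \in `[0, T] -> phi s = c * u x s) ->
  capp T (a i) phi = c * ip (al i) x.
Proof.
move=> h; rewrite -alP /capp -cintZ; [|exact: measurable_itv0|exact: cL1_continuous].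
exact: cint_ext.
Qed.

Lemma aX_cov i (x : R) : x \in `[0, T] -> E (fun w => aX i w * X x w) = q * ip (al i) (k x).
Proof.
move=> xT; rewrite aX_fubini; last exact: point_L2X.
by apply: capp_Zu => s sT; rewrite X_cov// kP.
Qed.

Variable c : 'I_N -> 'I_N -> R.
Hypothesis ec : forall j, e j = \sum_(i < N) c j i *: al i.

(** The random variable that corresponds to the projection of [k t] on [H_(A)]: the coefficient of
    [e j] is [ip (k t) (e j) = u (e j) t], and [al i] corresponds to [a_i(X)]. *)
Definition regr (t : R) (w : Omega) : R := \sum_(j < N) u (e j) t * \sum_(i < N) c j i * aX i w.
Definition innov (t : R) (w : Omega) : R := X t w - regr t w.

Lemma regr_L2 t : L2 P (regr t).
Proof. by apply: L2_sum => j; apply: L2Z; apply: L2_sum => i; apply: L2Z; exact: aX_L2. Qed.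

Lemma innov_L2 (t : R) : t \in `[0, T] -> L2 P (innov t).
Proof. by move=> tT; apply: L2B; [exact: point_L2X|exact: regr_L2]. Qed.

Lemma trig_linear_innov (t : R) : t \in `[0, T] -> trig_linear P T X (innov t).
Proof.
move=> tT; rewrite (_ : innov t = fun w => X t w + -1 * regr t w); last first.
  by apply/funext => w; rewrite mulN1r.
apply: (trig_linearD X_gaussian X_centered); first exact: trig_linear_point.
apply: (trig_linear_sum X_gaussian X_centered) => j.
apply: (trig_linear_sum X_gaussian X_centered) => i.
exact: (trig_linear_cint X_continuous X_gaussian X_centered X_bound TT).
Qed.

Lemma regr_E t psi : L2 P psi -> E (fun w => regr t w * psi w) =
  \sum_(j < N) u (e j) t * \sum_(i < N) c j i * E (fun w => aX i w * psi w).
Proof.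
move=> lpsi.
have l1 i : L1 P setT (fun w => aX i w * psi w) by apply: L2_mul => //; exact: aX_L2.
have l2 j : L1 P setT (fun w => \sum_(i < N) c j i * (aX i w * psi w)).
  by apply: L1_sum => // i; apply: L1Z.
transitivity (E (fun w => \sum_(j < N) u (e j) t * \sum_(i < N) c j i * (aX i w * psi w))).
  apply: Rint_ext => w _; rewrite mulr_suml; apply: eq_bigr => j _.
  by rewrite -mulrA mulr_suml; congr (_ * _); apply: eq_bigr => i _; rewrite mulrA.
rewrite Rint_sum//; last by move=> j; apply: L1Z.
apply: eq_bigr => j _; rewrite RintegralZl//; congr (_ * _).
rewrite Rint_sum//; last by move=> i; apply: L1Z.
by apply: eq_bigr => i _; rewrite RintegralZl.
Qed.

Lemma innov_cov (t x : R) : t \in `[0, T] -> x \in `[0, T] ->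
  E (fun w => innov t w * X x w) = q * u (residue (k t)) x.
Proof.
move=> tT xT; have lx := point_L2X xT.
transitivity (E (fun w => X t w * X x w - regr t w * X x w)).
  by apply: Rint_ext => w _; rewrite mulrBl.
rewrite RintegralB//; [|by apply: L2_mul => //; exact: point_L2X|by apply: L2_mul => //; exact: regr_L2].
rewrite regr_E// X_cov// kP// /residue ipBr mulrBr (ipC _ (k x)); congr (_ - _).
rewrite ip_sumr mulr_sumr; apply: eq_bigr => j _.
rewrite kP// ipZr mulrCA; congr (_ * _).
rewrite [in RHS]ec ip_sumr mulr_sumr; apply: eq_bigr => i _.
by rewrite aX_cov// ipZr (ipC _ (k x)) mulrCA.
Qed.

(** Integrating the covariance of the innovation against [a i] gives [q * a_i(u x)] with [x] in the
    reduced space. *)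
Lemma innov_aX (t : R) i : t \in `[0, T] -> E (fun w => innov t w * aX i w) = 0.
Proof.
move=> tT; transitivity (E (fun w => aX i w * innov t w)).
  by apply: Rint_ext => w _; rewrite mulrC.
rewrite aX_fubini; last exact: innov_L2.
rewrite (@capp_Zu i q (residue (k t))) ?residue_orth ?mulr0// => s sT.
by rewrite -innov_cov//; apply: Rint_ext => w _; rewrite mulrC.
Qed.

Lemma innov_innov (s t : R) : s \in `[0, T] -> t \in `[0, T] ->
  E (fun w => innov s w * innov t w) = q * u (residue (k s)) t.
Proof.
move=> sT tT; rewrite -innov_cov//.
have ls := innov_L2 sT.
transitivity (E (fun w => innov s w * X t w - regr t w * innov s w)).
  by apply: Rint_ext => w _; rewrite {2}/innov; ring.
rewrite RintegralB//; [|by apply: L2_mul => //; exact: point_L2X|by apply: L2_mul => //; exact: regr_L2].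
rewrite regr_E// [X in _ - X]big1 ?subr0// => j _; rewrite big1 ?mulr0// => i _.
rewrite -[RHS](mulr0 (c j i)) -(innov_aX i sT); congr (_ * _).
by apply: Rint_ext => w _; rewrite mulrC.
Qed.

(** [trig_linear] concerns combinations of values of [X], whereas [U] combines integrals. Step sums
    [Un] approximate [U], and their covariances with the innovation tend to 0 because [a_i(u x) = 0]
    for the residue [x]. In the limit the cosine integral is 0, and so is the sine integral, since
    [kappa] is bounded by 1. *)
Lemma innov_trig_orth (t : R) U : t \in `[0, T] -> lin_span setT aX U -> trig_orth P (innov t) U.
Proof.
move=> tT sU; have [lV hV] := trig_linear_innov tT.
have l1 := L2_L1 lV.
have [Un [sUn cUn EUn]] : exists Un : nat -> Omega -> R, [/\ forall n, lin_span `[0, T] X (Un n),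
    forall w, (Un ^~ w) @ \oo --> U w &
    (fun n => E (fun w => innov t w * Un n w)) @ \oo --> (0 : R)].
  elim: sU => [|b i {}U _ sU [Un [sUn cUn EUn]]].
    exists (fun _ _ => 0); split; [by move=> _; exact: lin_span0|by move=> w; exact: cvg_cst|].
    rewrite (_ : (fun n => _) = fun=> 0); first exact: cvg_cst.
    by apply/funext => n; rewrite -[RHS](Rint_cst P); apply: Rint_ext => w _; rewrite mulr0.
  exists (fun n w => Un n w + \sum_(l < n.+2) (b * cweight (a i) T n l) * X (grid T n l) w); split.
  - by move=> n; apply: lin_span_sum => // l; exact: grid_itv.
  - move=> w; apply: cvgD => //.
    rewrite (_ : (fun n => _) = fun n => b * \sum_(l < n.+2) cweight (a i) T n l * X (grid T n l) w).
      2: by apply/funext => n; rewrite mulr_sumr; apply: eq_bigr => l _; rewrite mulrA.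
    by apply: cvgMr; apply: cvg_cint => //; case: X_continuous.
  - pose Sn n w := \sum_(l < n.+2) b * cweight (a i) T n l * X (grid T n l) w.
    pose z x := q * u (residue (k t)) x.
    pose zn n := \sum_(l < n.+2) cweight (a i) T n l * z (grid T n l).
    have -> : (fun n => E (fun w => innov t w * (Un n w + Sn n w))) =
        (fun n => E (fun w => innov t w * Un n w) + b * zn n).
      apply/funext => n; have lUn := span_L2 X_gaussian X_centered (sUn n).
      have lX (l : 'I_n.+2) : L2 P (X (grid T n l)) by apply: point_L2X; exact: grid_itv.
      pose g l w := b * cweight (a i) T n l * (innov t w * X (grid T n l) w).
      have ll (l : 'I_n.+2) : L1 P setT (g l) by apply: L1Z => //; exact: L2_mul.
      transitivity (E (fun w => innov t w * Un n w + \sum_(l < n.+2) g l w)).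
        apply: Rint_ext => w _; rewrite mulrDr mulr_sumr; congr (_ + _).
        by apply: eq_bigr => l _; rewrite /g; ring.
      rewrite RintegralD//; [|exact: L2_mul|exact: L1_sum].
      rewrite Rint_sum// mulr_sumr; congr (_ + _); apply: eq_bigr => l _.
      by rewrite RintegralZl ?innov_cov ?grid_itv//; [rewrite /z; ring|exact: L2_mul].
    have z0 : cint (a i) `[0, T] z = 0.
      by rewrite -[LHS]/(capp _ _ _) (@capp_Zu i q (residue (k t))) ?residue_orth ?mulr0.
    have cv : zn @ \oo --> (0 : R).
      rewrite -[X in _ --> X]z0; apply: cvg_cint => // x.
      by apply: cvgMr; exact: u_cont.
    have cb : (fun n => b * zn n) @ \oo --> b * 0 by exact: cvgMr.
    rewrite mulr0 in cb; rewrite -[X in _ --> X](addr0 (0 : R)).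
    exact: cvgD.
have mUn n : measurable_fun setT (Un n) by case: (span_L2 X_gaussian X_centered (sUn n)).
have lim_trig (F : R -> R) : measurable_fun setT F -> continuous F -> (forall x, `|F x| <= 1) ->
    (fun n => E (fun w => innov t w * F (Un n w))) @ \oo --> E (fun w => innov t w * F (U w)).
  move=> mF cF F1.
  apply: (Rint_dominated measurableT (g := fun w => `|innov t w|) _ _ _ _).2.
  - by move=> n; apply: measurable_funM; [case: lV|exact: measurableT_comp].
  - by move=> w _; apply: cvgMr; apply: (cvg_comp _ _ (cUn w)); exact: cF.
  - exact: integrable_norm.
  - by move=> n w _; rewrite normrM ler_piMr.
split.
  apply: (cvg_unique (@Rhausdorff R) (lim_trig cos (@measurable_cosT R) (@continuous_cos R) (@cos_max R))).
  rewrite (_ : (fun n => _) = fun=> 0); first exact: cvg_cst.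
  by apply/funext => n; rewrite (hV _ (sUn n)).1.
apply: (cvg_unique (@Rhausdorff R) (lim_trig sin (@measurable_sinT R) (@continuous_sin R) (@sin_max R))).
apply/norm_cvg0P.
apply: (@squeeze_cvgr _ _ _ _ (fun=> 0) (fun n => `|E (fun w => innov t w * Un n w)|)).
- apply: nearW => n; rewrite normr_ge0/= (hV _ (sUn n)).2 normrM ler_piMl//.
  exact: (kappa_le1 X_gaussian X_centered (sUn n)).
- exact: cvg_cst.
- by rewrite -(normr0 R); apply: cvg_norm.
Qed.

Lemma innov_sigma (t : R) F : t \in `[0, T] -> sigma_rv setT aX F ->
  E (fun w => innov t w * \1_F w) = 0.
Proof.
move=> tT; apply: trig_orth_sigma; first by move=> i _; case: (aX_L2 i).
  by apply: L2_L1; exact: innov_L2.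
by move=> U; exact: innov_trig_orth.
Qed.

Context d' (Omega' : measurableType d') (P' : probability Omega' R) (Y : R -> Omega' -> R).
Hypothesis Y_cond : conditioned_process T a P X P' Y.
Local Notation E' := (Rintegral P' setT).

(** The defining law is taken at the two Dirac conditions jointly, so that the mixed moment can be
    read off. The versions [Z] of the conditional expectations agree almost everywhere with [regr],
    hence the moments of [Y] are those of the innovations. *)
Lemma conditioned_moments (s t : R) : s \in `[0, T] -> t \in `[0, T] ->
  [/\ L2 P' (Y s), E' (Y s) = 0 & E' (fun w => Y s w * Y t w) = q * u (residue (k s)) t].
Proof.
move=> sT tT; have [Y_cont _ law] := Y_cond.
pose tau (i : 'I_2) : R := if i == 0 then s else t.
have tauT i : tau i \in `[0, T] by rewrite /tau; case: ifP.
have [Z Zc {}law] := law 2%N (fun i => dirac_charge (tau i)).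
have XE i : (fun w => capp T (dirac_charge (tau i)) (X ^~ w)) = X (tau i).
  by apply/funext => w; apply: capp_dirac => //; case: X_continuous.
have YE i : (fun w => capp T (dirac_charge (tau i)) (Y ^~ w)) = Y (tau i).
  by apply/funext => w; apply: capp_dirac => //; case: Y_cont.
have maX i : setT i -> measurable_fun setT (aX i) by move=> _; case: (aX_L2 i).
have lV i : L2 P (innov (tau i)) by exact: innov_L2.
have ZW i : ae_eq P setT (Z i) (regr (tau i)).
  have := Zc i; rewrite XE => Zci.
  apply: (condexp_unique maX Zci).
  - by apply: L2_L1; exact: regr_L2.
  - apply: wrt_sum => j; apply: wrtZ; apply: wrt_sum => l; apply: wrtZ.
    by apply: wrt_gen.
  - by move=> F; exact: innov_sigma.
have mZ i : measurable_fun setT (Z i) by have [_ lZ _ _] := Zc i; exact: L1_meas lZ.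
have mX r : r \in `[0, T] -> measurable_fun setT (X r) by case: X_continuous => mX _; exact: mX.
have mY r : r \in `[0, T] -> measurable_fun setT (Y r) by case: Y_cont => mX' _; exact: mX'.
pose V1 (w : Omega') := [tuple capp T (dirac_charge (tau i)) (Y ^~ w) | i < 2].
pose V2 (w : Omega) := [tuple capp T (dirac_charge (tau i)) (X ^~ w) - Z i w | i < 2].
have V1E i w : tnth (V1 w) i = Y (tau i) w by rewrite tnth_mktuple -YE.
have V2E i w : tnth (V2 w) i = X (tau i) w - Z i w by rewrite tnth_mktuple -XE.
have mV1 : measurable_fun setT (V1 : Omega' -> 2.-tuple (measurableTypeR R)).
  apply/measurable_fun_tnthP => i; rewrite (_ : _ \o _ = Y (tau i)); first exact: mY.
  by apply/funext => w /=; exact: V1E.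
have mV2 : measurable_fun setT (V2 : Omega -> 2.-tuple (measurableTypeR R)).
  apply/measurable_fun_tnthP => i; rewrite (_ : _ \o _ = fun w => X (tau i) w - Z i w).
    by apply: measurable_funB => //; exact: mX.
  by apply/funext => w /=; exact: V2E.
have mt i : measurable_fun setT (fun p : 2.-tuple (measurableTypeR R) => tnth p i) by exact: measurable_tnth.
have transf (phi : 2.-tuple (measurableTypeR R) -> R) : measurable_fun setT phi ->
   L1 P setT (fun w => phi [tuple innov (tau i) w | i < 2]) ->
   L1 P' setT (fun w => phi (V1 w)) /\
   E' (fun w => phi (V1 w)) = E (fun w => phi [tuple innov (tau i) w | i < 2]).
  move=> mphi lphi.
  have [l2 e2] : L1 P setT (fun w => phi (V2 w)) /\
      E (fun w => phi [tuple innov (tau i) w | i < 2]) = E (fun w => phi (V2 w)).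
    apply: Rint_ae_eq => //; first exact: measurableT_comp.
    have h0 := ZW 0; have h1 := ZW 1.
    move: h0 h1; apply: filterS2 => w h0 h1 wT.
    congr phi; apply: eq_from_tnth => i; rewrite V2E tnth_mktuple /innov; congr (_ - _).
    have [->|i0] := eqVneq i 0; first by rewrite h0.
    by have -> : i = 1; [apply/val_inj; case: i i0 => -[|[]]|rewrite h1].
  split; last by rewrite e2; apply: same_law_Rint.
  by apply: (same_law_integrable mV2 mV1 _ mphi l2) => B mB; exact/esym/law.
have E0 r : r \in `[0, T] -> E (innov r) = 0.
  move=> rT; have [_ h] := trig_linear_innov rT.
  have [h1 _] := h _ (lin_span0 _ _); rewrite -[RHS]h1.
  by apply: Rint_ext => w _; rewrite cos0 mulr1.
have tup w i : tnth [tuple innov (tau i) w | i < 2] i = innov (tau i) w by rewrite tnth_mktuple.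
have V1_0 w : tnth (V1 w) 0 = Y s w by rewrite V1E.
have V1_1 w : tnth (V1 w) 1 = Y t w by rewrite V1E.
split.
- split; first exact: mY.
  have [|h _] := transf (fun p => tnth p 0 ^+ 2) (measurable_funX 2 (mt 0)).
    by apply: (L1_ext measurableT _ (lV 0).2) => w _; rewrite tup.
  by apply: (L1_ext measurableT _ h) => w _; rewrite V1_0.
- have [|_ h] := transf (fun p => tnth p 0) (mt 0).
    by apply: (L1_ext measurableT _ (L2_L1 (lV 0))) => w _; rewrite tup.
  rewrite (_ : Y s = fun w => tnth (V1 w) 0); last by apply/funext => w; rewrite V1_0.
  rewrite h -[RHS](E0 s sT); apply: Rint_ext => w _; exact: tup.
- have [|_ h] := transf (fun p => tnth p 0 * tnth p 1) (measurable_funM (mt 0) (mt 1)).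
    by apply: (L1_ext measurableT _ (L2_mul (lV 0) (lV 1))) => w _; rewrite !tup.
  transitivity (E' (fun w => tnth (V1 w) 0 * tnth (V1 w) 1)).
    by apply: Rint_ext => w _; rewrite V1_0 V1_1.
  rewrite h -innov_innov//.
  by apply: Rint_ext => w _; rewrite !tup.
Qed.

End conditioning.

(** * Prediction *)

Section prediction.
Context (R : realType) (T : R).
Context (H : completeNormedModType R) (ip : {dot H for idfun}).
Variable u : H -> R -> R.
Hypothesis u_cont : forall x, {within `[0, T], continuous (u x)}.
Variables (k : R -> H) (C : R).
Hypothesis kP : forall (s : R) x, s \in `[0, T] -> u x s = ip (k s) x.
Context d (Omega : measurableType d) (P : probability Omega R) (Y : R -> Omega -> R).
Hypotheses (Y_continuous : continuous_process T Y) (Y_gaussian : gaussian_process P T Y).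
Hypothesis Y_centered : centered_process P T Y.
Hypothesis Y_bound : forall s : R, s \in `[0, T] -> Rintegral P setT (fun w => Y s w ^+ 2) <= C.
Variable q : R.
Local Notation E := (Rintegral P setT).
Variables (N : nat) (a : 'I_N -> condition R) (al : 'I_N -> H) (e : 'I_N -> H).
Hypothesis alP : forall i x, capp T (a i) (u x) = ip (al i) x.
Hypothesis al_residue : forall i x, ip (al i) (residue ip e x) = 0.
Hypothesis Y_cov : forall s t : R, s \in `[0, T] -> t \in `[0, T] ->
  E (fun w => Y s w * Y t w) = q * u (residue ip e (k s)) t.
Variables f g : R -> R.
Hypothesis fg : forall s t : R, s \in `[0, T] -> t \in `[0, T] -> s <= t ->
  q * ip (k s) (k t) = f s * g t.

Variables (s t : R) (s_ge0 : 0 <= s) (st : s < t) (tT : t <= T).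
Local Notation D := (D_matrix T u g a e s).
Local Notation dv := (fun l w => d_vector a Y s w l 0).

Let s0T : 0 <= s <= T. Proof. by rewrite s_ge0 (ltW (lt_le_trans st tT)). Qed.
Let sI : s \in `[0, T]. Proof. by rewrite in_itv. Qed.
Let tI : t \in `[0, T]. Proof. by rewrite in_itv/= tT (le_trans s_ge0 (ltW st)). Qed.
Let T_ge0 : 0 <= T. Proof. by case/andP: s0T; exact: le_trans. Qed.
Let rI (r : R) : r \in `[0, s] -> r \in `[0, T].
Proof. by case/andP: s0T => _ sT; rewrite !in_itv/= => /andP[-> rs]; rewrite (le_trans rs). Qed.

Lemma d_vector_wrt l : measurable_wrt (natural_filtration Y s) (dv l).
Proof.
rewrite -(@fintype.splitK 1 N l); case: (fintype.split l) => i /=.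
  rewrite (_ : dv _ = Y s); last first.
    by apply/funext => w; rewrite /d_vector col_mxEu (ord1 i) mxE eqxx.
  by apply: wrt_gen => /=; rewrite in_itv/= s_ge0 lexx.
rewrite (_ : dv _ = fun w => -1 * cint (a i) `[0, s] (Y ^~ w)); last first.
  by apply/funext => w; rewrite /d_vector col_mxEd mxE mulN1r.
by apply: wrtZ; exact: (cint_path_wrt Y_continuous s0T).
Qed.

Lemma d_vector_trig_linear l : trig_linear P T Y (dv l).
Proof.
rewrite -(@fintype.splitK 1 N l); case: (fintype.split l) => i /=.
  rewrite (_ : dv _ = Y s); last first.
    by apply/funext => w; rewrite /d_vector col_mxEu (ord1 i) mxE eqxx.
  exact: trig_linear_point.
rewrite (_ : dv _ = fun w => 0 + -1 * cint (a i) `[0, s] (Y ^~ w)); last first.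
  by apply/funext => w; rewrite /d_vector col_mxEd mxE mulN1r add0r.
apply: (trig_linearD Y_gaussian Y_centered); first exact: trig_linear0.
exact: (trig_linear_cint Y_continuous Y_gaussian Y_centered Y_bound s0T).
Qed.

(* Since [E Y_r Y_x = f r * g x - \sum_j q * u (e j) r * u (e j) x] for
   [r <= s <= x], these are the coordinates of [E Y_r Y_x] on the functions
   [g], [u (e j)]. *)
Definition past_coord (r : R) : 'cV[R]_(1 + N) :=
  col_mx (f r)%:M (\col_j - (q * u (e j) r)).

Lemma cov_future (r x : R) : r \in `[0, s] -> x \in `[0, T] -> s <= x ->
  q * u (residue ip e (k r)) x = f r * g x + \sum_(j < N) - (q * u (e j) r) * u (e j) x.
Proof.
move=> rs xT sx; have rT := rI rs.
have rx : r <= x by move: rs; rewrite in_itv/= => /andP[_ /le_trans]; apply.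
rewrite kP// /residue ipBr mulrBr (ipC _ (k x)) fg//; congr (_ + _).
rewrite ip_sumr mulr_sumr -sumrN; apply: eq_bigr => j _.
by rewrite ipZr -!kP//; ring.
Qed.

(** The factorisation through [g] holds only at times after [s], whereas the integrals in [d_vector]
    are over the past. Their minus sign makes the two fit: since the integral of the covariance over
    [[0, T]] vanishes, minus its integral over [[0, s]] is the one over []s, T]]. *)
Lemma d_vector_cov (r : R) l : r \in `[0, s] ->
  E (fun w => dv l w * Y r w) = (D *m past_coord r) l 0.
Proof.
move=> rs; have rT := rI rs.
have lY : L2 P (Y r) := point_L2 Y_gaussian Y_centered rT.
rewrite /D_matrix /past_coord mul_block_col.
rewrite -(@fintype.splitK 1 N l); case: (fintype.split l) => i /=.
  rewrite col_mxEu (ord1 i) !mxE big_ord1 !mxE eqxx.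
  transitivity (E (fun w => Y r w * Y s w)).
    by apply: Rint_ext => w _; rewrite /d_vector col_mxEu mxE eqxx mulrC.
  rewrite Y_cov// cov_future//; first rewrite mulrC mulr1n.
  by congr (_ + _); apply: eq_bigr => j _; rewrite !mxE mulrC.
rewrite col_mxEd mxE mxE big_ord1 !mxE eqxx mulr1n.
transitivity (E (fun w => -1 * (cint (a i) `[0, s] (Y ^~ w) * Y r w))).
  by apply: Rint_ext => w _; rewrite /d_vector col_mxEd mxE mulN1r mulNr.
have lc := cint_path_L2 Y_continuous Y_gaussian Y_centered Y_bound s0T (a i).
rewrite RintegralZl//; last exact: L2_mul.
rewrite (cint_path_fubini Y_continuous Y_gaussian Y_centered Y_bound s0T)//.
pose z x := q * u (residue ip e (k r)) x.
have z_cont : {within `[0, T], continuous z} by move=> x; apply: cvgMr; exact: u_cont.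
have -> : cint (a i) `[0, s] (fun x => E (fun w => Y x w * Y r w)) = cint (a i) `[0, s] z.
  apply: cint_ext => x /rI xT; rewrite /z -Y_cov//.
  by apply: Rint_ext => w _; rewrite mulrC.
have z0 : cint (a i) `[0, T] z = 0.
  rewrite cintZ; [|exact: measurable_itv0|exact: cL1_continuous].
  by rewrite -[cint _ _ _]/(capp _ _ _) alP al_residue mulr0.
have -> : -1 * cint (a i) `[0, s] z = cint (a i) `]s, T] z.
  have := cint_split (a i) s0T z_cont; rewrite z0 => /esym/eqP.
  by rewrite addrC addr_eq0 mulN1r => /eqP ->.
have mI : measurable (`]s, T]%classic : set (measurableTypeR R)) by exact: measurable_itv.
have sub : `]s, T]%classic `<=` (`[0, T]%classic : set R).
  by move=> x /=; rewrite !in_itv/= => /andP[/ltW sx ->]; rewrite (le_trans s_ge0 sx).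
have lu x : cL1 (a i) `]s, T]%classic (u x).
  by apply: (cL1S (E := `[0, T]%classic)) => //; exact: cL1_continuous.
have zE x : `]s, T]%classic x -> z x = f r * g x + \sum_(j < N) - (q * u (e j) r) * u (e j) x.
  move=> sx; rewrite /z cov_future//; first exact: sub.
  by move: sx; rewrite /= in_itv/= => /andP[/ltW].
have lsum : cL1 (a i) `]s, T]%classic (fun x => \sum_(j < N) - (q * u (e j) r) * u (e j) x).
  by apply: cL1_sum => // j; exact: cL1Z.
have sumE : cint (a i) `]s, T] (fun x => \sum_(j < N) - (q * u (e j) r) * u (e j) x) =
    \sum_j (\matrix_(i0, j0) cint (a i0) `]s, T] (u (e j0))) i j * (\col_j0 - (q * u (e j0) r)) j 0.
  rewrite cint_sum//; last by move=> j; exact: cL1Z.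
  by apply: eq_bigr => j _; rewrite cintZ// !mxE mulrC.
(* [g] need not be integrable on [`]s, T]] when [f r = 0]; otherwise it is there
   a multiple of the continuous function [u (k r)]. *)
have [f0|f0] := eqVneq (f r) 0.
  rewrite f0 mulr0 add0r -sumE; apply: cint_ext => x sx.
  by rewrite zE// f0 mul0r add0r.
have lg : cL1 (a i) `]s, T]%classic (fun x => f r * g x).
  have h x : `]s, T]%classic x -> q * u (k r) x = f r * g x.
    move=> sx; rewrite kP; last exact: sub.
    rewrite ipC fg//; first exact: sub.
    move: rs sx; rewrite /= !in_itv/= => /andP[_ rs] /andP[sx _].
    exact: le_trans rs (ltW sx).
  have [l1 l2] := cL1Z q mI (lu (k r)).
  by split; [apply: (L1_ext mI h l1)|apply: (L1_ext mI h l2)].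
have lg' : cL1 (a i) `]s, T]%classic g.
  have [l1 l2] := cL1Z (f r)^-1 mI lg.
  have h x : `]s, T]%classic x -> (f r)^-1 * (f r * g x) = g x by rewrite mulKf.
  by split; [apply: (L1_ext mI h l1)|apply: (L1_ext mI h l2)].
by rewrite (cint_ext _ zE) cintD// cintZ// sumE mulrC.
Qed.

Definition future_row : 'rV[R]_(1 + N) := row_mx (g t)%:M (\row_j u (e j) t).

Lemma future_rowE (xi : 'cV[R]_(1 + N)) : (future_row *m xi) 0 0 =
  xi (lshift N 0) 0 * g t + \sum_(i < N) xi (rshift 1 i) 0 * u (e i) t.
Proof.
rewrite -[in LHS](vsubmxK xi) /future_row mul_row_col mxE; congr (_ + _).
  by rewrite mxE big_ord1 !mxE eqxx mulr1n mulrC; congr (xi _ _ * _); apply/val_inj.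
by rewrite mxE; apply: eq_bigr => i _; rewrite !mxE mulrC.
Qed.

Lemma cov_future_row (r : R) : r \in `[0, s] ->
  E (fun w => Y t w * Y r w) = (future_row *m past_coord r) 0 0.
Proof.
move=> rs; transitivity (E (fun w => Y r w * Y t w)).
  by apply: Rint_ext => w _; rewrite mulrC.
rewrite Y_cov ?(rI rs)// cov_future ?(ltW st)// future_rowE /past_coord col_mxEu mxE eqxx mulr1n.
by congr (_ + _); apply: eq_bigr => j _; rewrite col_mxEd mxE.
Qed.

Lemma prediction_zero : future_row = 0 -> is_condexp P (natural_filtration Y s) (Y t) (fun=> 0).
Proof.
move=> row0.
have mY r : `[0, s]%classic r -> measurable_fun setT (Y r).
  by move=> /rI rT; case: Y_continuous => mY _; exact: mY.
apply: orth_condexp => //.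
- by apply: L2_L1; exact: (point_L2 Y_gaussian Y_centered).
- exact: L2_L1 (L2_cst P 0).
- exact: wrt_cst.
move=> F GF; transitivity (E (fun w => Y t w * \1_F w)).
  by apply: Rint_ext => w _; rewrite subr0.
apply: (trig_linear_orth Y_gaussian Y_centered _ _ _ GF); first by move=> r; exact: rI.
  exact: trig_linear_point.
by move=> r rs; rewrite cov_future_row// row0 mul0mx mxE.
Qed.

Hypothesis D_unit : D \in unitmx.

Lemma prediction_unit :
  is_condexp P (natural_filtration Y s) (Y t)
    (fun w => let xi := invmx D *m d_vector a Y s w in
       xi (lshift N 0) 0 * g t + \sum_(i < N) xi (rshift 1 i) 0 * u (e i) t).
Proof.
(* Grouping the inverse with the row makes the predictor a combination of the entries of [d_vector]
   with deterministic coefficients, to which linearity of [trig_linear] applies. *)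
pose nu := future_row *m invmx D.
rewrite (_ : (fun w => _) = fun w => \sum_l nu 0 l * dv l w); last first.
  apply/funext => w /=; rewrite -future_rowE.
  by rewrite mulmxA mxE.
have mY r : `[0, s]%classic r -> measurable_fun setT (Y r).
  by move=> /rI rT; case: Y_continuous => mY _; exact: mY.
have lY r : r \in `[0, T] -> L2 P (Y r) by exact: (point_L2 Y_gaussian Y_centered).
have tl_sum := trig_linear_sum Y_gaussian Y_centered (fun l => nu 0 l) d_vector_trig_linear.
have tl : trig_linear P T Y (fun w => Y t w + -1 * \sum_l nu 0 l * dv l w).
  by apply: (trig_linearD Y_gaussian Y_centered) => //; exact: trig_linear_point.
apply: orth_condexp => //.
- by apply: L2_L1; exact: lY.
- by apply: L2_L1; exact: tl_sum.1.
- by apply: wrt_sum => l; apply: wrtZ; exact: d_vector_wrt.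
move=> F GF.
transitivity (E (fun w => (Y t w + -1 * \sum_l nu 0 l * dv l w) * \1_F w)).
  by apply: Rint_ext => w _; rewrite mulN1r.
apply: (trig_linear_orth Y_gaussian Y_centered _ tl _ GF); first by move=> r; exact: rI.
move=> r rs; have rT := rI rs; have lr := lY r rT.
have ll l : L1 P setT (fun w => dv l w * Y r w).
  by apply: L2_mul => //; exact: (d_vector_trig_linear l).1.
transitivity (E (fun w => Y t w * Y r w - \sum_l nu 0 l * (dv l w * Y r w))).
  apply: Rint_ext => w _; rewrite mulrDl mulN1r mulNr mulr_suml; congr (_ - _).
  by apply: eq_bigr => l _; rewrite mulrA.
rewrite RintegralB//; [|exact: L2_mul (lY t tI) lr|by apply: L1_sum => // l; exact: L1Z].
rewrite Rint_sum//; last by move=> l; exact: L1Z.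
rewrite (eq_bigr (fun l => nu 0 l * (D *m past_coord r) l 0)); last first.
  by move=> l _; rewrite RintegralZl// d_vector_cov.
rewrite cov_future_row//; apply/eqP; rewrite subr_eq0; apply/eqP.
transitivity ((nu *m (D *m past_coord r)) 0 0); last by rewrite mxE.
by rewrite mulmxA mulmxKV.
Qed.

End prediction.

(** * Existence of conditional expectations and conclusion *)

Section factored_condexp.
Context d (Omega : measurableType d) (R : realType) (P : probability Omega R).
Context d0 (S : measurableType d0) (phi : Omega -> S).
Hypothesis mphi : measurable_fun setT phi.
Variables (V : Omega -> R) (lV : L1 P setT V).

Let mu (A : set S) : \bar R := P (phi @^-1` A).
Let nu (A : set S) : \bar R := induced_charge lV (phi @^-1` A).

Let mpre A : measurable A -> measurable (phi @^-1` A).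
Proof. by move=> mA; rewrite -[X in measurable X]setTI; exact: mphi. Qed.

Let mu0 : mu set0 = 0%E. Proof. by rewrite /mu preimage_set0 measure0. Qed.
Let mu_ge0 A : (0 <= mu A)%E. Proof. exact: measure_ge0. Qed.
Let mu_add : semi_sigma_additive mu.
Proof.
move=> F mF tF mUF; rewrite /mu preimage_bigcup; apply: measure_semi_sigma_additive.
- by move=> n; exact: mpre.
- apply/trivIsetP => /= i j _ _ ij; rewrite -preimage_setI.
  by move/trivIsetP : tF => /(_ _ _ _ _ ij) ->//; rewrite preimage_set0.
- by rewrite -preimage_bigcup; exact: mpre.
Qed.
HB.instance Definition _ := isMeasure.Build _ _ _ mu mu0 mu_ge0 mu_add.
Let mu_fin : fin_num_fun mu.
Proof. by move=> A mA; apply: fin_num_measure; exact: mpre. Qed.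
HB.instance Definition _ := Measure_isFinite.Build _ _ _ mu mu_fin.

Let nu0 : nu set0 = 0%E. Proof. by rewrite /nu preimage_set0 charge0. Qed.
Let nu_fin A : measurable A -> nu A \is a fin_num.
Proof. by move=> mA; apply: fin_num_measure; exact: mpre. Qed.
Let nu_add : semi_sigma_additive nu.
Proof.
move=> F mF tF mUF; rewrite /nu preimage_bigcup; apply: charge_semi_sigma_additive.
- by move=> n; exact: mpre.
- apply/trivIsetP => /= i j _ _ ij; rewrite -preimage_setI.
  by move/trivIsetP : tF => /(_ _ _ _ _ ij) ->//; rewrite preimage_set0.
- by rewrite -preimage_bigcup; exact: mpre.
Qed.
HB.instance Definition _ := isCharge.Build _ _ _ nu nu0 nu_fin nu_add.

(** [Z] is the Radon-Nikodym derivative, on the target of [phi], of the image of the charge with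
    density [V] with respect to the image of [P]. *)
Lemma exists_factored_condexp : exists Z : S -> R, [/\ measurable_fun setT Z,
  L1 P setT (fun w => Z (phi w)) &
  forall A, measurable A ->
    (\int[P]_(w in phi @^-1` A) (Z (phi w))%:E = \int[P]_(w in phi @^-1` A) (V w)%:E)%E].
Proof.
have numu : nu `<< mu.
  apply/null_content_dominatesP => A mA muA.
  apply: null_set_integral => //; first exact: mpre.
  by apply: measurable_funTS; exact: (measurable_int P).
pose f := Radon_Nikodym nu mu.
have fin x : f x \is a fin_num by exact: Radon_Nikodym_fin_num.
have intf : mu.-integrable setT f by exact: Radon_Nikodym_integrable.
pose Z x := fine (f x).
have ZE : f = EFin \o Z by apply/funext => x; rewrite /= fineK.
have mf : measurable_fun setT f by exact: measurable_int intf.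
have mZ : measurable_fun setT Z by apply/measurable_EFinP; rewrite -ZE.
have lZ : L1 P setT (fun w => Z (phi w)).
  apply/integrableP; split.
    by apply/measurable_EFinP; exact: measurableT_comp.
  case/integrableP : intf => _; apply: le_lt_trans.
  rewrite le_eqVlt; apply/orP; left; apply/eqP.
  have mabs : measurable_fun setT (fun x => `|f x|%E) by exact: measurableT_comp.
  have h := @ge0_integral_pushforward _ _ _ _ R phi mphi P setT (fun x => `|f x|%E) measurableT
     mabs (fun x _ => abse_ge0 _).
  rewrite preimage_setT in h; rewrite -[RHS]/(\int[pushforward P phi]_x `|f x|%E)%E h.
  by rewrite ZE.
exists Z; split => // A mA.
have h := @integral_pushforward _ _ _ _ R phi mphi P A f mf.
transitivity (\int[P]_(w in phi @^-1` A) (f \o phi) w)%E; first by rewrite ZE.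
rewrite -h//; last by rewrite ZE; apply: (integrableS measurableT) => //; exact: mpre.
by rewrite -[LHS]/(\int[mu]_(x in A) f x)%E -Radon_Nikodym_integral.
Qed.

End factored_condexp.

Lemma exists_condexp d (Omega : measurableType d) (R : realType) (P : probability Omega R)
    (I : Type) (D : set I) (X : I -> Omega -> R) (V : Omega -> R) :
  (forall i, D i -> measurable_fun setT (X i)) -> L1 P setT V ->
  exists Z, is_condexp P (sigma_rv D X) V Z.
Proof.
move=> mX lV.
(* The target is the same set with the smaller sigma-algebra, and [phi] is the identity;
   measurability on the target is then measurability for [sigma_rv D X]. *)
pose MT := g_sigma_algebraType (\bigcup_(i in D)
  preimage_set_system setT (X i : Omega -> measurableTypeR R) measurable).
have mphi : measurable_fun [set: Omega] (idfun : Omega -> MT).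
  by move=> _ B mB; rewrite setTI; exact: (sigma_rv_measurable mX mB).
have [Z [mZ lZ ZE]] := exists_factored_condexp mphi lV.
exists Z; split; [exact: lV|exact: lZ|exact/measurable_wrtE|].
by move=> F GF; exact: (ZE F GF).
Qed.

Theorem theorem5p2 (R : realType) (T : R) (T_gt0 : 0 < T)
  (H : completeNormedModType R) (ip : {dot H for idfun})
  (H_hilbert : hilbert_norm ip) (H_separable : separable_space H)
  (u : H -> R -> R) (u_op : bounded_operator T u)
  (d : measure_display) (Omega : measurableType d) (P : probability Omega R)
  (X : R -> Omega -> R)
  (X_continuous : continuous_process T X)
  (X_gaussian : gaussian_process P T X)
  (X_centered : centered_process P T X)
  (X_generated : generated_by ip T u P X)
  (X_markov : markov_process P T X)
  (X_covar : forall s t, 0 < s < T -> 0 < t < T -> covar P X s t <> 0%E)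
  (f g : R -> R) (fg_X : markov_factorization P T X f g)
  (N : nat) (a : 'I_N -> condition R)
  (d' : measure_display) (Omega' : measurableType d')
  (P' : probability Omega' R) (Y : R -> Omega' -> R)
  (Y_cond : conditioned_process T a P X P' Y)
  (e : 'I_N -> H)
  (e_basis : padded_orthonormal_basis ip (detached_space ip T u a) e) :
  forall s t : R, 0 <= s -> s < t -> t <= T ->
  exists xi : Omega' -> 'cV[R]_(1 + N),
    [/\ forall i, measurable_wrt (natural_filtration Y s) (fun w => xi w i 0),
        is_condexp P' (natural_filtration Y s) (Y t)
          (fun w => xi w (lshift N 0) 0 * g t
                    + \sum_(i < N) xi w (rshift 1 i) 0 * u (e i) t) &
        D_matrix T u g a e s \in unitmx ->
          forall w, xi w = invmx (D_matrix T u g a e s) *m d_vector a Y s w].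
Proof.
move=> s t s0 st tT.
have T_ge0 : 0 <= T by exact: ltW.
have u_cont : forall x, {within `[0, T], continuous (u x)} by case: u_op.
have [k [M [M0 kP kM]]] := exists_kernel H_hilbert H_separable u_op.
have [al alP] : {al : 'I_N -> H & forall i x, capp T (a i) (u x) = ip (al i) x}.
  apply: (@choice _ _ (fun i v => forall x, capp T (a i) (u x) = ip v x)) => i.
  exact: exists_representer.
pose q := normal_m2 R.
have q_ge0 : 0 <= q by exact: ltW (normal_m2_gt0 R).
have X_cov := process_covariance H_hilbert H_separable X_generated X_gaussian X_centered kP.
have fg (r v : R) : r \in `[0, T] -> v \in `[0, T] -> r <= v -> q * ip (k r) (k v) = f r * g v.
  move=> rT vT rv; rewrite -X_cov//; case: fg_X => /(_ r v rT vT) + _ _.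
  by rewrite /covar unlock /Rintegral (min_idPl rv) (max_idPr rv) => ->.
have [c ec] := e_span H_hilbert alP e_basis.
have al_residue i x : ip (al i) (residue ip e x) = 0 := residue_orth alP e_basis i x.
have [Y_continuous Y_gaussian _] := Y_cond.
have mom (r v : R) : r \in `[0, T] -> v \in `[0, T] -> _ :=
  conditioned_moments T_ge0 H_hilbert u_cont kP kM X_continuous X_gaussian X_centered q_ge0 X_cov
    alP e_basis ec Y_cond (s := r) (t := v).
have Y_cov (r v : R) : r \in `[0, T] -> v \in `[0, T] ->
    Rintegral P' setT (fun w => Y r w * Y v w) = q * u (residue ip e (k r)) v.
  by move=> rT vT; case: (mom r v rT vT).
have Y_centered : centered_process P' T Y.
  move=> r rT; have [lY EY _] := mom r r rT rT.
  by rewrite unlock -(fineK (integrable_fin_num measurableT (L2_L1 lY))); congr EFin.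
(* Conditioning lowers the variance: [E Y_r^2] is [q] times [|k r|^2] minus a sum of squares of the
   [ip (k r) (e j)]. *)
have Y_bound (r : R) : r \in `[0, T] -> Rintegral P' setT (fun w => Y r w ^+ 2) <= q * M ^+ 2.
  move=> rT; rewrite (_ : Rintegral _ _ _ = q * u (residue ip e (k r)) r); last first.
    by rewrite -Y_cov//; apply: Rint_ext => w _; rewrite expr2.
  rewrite ler_wpM2l// kP// /residue ipBr H_hilbert ip_sumr.
  apply: (@le_trans _ _ (`|k r| ^+ 2)); last by rewrite ler_sqr ?nnegrE ?kM.
  by rewrite gerBl sumr_ge0// => j _; rewrite ipZr -expr2 sqr_ge0.
have s0T : 0 <= s <= T by rewrite s0 (ltW (lt_le_trans st tT)).
have mY (r : R) : `[0, s]%classic r -> measurable_fun setT (Y r).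
  move=> rs; have [mY _] := Y_continuous; apply: mY; move: rs; rewrite /= !in_itv/= => /andP[-> rs].
  by rewrite (le_trans rs)//; case/andP: s0T.
have lYt : L1 P' setT (Y t).
  have tI : t \in `[0, T] by rewrite in_itv/= tT (le_trans s0 (ltW st)).
  by have [lY _ _] := mom t t tI tI; exact: (L2_L1 lY).
have [D_unit|D_sing] := boolP (D_matrix T u g a e s \in unitmx).
  exists (fun w => invmx (D_matrix T u g a e s) *m d_vector a Y s w); split => //.
    move=> i; rewrite (_ : (fun w => _) = fun w =>
      \sum_l invmx (D_matrix T u g a e s) i l * d_vector a Y s w l 0).
      by apply: wrt_sum => l; apply: wrtZ; exact: (d_vector_wrt Y_continuous _ s0 st tT).
    by apply/funext => w; rewrite mxE.
  exact: (prediction_unit u_cont kP Y_continuous Y_gaussian Y_centered Y_bound alP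
    al_residue Y_cov fg s0 st tT).
case: (pickP (fun l => future_row u e g t 0 l != 0)) => [l row_l|row0].
  have [Z Zc] := exists_condexp mY lYt.
  have [_ _ mZ _] := Zc.
  exists (fun w => \col_i if i == l then (future_row u e g t 0 l)^-1 * Z w else 0); split => //.
    move=> i; case: (eqVneq i l) => [->|il].
      rewrite (_ : (fun w => _) = fun w => (future_row u e g t 0 l)^-1 * Z w); first exact: wrtZ.
      by apply/funext => w; rewrite mxE eqxx.
    rewrite (_ : (fun w => _) = fun=> 0); first exact: wrt_cst.
    by apply/funext => w; rewrite mxE (negbTE il).
  rewrite (_ : (fun w => _) = Z)//; apply/funext => w.
  rewrite -future_rowE mxE (bigD1 l)//= mxE eqxx mulVKf// big1 ?addr0// => i /negbTE il.
  by rewrite mxE il mulr0.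
exists (fun=> 0); split => //.
  by move=> i; rewrite (_ : (fun w => _) = fun=> 0); [exact: wrt_cst|apply/funext => w; rewrite mxE].
rewrite (_ : (fun w => _) = fun=> 0); last first.
  by apply/funext => w; rewrite -(future_rowE u e g t) mulmx0 mxE.
apply: (prediction_zero kP Y_continuous Y_gaussian Y_centered Y_cov fg s0 st tT).
by apply/rowP => l; apply/eqP; rewrite [X in _ == X]mxE; apply/negPn; rewrite row0.
Qed.
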